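(* There exists a sequence of tuples $(P_i, \mathbf{v}_i, f_i)_{i=1}^{\infty}$, where $P_i\subset\mathbb{R}^3$ is a polyhedron (not required to be convex), $\mathbf{v}_i$ is a vertex of $P_i$ and $f_i$ is a face (two-dimensional facet) of $P_i$, satisfying (B1) $\operatorname{diam}(P_i) = 1$ for all $i$; (B2) $f_i$ lies in the $xy$-plane for all $i$; (B3) $\mathbf{v}_i$ lies on the positive $z$-axis for all $i$; (B4) there exists a constant $c_v>0$ (independent of $i$) such that $\operatorname{dist}(\mathbf{o}, \partial f_i) > c_v$ for all $i$, where $\partial f_i$ is the boundary of $f_i$ and $\mathbf{o}$ is the origin; (B5) $\operatorname{dist}(\mathbf{v}_i, f_i) \rightarrow 0$ as $i\rightarrow \infty$; and such that, for the function $u(x,y,z) = x^2 + y^2$ and some real number $C$, $$\lim_{i\rightarrow \infty} \frac{ |u-I_{P_i} u|_{H^1(P_i)} }{ |u|_{H^2(P_i)} } = C< \infty,$$ where $I_{P_i}u$ is the harmonic-coordinate interpolant of $u$ on $P_i$.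
   Context: Sobolev seminorms: $|w|_{H^m(P)}^2 = \int_P \sum_{|\alpha|=m} |D^\alpha w|^2$. Harmonic interpolant on a polyhedron $P$: given $u\in H^2(P)$, let $g_u:\partial P\to\mathbb{R}$ be the boundary interpolant of the vertex values of $u$. On each triangular facet, $g_u$ is the affine function equal to $u$ at the three vertices. On a non-triangular facet $F$ with vertices $\mathbf{w}_1,\dots,\mathbf{w}_k$, $g_u=\sum_j u(\mathbf{w}_j)\lambda_j$, where $(\lambda_j)$ is a chosen set of two-dimensional generalized barycentric coordinates on $F$, i.e. functions with $\lambda_j\ge 0$ on $F$ and $L=\sum_j L(\mathbf{w}_j)\lambda_j$ for every affine function $L$ on $F$ (chosen regular enough, e.g. so that $g_u$ is the trace of an $H^1(P)$ function). Then $I_P u\in H^1(P)$ is the (unique, weak) solution of $\Delta(I_P u)=0$ in $P$, $I_P u = g_u$ on $\partial P$. For polyhedra all of whose facets are triangles, $g_u$ is simply the continuous piecewise affine interpolant of $u$ on $\partial P$. *)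

(* Defs.v *)
From HB Require Import structures.
From mathcomp Require Import all_boot all_order all_algebra.
From mathcomp Require Import all_classical all_reals all_analysis.

Set Implicit Arguments.
Unset Strict Implicit.
Unset Printing Implicit Defensive.

Import Order.TTheory GRing.Theory Num.Theory.
Import numFieldTopology.Exports numFieldNormedType.Exports.

Local Open Scope classical_set_scope.
Local Open Scope ring_scope.

(* A point (x, y, z) of R^3 is p with x = p.1.1, y = p.1.2, z = p.2. The
   library norm on this product is the sup norm, which induces the usual
   topology; Euclidean lengths go through [dist]. *)
Notation pt3 R := (R * R * R)%type (only parsing).

Section Euclid.
Context {R : realType}.
Implicit Types (p q n : pt3 R) (A H : set (pt3 R)).

Definition inner p q : R := p.1.1 * q.1.1 + p.1.2 * q.1.2 + p.2 * q.2.

Definition dist p q : R := Num.sqrt (inner (p - q) (p - q)).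

Definition diam A : R :=
  sup [set r : R | exists p q, [/\ A p, A q & r = dist p q]].

Definition dist_set p A : R := inf [set dist p q | q in A].

Definition affine (L : pt3 R -> R) : Prop :=
  exists n (d : R), forall p, L p = inner n p + d.

Definition segment p q : set (pt3 R) :=
  [set x | exists2 t : R, 0 <= t <= 1 & x = (1 - t) *: p + t *: q].

Definition plane n (d : R) : set (pt3 R) := [set p | inner n p = d].

Definition relint H A : set (pt3 R) :=
  [set p | A p /\ \forall q \near within H (nbhs p), A q].

End Euclid.

Section Polyhedron.
Context {R : realType}.

Definition edge_of (V : eqType) (c : seq V) (i j : V) : bool :=
  [&& i \in c, j \in c & (next c i == j) || (next c j == i)].

(* the union of the edges of the closed polygon with vertex cycle c *)
Definition closed_polygon (V : eqType) (x : V -> pt3 R) (c : seq V) :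
    set (pt3 R) :=
  [set p | exists2 i, i \in c & segment (x i) (x (next c i)) p].

(* A compact solid bounded by a closed polyhedral surface; neither the solid
   nor its facets need be convex. Facets are maximal planar pieces (facets
   sharing an edge are never coplanar) and every vertex is a corner of some
   facet. A vertex may lie inside a straight part of the boundary of another
   facet; it then belongs to the vertex cycle of that facet too. *)
Record polyhedron := Polyhedron {
  nvert : nat;
  vertex : 'I_nvert -> pt3 R;
  nface : nat;
  (* the vertices of a facet in cyclic order along its boundary *)
  cyc : 'I_nface -> seq 'I_nvert;
  region : 'I_nface -> set (pt3 R);
  body : set (pt3 R);

  vertex_inj : injective vertex;

  cyc_uniq : forall F, uniq (cyc F) /\ (3 <= size (cyc F))%N;
  cyc_simple : forall F i j p, i \in cyc F -> j \in cyc F -> i != j ->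
    segment (vertex i) (vertex (next (cyc F) i)) p ->
    segment (vertex j) (vertex (next (cyc F) j)) p ->
    exists k, [/\ p = vertex k, k \in [:: i; next (cyc F) i]
                & k \in [:: j; next (cyc F) j]];
  (* By the Jordan curve theorem these conditions determine the facet: the
     closed polygon together with the region of the plane that it encloses. *)
  region_polygon : forall F, exists n d,
    [/\ n != 0, region F `<=` plane n d, compact (region F),
        relint (plane n d) (region F) !=set0
      & region F `\` relint (plane n d) (region F) =
        closed_polygon vertex (cyc F)];

  face_meet : forall F G p, F != G -> region F p -> region G p ->
    (exists i, [/\ i \in cyc F, i \in cyc G & p = vertex i]) \/
    (exists i j, [/\ edge_of (cyc F) i j, edge_of (cyc G) i j
                   & segment (vertex i) (vertex j) p]);
  edge_two : forall F i j, edge_of (cyc F) i j ->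
    #|[pred G | edge_of (cyc G) i j]| = 2%N;
  edge_crease : forall F G i j, F != G ->
    edge_of (cyc F) i j -> edge_of (cyc G) i j ->
    ~ exists n d, n != 0 /\
        forall k, (k \in cyc F) || (k \in cyc G) -> plane n d (vertex k);
  vertex_corner : forall i, exists2 F, i \in cyc F &
    ~ segment (vertex (prev (cyc F) i)) (vertex (next (cyc F) i)) (vertex i);
  (* the facets around a vertex form a single fan: the surface is a manifold *)
  vertex_fan : forall i F G, i \in cyc F -> i \in cyc G ->
    connect [rel A B | [exists j, edge_of (cyc A) i j && edge_of (cyc B) i j]]
      F G;

  body_compact : compact body;
  body_regular : body = closure body°;
  body_connected : body° !=set0 /\ connected body°;
  body_frontier : body `\` body° = [set p | exists F, region F p]
}.

Definition face_boundary (P : polyhedron) (F : 'I_(nface P)) : set (pt3 R) :=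
  closed_polygon (@vertex P) (cyc F).

End Polyhedron.
Arguments polyhedron : clear implicits.

(* Lebesgue measure on R^3 *)
Notation mu3 :=
  ((lebesgue_measure \x lebesgue_measure) \x lebesgue_measure)%E.

Section Sobolev.
Context {R : realType}.
Implicit Types (O : set (pt3 R)) (f g w phi : pt3 R -> R)
  (alpha : nat * nat * nat).

Definition basis (k : 'I_3) : pt3 R :=
  ((k == 0 :> nat)%:R, (k == 1 :> nat)%:R, (k == 2 :> nat)%:R).

Definition partial (k : 'I_3) f : pt3 R -> R := fun p => 'D_(basis k) f p.

Fixpoint Ck (m : nat) f : Prop :=
  continuous f /\
  if m is m'.+1 then
    forall k, (forall p, derivable f p (basis k)) /\ Ck m' (partial k f)
  else True.

(* C_c^infty(O) *)
Definition test_function O phi : Prop :=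
  (forall m, Ck m phi) /\
  exists K, [/\ compact K, K `<=` O & forall p, ~ K p -> phi p = 0].

(* the multi-indices of order m *)
Definition multi (m : nat) : seq (nat * nat * nat) :=
  [seq (a, b, m - a - b)%N | a <- iota 0 m.+1, b <- iota 0 (m.+1 - a)].

Definition multi_order alpha : nat := (alpha.1.1 + alpha.1.2 + alpha.2)%N.

Definition Dpartial alpha f : pt3 R -> R :=
  iter alpha.1.1 (partial (inord 0))
    (iter alpha.1.2 (partial (inord 1))
      (iter alpha.2 (partial (inord 2)) f)).

Definition L2 O f : Prop :=
  @measurable_fun _ _
    (measurableTypeR R * measurableTypeR R * measurableTypeR R)%type R O f /\
  mu3.-integrable O (fun p => (f p ^+ 2)%:E).

Definition weak_derivative O alpha w g : Prop :=
  [/\ L2 O w, L2 O g & forall phi, test_function O phi ->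
     \int[mu3]_(p in O) (w p * Dpartial alpha phi p) =
     (-1) ^+ multi_order alpha * \int[mu3]_(p in O) (g p * phi p)].

(* D alpha is the (a.e. unique) weak derivative D^alpha w, for |alpha| = m *)
Definition weak_derivatives O m w (D : nat * nat * nat -> pt3 R -> R) :=
  forall alpha, alpha \in multi m -> weak_derivative O alpha w (D alpha).

(* s = |w|_{H^m(O)}; in particular the seminorm is finite *)
Definition is_seminorm O (m : nat) w (s : R) : Prop :=
  exists2 D, weak_derivatives O m w D &
    s = Num.sqrt (\int[mu3]_(p in O) \sum_(alpha <- multi m) D alpha p ^+ 2).

Definition H1 O w : Prop := exists D, weak_derivatives O 1 w D.

(* the closure of C_c^infty(O) in H^1(O) *)
Definition H10 O w : Prop :=
  H1 O w /\ exists phi : nat -> pt3 R -> R, exists s : nat -> R,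
    [/\ forall n, test_function O (phi n),
        forall n, is_seminorm O 1 (fun p => w p - phi n p) (s n),
        (fun n => \int[mu3]_(p in O) (w p - phi n p) ^+ 2) @ \oo --> (0 : R)
      & s @ \oo --> (0 : R)].

Definition weakly_harmonic O w : Prop :=
  exists2 D, weak_derivatives O 1 w D & forall phi, test_function O phi ->
    \int[mu3]_(p in O) (\sum_(alpha <- multi 1) D alpha p * Dpartial alpha phi p)
    = 0.

End Sobolev.

Section HarmonicInterpolant.
Context {R : realType}.
Implicit Types (P : polyhedron R) (u g w : pt3 R -> R).

Definition triangular P (F : 'I_(nface P)) : bool := size (cyc F) == 3%N.

(* generalized barycentric coordinates on the facet F *)
Definition barycentric P (F : 'I_(nface P)) (lam : 'I_(nvert P) -> pt3 R -> R) :=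
  (forall i p, i \in cyc F -> region F p -> 0 <= lam i p) /\
  (forall L, affine L -> forall p, region F p ->
     L p = \sum_(i <- cyc F) L (vertex i) * lam i p).

(* g agrees on the surface of P with the interpolant g_u of the vertex values
   of u; lam gives the coordinates chosen on the non-triangular facets. *)
Definition boundary_interpolant P
    (lam : 'I_(nface P) -> 'I_(nvert P) -> pt3 R -> R) u g : Prop :=
  forall F : 'I_(nface P),
    if triangular F then
      exists L, [/\ affine L, forall i, i \in cyc F -> L (vertex i) = u (vertex i)
                  & forall p, region F p -> g p = L p]
    else forall p, region F p ->
      g p = \sum_(i <- cyc F) u (vertex i) * lam F i p.

(* w = I_P u. The boundary condition w = g_u is in the H^1 sense: w - g is in
   H^1_0 for an H^1 extension g of g_u that is continuous up to the boundary. *)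
Definition harmonic_interpolant P
    (lam : 'I_(nface P) -> 'I_(nvert P) -> pt3 R -> R) u w : Prop :=
  weakly_harmonic (body P)° w /\
  exists g, [/\ {within body P, continuous g}, H1 (body P)° g,
                boundary_interpolant lam u g
              & H10 (body P)° (fun p => w p - g p)].

End HarmonicInterpolant.

(* Main.v *)
(* The polyhedron is a fan of three tetrahedra ABCD, BCDE, BCEV around the edge
   BC, whose apex V lies at height h above an interior point of the facet ABC;
   the wedge between the facets ABC and BCV is outside. Near V and the facet the
   boundary values can therefore jump: they extend to a function that is affine
   on each tetrahedron, with gradient bounded uniformly in h. The harmonic
   interpolant minimises the Dirichlet energy, so |u - I u|_{H^1}^2 is at most a
   constant times the volume, whereas |u|_{H^2}^2 is 8 times the volume. The
   ratio is thus bounded as h tends to 0, and converges along a subsequence. *)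

(* The vertex values leave a fixed gap between V and the facet: with the edge BC at x = -s, the
   affine interpolant on ABC equals 1/4 - s^2 at the origin, about 3/16, while u(V) = 0 at distance
   h. Solid between the two would force a gradient of order 1/h somewhere. Moving the gap outside
   makes the solid nonconvex, and the comparison function has no Lipschitz constant uniform in h for
   Euclidean distance. Its weak derivatives therefore come from bounds along coordinate segments
   that stay inside the open solid, combined with one-sided derivatives because of its kinks. The
   existence of the interpolant is part of the claim, so the minimiser is constructed: energies
   within 4^-n of the infimum, the parallelogram law, a Poincare inequality and completeness of L2.
   The gradient bound is uniform because the tetrahedra ABCD, BCDE and BCEV keep a nondegenerate
   shape as h tends to 0; only ABCV, the part left out, becomes flat. *)
From Pilot Require Import Defs.
From HB Require Import structures.
From mathcomp Require Import all_boot all_order all_algebra.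
From mathcomp Require Import all_classical all_reals all_analysis.
From mathcomp Require Import measurable_realfun ring lra.
(* again, because mathcomp-analysis has a [basis] of its own *)
Import Pilot.Defs.
Set Implicit Arguments.
Unset Strict Implicit.
Unset Printing Implicit Defensive.
Import Order.TTheory GRing.Theory Num.Theory.
Import numFieldTopology.Exports numFieldNormedType.Exports.
Local Open Scope classical_set_scope.
Local Open Scope ring_scope.

(** * Square-integrable functions *)

Section SquareIntegrable.
Context d (T : measurableType d) (R : realType).
Variables (mu : {measure set T -> \bar R}) (O : set T).
Hypothesis mO : measurable O.
Implicit Types f g h : T -> R.

Definition sqint f : Prop :=
  measurable_fun O f /\ mu.-integrable O (fun p => (f p ^+ 2)%:E).

Lemma integrable_le_EFin f g : measurable_fun O f ->
  (forall x, O x -> `|f x| <= g x) -> mu.-integrable O (EFin \o g) ->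
  mu.-integrable O (EFin \o f).
Proof.
move=> mf fg ig; apply: (le_integrable mO _ _ ig).
  exact/measurable_EFinP.
by move=> x Ox /=; rewrite lee_fin (le_trans (fg _ Ox))// ler_norm.
Qed.

Lemma integrableD_EFin f g : mu.-integrable O (EFin \o f) ->
  mu.-integrable O (EFin \o g) -> mu.-integrable O (EFin \o (f \+ g)).
Proof. by move=> fi gi; have := integrableD mO fi gi. Qed.

Lemma integrableZ_EFin k f : mu.-integrable O (EFin \o f) ->
  mu.-integrable O (EFin \o (fun x => k * f x)).
Proof. by move=> fi; have := integrableZl mO k fi. Qed.

Lemma sqint_mul f g : sqint f -> sqint g ->
  mu.-integrable O (EFin \o (fun x => f x * g x)).
Proof.
move=> [mf fi] [mg gi].
apply: (@integrable_le_EFin _ (fun x => f x ^+ 2 + g x ^+ 2)).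
- exact: measurable_funM.
- move=> x _; rewrite ler_norml; apply/andP; split; nra.
- exact: integrableD_EFin.
Qed.

Lemma sqintD f g : sqint f -> sqint g -> sqint (fun x => f x + g x).
Proof.
move=> sf sg; have [mf fi] := sf; have [mg gi] := sg; split.
  exact: measurable_funD.
rewrite (_ : (fun p => _) = EFin \o
    ((fun x => f x ^+ 2) \+ ((fun x => 2 * (f x * g x)) \+ fun x => g x ^+ 2))).
  apply: integrableD_EFin => //; apply: integrableD_EFin => //.
  by apply: integrableZ_EFin; exact: sqint_mul.
by apply/funext => x /=; congr EFin; ring.
Qed.

Lemma sqintZ k f : sqint f -> sqint (fun x => k * f x).
Proof.
move=> [mf fi]; split; first exact: measurable_funM.
rewrite (_ : (fun p => _) = EFin \o (fun x => k ^+ 2 * (f x ^+ 2))).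
  exact: integrableZ_EFin.
by apply/funext => x /=; congr EFin; ring.
Qed.

Lemma sqintN f : sqint f -> sqint (fun x => - f x).
Proof. by move=> /(sqintZ (-1)); under eq_fun do rewrite mulN1r. Qed.

Lemma sqintB f g : sqint f -> sqint g -> sqint (fun x => f x - g x).
Proof. by move=> sf sg; apply: sqintD => //; exact: sqintN. Qed.

Lemma integrable_cst_EFin (k : R) : (mu O < +oo)%E ->
  mu.-integrable O (EFin \o fun=> k).
Proof.
move=> fin; apply: measurable_bounded_integrable => //.
by exists `|k|; split; [exact: num_real|move=> M kM x _ /=; exact: ltW].
Qed.

Lemma sqint_bounded f (M : R) : (mu O < +oo)%E -> measurable_fun O f ->
  (forall x, O x -> `|f x| <= M) -> sqint f.
Proof.
move=> fin mf fM; split => //.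
apply: (@integrable_le_EFin _ (fun=> M ^+ 2)).
- exact: measurable_funX.
- move=> x Ox /=; have fMx := fM _ Ox.
  by rewrite normrX lerXn2r// ?nnegrE// (le_trans _ fMx).
- exact: integrable_cst_EFin.
Qed.

(** The integral is real valued, with a default value when the extended one is infinite. Bilinearity
    therefore asks for square integrability, while symmetry and positivity hold for all
    functions. *)
Definition l2dot f g := \int[mu]_(x in O) (f x * g x).

Lemma ipC f g : l2dot f g = l2dot g f.
Proof. by apply: eq_Rintegral => x _; rewrite mulrC. Qed.

Lemma ip_norm f : l2dot f f = \int[mu]_(x in O) (f x ^+ 2).
Proof. by apply: eq_Rintegral => x _; rewrite expr2. Qed.

Lemma ip_ge0 f : 0 <= l2dot f f.
Proof. by apply: Rintegral_ge0 => x _; rewrite -expr2 sqr_ge0. Qed.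

Lemma ipDl f g h : sqint f -> sqint g -> sqint h ->
  l2dot (fun x => f x + g x) h = l2dot f h + l2dot g h.
Proof.
move=> sf sg sh; rewrite /l2dot -RintegralD//; try exact: sqint_mul.
by apply: eq_Rintegral => x _; rewrite mulrDl.
Qed.

Lemma ipZl k f h : sqint f -> sqint h -> l2dot (fun x => k * f x) h = k * l2dot f h.
Proof.
move=> sf sh; rewrite /l2dot -RintegralZl//; try exact: sqint_mul.
by apply: eq_Rintegral => x _; rewrite mulrA.
Qed.

Lemma ipNl f h : sqint f -> sqint h -> l2dot (fun x => - f x) h = - l2dot f h.
Proof.
by move=> sf sh; rewrite -mulN1r -ipZl//; apply: eq_Rintegral => x _;
  rewrite mulN1r.
Qed.

Lemma ipBl f g h : sqint f -> sqint g -> sqint h ->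
  l2dot (fun x => f x - g x) h = l2dot f h - l2dot g h.
Proof. by move=> sf sg sh; rewrite ipDl ?ipNl//; exact: sqintN. Qed.

Lemma ipDr f g h : sqint f -> sqint g -> sqint h ->
  l2dot h (fun x => f x + g x) = l2dot h f + l2dot h g.
Proof. by move=> *; rewrite ipC ipDl// !(ipC h). Qed.

Lemma ipZr k f h : sqint f -> sqint h -> l2dot h (fun x => k * f x) = k * l2dot h f.
Proof. by move=> *; rewrite ipC ipZl// !(ipC h). Qed.

Lemma ipNr f h : sqint f -> sqint h -> l2dot h (fun x => - f x) = - l2dot h f.
Proof. by move=> *; rewrite ipC ipNl// !(ipC h). Qed.

Lemma normD2 f g : sqint f -> sqint g ->
  l2dot (fun x => f x + g x) (fun x => f x + g x) =
  l2dot f f + 2 * l2dot f g + l2dot g g.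
Proof.
move=> sf sg; have sfg := sqintD sf sg.
by rewrite ipDl// !ipDr// (ipC g f); ring.
Qed.

Lemma normB2 f g : sqint f -> sqint g ->
  l2dot (fun x => f x - g x) (fun x => f x - g x) =
  l2dot f f - 2 * l2dot f g + l2dot g g.
Proof.
by move=> sf sg; rewrite normD2 ?ipNr ?ipNl//; do ?exact: sqintN; ring.
Qed.

Lemma cauchy_schwarz f g : sqint f -> sqint g ->
  l2dot f g ^+ 2 <= l2dot f f * l2dot g g.
Proof.
move=> sf sg; have key t : 0 <= l2dot f f + 2 * t * l2dot f g + t ^+ 2 * l2dot g g.
  have -> : l2dot f f + 2 * t * l2dot f g + t ^+ 2 * l2dot g g =
      l2dot (fun x => f x + t * g x) (fun x => f x + t * g x).
    by rewrite normD2 ?ipZl ?ipZr//; do ?exact: sqintZ; ring.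
  exact: ip_ge0.
have := ip_ge0 g; rewrite le_eqVlt => /predU1P[g0|g0].
  rewrite -g0 mulr0; have [->|fg0] := eqVneq (l2dot f g) 0; first by rewrite expr0n.
  (* When g has norm 0 but a nonzero product with f, this [t] makes the quadratic equal to -1. *)
  have := key (- (l2dot f f + 1) / (2 * l2dot f g)); rewrite -g0 mulr0 addr0.
  rewrite (_ : 2 * _ * _ = - (l2dot f f + 1)); first by lra.
  by field.
(* The minimiser of the quadratic. *)
have := key (- l2dot f g / l2dot g g).
rewrite (_ : _ + _ = (l2dot f f * l2dot g g - l2dot f g ^+ 2) / l2dot g g); last first.
  by field; rewrite gt_eqF.
by rewrite pmulr_lge0 ?invr_gt0// subr_ge0.
Qed.

Lemma ip_cvg0 (F : nat -> T -> R) g : (forall n, sqint (F n)) -> sqint g ->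
  (fun n => l2dot (F n) (F n)) @ \oo --> (0 : R) ->
  (fun n => l2dot (F n) g) @ \oo --> (0 : R).
Proof.
move=> sF sg F0.
have sq0 : (fun n => Num.sqrt (l2dot (F n) (F n) * l2dot g g)) @ \oo --> (0 : R).
  have F0' : (fun n => l2dot (F n) (F n) * l2dot g g) @ \oo --> (0 : R).
    by rewrite -[X in _ --> X](mul0r (l2dot g g)); apply: cvgM => //; exact: cvg_cst.
  rewrite -[X in _ --> X]sqrtr0.
  by apply: continuous_cvg => //; exact: sqrt_continuous.
apply: norm_cvg0; apply: (squeeze_cvgr _ (cvg_cst 0) sq0).
near=> n; rewrite normr_ge0/= -sqrtr_sqr ler_sqrt.
  exact: cauchy_schwarz.
by rewrite mulr_ge0// ip_ge0.
Unshelve. all: by end_near. Qed.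

Lemma normD2_le f g : sqint f -> sqint g ->
  l2dot (fun x => f x + g x) (fun x => f x + g x) <= 2 * l2dot f f + 2 * l2dot g g.
Proof.
move=> sf sg; have := ip_ge0 (fun x => f x - g x).
by rewrite normB2// normD2//; lra.
Qed.

End SquareIntegrable.

(** * Completeness of L2 on a set of finite measure *)

Lemma cvg_of_summable_increments (R : realType) (u : nat -> R) :
  (\sum_(k <oo) `|u k.+1 - u k|%:E < +oo)%E -> cvgn u.
Proof.
move=> fin; pose a k := u k.+1 - u k.
have ca : cvgn [normed series a].
  apply: nondecreasing_is_cvgn.
    by apply: nondecreasing_series => n _ _; exact: normr_ge0.
  exists (fine (\sum_(k <oo) `|u k.+1 - u k|%:E)%E) => _ [n _ <-].
  rewrite -lee_fin fineK; last first.
    by rewrite ge0_fin_numE//; apply: nneseries_ge0 => k _ _; rewrite lee_fin.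
  apply: le_trans (nneseries_lim_ge n _); last by move=> k _ _; rewrite lee_fin.
  by rewrite sumEFin.
have := normed_cvg ca; rewrite (_ : series a = fun n => u n - u 0%N); last first.
  by apply/funext => n; rewrite /series/= telescope_sumr.
move=> cu; rewrite (_ : u = (fun n => u n - u 0%N) \+ cst (u 0%N)).
  by apply: is_cvgD => //; exact: is_cvg_cst.
by apply/funext => n /=; rewrite subrK.
Qed.

Section RieszFischer.
Context d (T : measurableType d) (R : realType).
Variables (mu : {measure set T -> \bar R}) (O : set T).
Hypothesis mO : measurable O.
Hypothesis finO : (mu O < +oo)%E.
Local Notation sqint := (sqint mu O).
Local Notation ip := (l2dot mu O).

Lemma EFin_ip f : sqint f -> (\int[mu]_(x in O) (f x ^+ 2)%:E)%E = (ip f f)%:E.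
Proof.
move=> [mf fi]; rewrite ip_norm /Rintegral fineK//.
exact: integrable_fin_num.
Qed.

Variables (F : nat -> T -> R) (M : R).
Hypothesis sF : forall n, sqint (F n).
Hypothesis FM : forall n,
  ip (fun x => F n.+1 x - F n x) (fun x => F n.+1 x - F n x) <= M * 4^-1 ^+ n.

Let M0 : 0 <= M.
Proof.
by have := FM 0; rewrite expr0 mulr1; apply: le_trans; exact: ip_ge0.
Qed.

(** Young's inequality [|a| <= e / 2 + a^2 / (2 e)] with [e = 2^-n]: the squares decay like 4^-n, so
    the bound stays geometric after division by e. The finite measure of O absorbs the constant e /
    2. *)
Let increment_bound n : (\int[mu]_(x in O) `|F n.+1 x - F n x|%:E <=
   ((fine (mu O) + M) / 2 * 2^-1 ^+ n)%:E)%E.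
Proof.
pose h x := F n.+1 x - F n x; have sh : sqint h by exact: sqintB.
have e0 : 0 < 2^-1 ^+ n :> R by rewrite exprn_gt0.
have fO : mu O \is a fin_num by rewrite ge0_fin_numE.
apply: (@le_trans _ _ (\int[mu]_(x in O)
    ((2^-1 ^+ n / 2)%:E + (2 ^+ n / 2 * h x ^+ 2)%:E))%E).
  apply: ge0_le_integral => //.
  - by apply/measurable_EFinP/measurableT_comp => //; exact: sh.1.
  - apply/measurable_EFinP/measurable_funD => //; apply: measurable_funM => //.
    by apply: measurable_funX; exact: sh.1.
  move=> x _; rewrite -EFinD lee_fin -/(h x).
  have := sqr_ge0 (2^-1 ^+ n - `|h x|); rewrite sqrrB real_normK ?num_real//.
  have -> : (2 ^+ n : R) = (2^-1 ^+ n)^-1 by rewrite exprVn invrK.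
  set e := 2^-1 ^+ n in e0 *; move=> H.
  rewrite -(ler_pM2l e0).
  rewrite (_ : e * (e / 2 + e^-1 / 2 * h x ^+ 2) = (e ^+ 2 + h x ^+ 2) / 2); first by lra.
  by field; rewrite gt_eqF.
rewrite ge0_integralD//=; last 2 first.
  - by move=> x _; rewrite lee_fin mulr_ge0 ?sqr_ge0 ?divr_ge0 ?exprn_ge0.
  - apply/measurable_EFinP/measurable_funM => //.
    by apply: measurable_funX; exact: sh.1.
rewrite integral_cst// -[X in (_ * X)%E](fineK fO) -EFinM.
under eq_integral do rewrite EFinM.
rewrite integralZl//; last exact: sh.2.
rewrite EFin_ip// -EFinM -EFinD lee_fin.
have := FM n; rewrite -/h => H.
have E4 : (4^-1 : R) ^+ n = 2^-1 ^+ n * 2^-1 ^+ n.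
  by rewrite -exprMn; congr (_ ^+ _); lra.
rewrite E4 in H.
have -> : (2 ^+ n : R) = (2^-1 ^+ n)^-1 by rewrite exprVn invrK.
set e := 2^-1 ^+ n in e0 H *.
rewrite (_ : (fine (mu O) + M) / 2 * e = e / 2 * fine (mu O) + e^-1 / 2 * (M * (e * e))); last first.
  by field; rewrite gt_eqF.
by rewrite lerD2l ler_wpM2l// divr_ge0// invr_ge0 ltW.
Qed.

(** Induction on k with [(a + b)^2 <= 2 a^2 + 2 b^2]; the factor 4 is the fixed point of c -> 2 c /
    4 + 2. *)
Let tail_bound k n :
  ip (fun x => F (n + k)%N x - F n x) (fun x => F (n + k)%N x - F n x) <=
  4 * M * 4^-1 ^+ n.
Proof.
elim: k n => [n|k IH n].
  rewrite addn0 (_ : (fun x => _) = fun=> 0); last first.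
    by apply/funext => x; rewrite subrr.
  rewrite ip_norm; under eq_Rintegral do rewrite expr0n/=.
  by rewrite Rintegral_cst// mul0r !mulr_ge0 ?exprn_ge0// invr_ge0.
have := IH n.+1; rewrite addSnnS => H.
rewrite (_ : (fun x => _) = (fun x => (F (n + k.+1)%N x - F n.+1 x) + (F n.+1 x - F n x))); last first.
  by apply/funext => x; ring.
apply: le_trans (normD2_le mO _ _) _; try exact: sqintB.
have := FM n; move: H; rewrite exprS.
set a := ip _ _; set b := ip _ _.
have : 0 <= M * 4^-1 ^+ n :> R by rewrite mulr_ge0// exprn_ge0// invr_ge0.
set e := 4^-1 ^+ n.
lra.
Qed.

(** The increments have geometrically bounded integrals, so their sum is finite almost everywhere
    and the sequence converges pointwise there. Fatou's lemma turns [tail_bound] into convergence in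
    L2. *)
Lemma sqint_complete : exists2 f, sqint f &
  (fun n => ip (fun x => F n x - f x) (fun x => F n x - f x)) @ \oo --> (0 : R).
Proof.
have mF n : measurable_fun O (F n) := (sF n).1.
(* An upper limit is measurable whether or not the sequence converges; at points of convergence it
   is the limit. *)
pose f x := fine (limn_esup (fun n => (F n x)%:E)).
have mf : measurable_fun O f.
  apply: measurableT_comp => //.
  by apply: measurable_fun_limn_esup => n; exact/measurable_EFinP.
pose S x := (\sum_(k <oo) `|F k.+1 x - F k x|%:E)%E.
have mS : measurable_fun O S.
  apply: ge0_emeasurable_sum => //.
    by move=> k _; apply/measurable_EFinP/measurableT_comp => //; exact: measurable_funB.
have iS : mu.-integrable O S.
  apply/integrableP; split => //.
  under eq_integral => x _.
    rewrite gee0_abs; last by apply: nneseries_ge0 => k _ _; rewrite lee_fin.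
    over.
  rewrite integral_nneseries//; last first.
    by move=> k; apply/measurable_EFinP/measurableT_comp => //; exact: measurable_funB.
  apply: le_lt_trans (lee_nneseries _ (fun n _ => increment_bound n)) _.
    by move=> k _ _; apply: integral_ge0 => x _; rewrite lee_fin.
  set C := (_ / 2).
  have C0 : 0 <= C by rewrite divr_ge0// addr_ge0// fine_ge0.
  have /cvg_ex[l cl] : cvgn (series (geometric C 2^-1)).
    by apply: is_cvg_geometric_series; rewrite ger0_norm ?invr_ge0// invf_lt1 ?ltr1n.
  rewrite (_ : limn _ = l%:E) ?ltry//; apply/cvg_lim => //.
  rewrite (_ : (fun n => _) = EFin \o (series (geometric C 2^-1))).
    by apply: cvg_EFin => //; exact: nearW.
  by apply/funext => n /=; rewrite sumEFin.
have cvgF : {ae mu, forall x, O x -> (fun n => F n x) @ \oo --> f x}.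
  apply: filterS (integrable_ae mO iS) => x H Ox; have Sfin := H Ox.
  have cF : cvgn (fun n => F n x).
    apply: cvg_of_summable_increments; rewrite -ge0_fin_numE//.
    by apply: nneseries_ge0 => k _ _; rewrite lee_fin.
  have /cvg_ex[l cl] := cF.
  rewrite /f (_ : limn_esup _ = l%:E)//=.
  suff /cvg_limn_einf_sup[_ ->] : (fun n => (F n x)%:E) @ \oo --> l%:E by [].
  by apply: cvg_EFin => //; exact: nearW.
have tail n : (\int[mu]_(x in O) ((F n x - f x) ^+ 2)%:E <= (4 * M * 4^-1 ^+ n)%:E)%E.
  pose g k x := ((F (n + k)%N x - F n x) ^+ 2)%:E.
  have mg k : measurable_fun O (g k).
    by apply/measurable_EFinP/measurable_funX; exact: measurable_funB.
  have g0 k x : O x -> (0 <= g k x)%E by move=> _; rewrite lee_fin sqr_ge0.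
  rewrite -(@ae_eq_integral _ _ _ mu O _ (fun x => limn_einf (g ^~ x)) mO).
  - apply: le_trans (fatou mu mO mg g0) _.
    rewrite limn_einf_lim; apply: lime_le; first exact: is_cvg_einfs.
    apply: nearW => k; apply: (@le_trans _ _ (\int[mu]_(x in O) g k x)%E).
      by apply: ereal_inf_lbound; exists k => /=.
    rewrite EFin_ip; last exact: sqintB.
    by rewrite lee_fin tail_bound.
  - have := @measurable_fun_limn_esup _ _ _ O (fun k x => - g k x)%E
      (fun k => measurableT_comp (@oppe_measurable _ _) (mg k)).
    exact: measurableT_comp.
  - by apply/measurable_EFinP/measurable_funX; exact: measurable_funB.
  apply: filterS cvgF => x /[apply] cFx.
  have cg : (fun k => g k x) @ \oo --> ((F n x - f x) ^+ 2)%:E.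
    apply: cvg_EFin; first exact: nearW.
    have c : (fun k => F (n + k)%N x - F n x) @ \oo --> f x - F n x.
      apply: cvgB; last exact: cvg_cst.
      under eq_fun do rewrite addnC.
      have := cFx; rewrite -(@cvg_shiftn n _ (fun k => F k x)).
      exact.
    rewrite -sqrrN opprB expr2.
    rewrite (_ : fine \o _ = fun k => (F (n + k)%N x - F n x) * (F (n + k)%N x - F n x)).
      exact: cvgM.
    by apply/funext => k /=; rewrite expr2.
  by have [-> _] := cvg_limn_einf_sup cg.
have sFf n : sqint (fun x => F n x - f x).
  split; first exact: measurable_funB.
  apply/integrableP; split.
    by apply/measurable_EFinP/measurable_funX; exact: measurable_funB.
  under eq_integral => x _ do rewrite gee0_abs ?lee_fin ?sqr_ge0//.
  exact: le_lt_trans (tail n) (ltry _).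
exists f.
  have := sqintB mO (sF 0%N) (sFf 0%N).
  by under eq_fun do rewrite opprB addrC subrK.
have g0 : (fun n => 4 * M * 4^-1 ^+ n) @ \oo --> (0 : R).
  by apply: cvg_geometric; rewrite ger0_norm ?invr_ge0// invf_lt1 ?ltr1n.
apply: (squeeze_cvgr _ (cvg_cst 0) g0); apply: nearW => n.
by rewrite ip_ge0/= -lee_fin -EFin_ip.
Qed.

End RieszFischer.

(* pt3 carries the topology, mpt3 the product sigma-algebra; they are convertible. *)
Notation mpt3 R :=
  (measurableTypeR R * measurableTypeR R * measurableTypeR R)%type (only parsing).

(** * Lebesgue measure on R^3: open sets and translations *)

Section Measurability.
Context {R : realType}.

(** The sigma-algebra is a product one, so an open set is exhibited as a countable union of boxes:
    sup-norm balls of radius 1/(n+1) about rational centres. *)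
Lemma open_measurable3 (U : set (pt3 R)) : open U -> measurable (U : set (mpt3 R)).
Proof.
move=> oU.
pose box (c : rat * rat * rat * nat) : set (mpt3 R) :=
  (ball (ratr c.1.1.1 : R) c.2.+1%:R^-1 `*` ball (ratr c.1.1.2 : R) c.2.+1%:R^-1) `*`
  ball (ratr c.1.2 : R) c.2.+1%:R^-1.
rewrite (_ : U = \bigcup_c (if `[< box c `<=` U >] then box c else set0)).
  apply: countable_bigcupT_measurable => // c; case: ifPn => // _.
  by apply: measurableX; [apply: measurableX|]; exact: measurable_ball.
apply/seteqP; split => [p Up|p [c _]]; last first.
  by case: ifPn => // /asboolP; apply.
have /nbhs_ballP[e /= e0 eU] : nbhs p U by exact: open_nbhs_nbhs.
have e20 : 0 < e / 2 by rewrite divr_gt0.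
(* With a radius below e / 2, a box that contains p lies in the ball of radius e about p. *)
have [n _ /(_ n (leqnn n)) /= ne] := near_infty_natSinv_lt (PosNum e20).
pose d : R := n.+1%:R^-1.
have d0 : 0 < d by rewrite invr_gt0.
have /choice[q qP] (x : R) : exists q : rat, `|x - ratr q| < d.
  have /rat_in_itvoo[q] : x - d < x + d by lra.
  rewrite in_itv/= => /andP[q1 q2]; exists q.
  by rewrite ltr_norml; apply/andP; split; lra.
pose c := (q p.1.1, q p.1.2, q p.2, n).
have pc : box c p.
  by split; [split|] => /=; rewrite /ball/= distrC; exact: qP.
exists c => //; case: ifPn => // /asboolPn; apply: contra_notP => _ r rc.
apply: eU; case: pc rc => [[p1 p2] p3] [[r1 r2] r3].
move: p1 p2 p3 r1 r2 r3; rewrite /ball/= => p1 p2 p3 r1 r2 r3.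
have tri (x y z : R) : `|x - y| < d -> `|x - z| < d -> `|y - z| < e.
  rewrite !ltr_norml => /andP[? ?] /andP[? ?].
  rewrite -/d in ne; apply/andP; split; lra.
by split; [split|] => /=; [apply: tri p1 r1|apply: tri p2 r2|apply: tri p3 r3].
Qed.

Lemma continuous_measurable3 (f : pt3 R -> R) : continuous f ->
  measurable_fun setT (f : mpt3 R -> R).
Proof.
move=> cf; apply: (measurability _ (RGenOpens.measurableE R)).
move=> _ [_ [a [b ->] <-]]; rewrite setTI; apply: open_measurable3.
by apply: open_comp => //= x _; exact: cf.
Qed.

End Measurability.

Section Translation.
Local Open Scope ereal_scope.

(** Lebesgue measure is determined by its values on half-open intervals, and its image under a
    translation agrees with it there. *)
Lemma lebesgue_measure_shift (R : realType) (a : R) (A : set (measurableTypeR R)) :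
  measurable A ->
  lebesgue_measure ((fun x : measurableTypeR R => (x + a)%R : measurableTypeR R)
    @^-1` A) = lebesgue_measure A.
Proof.
pose s := (fun x : measurableTypeR R => (x + a)%R : measurableTypeR R).
have ms : measurable_fun setT s by apply: measurable_funD.
move=> mA; rewrite (@lebesgue_measure_unique _ (pushforward lebesgue_measure
  (HB.pack_for {mfun _ >-> _} s (isMeasurableFun.Build _ _ _ _ s ms))) _ A)//.
move=> _ [[x y] _ <-].
change (lebesgue_measure (`]x, y]%classic : set (measurableTypeR R)) =
  lebesgue_measure (s @^-1` `]x, y]%classic)).
rewrite (_ : s @^-1` _ = `](x - a)%R, (y - a)%R]%classic); last first.
  by apply/seteqP; split => z /=; rewrite !in_itv/= ltrBlDr lerBrDr.
rewrite !lebesgue_measure_itv/= !lte_fin ltrD2r.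
by case: ifPn => // _; rewrite -!EFinB; congr EFin; ring.
Qed.

(** The product measure integrates the measures of sections: [s2] preserves the measure of each
    section, and [s1] is a change of variable in the outer integral. *)
Lemma product_measure_map d1 d2 (T1 : measurableType d1) (T2 : measurableType d2)
    (R : realType) (m1 : {measure set T1 -> \bar R})
    (m2 : {sigma_finite_measure set T2 -> \bar R}) (s1 : T1 -> T1) (s2 : T2 -> T2) :
  measurable_fun setT s1 -> measurable_fun setT s2 ->
  (forall A, measurable A -> m1 (s1 @^-1` A) = m1 A) ->
  (forall A, measurable A -> m2 (s2 @^-1` A) = m2 A) ->
  let s := fun p => (s1 p.1, s2 p.2) in
  measurable_fun setT s /\
  forall X, measurable X -> (m1 \x m2) (s @^-1` X) = (m1 \x m2) X.
Proof.
move=> ms1 ms2 m1E m2E s.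
have ms : measurable_fun setT s.
  by apply: measurable_fun_pair; apply: measurableT_comp.
split => // X mX.
have mf : measurable_fun setT (m2 \o xsection X) by exact: measurable_fun_xsection.
transitivity (\int[m1]_x ((m2 \o xsection X) \o s1) x).
  apply: eq_integral => x _ /=.
  rewrite -[RHS]m2E; last exact: measurable_xsection.
  by congr (m2 _); apply/seteqP; split => y; rewrite /xsection/= !inE.
have := @ge0_integral_pushforward _ _ _ _ R s1 ms1 m1 setT _ measurableT mf.
rewrite preimage_setT => <-//.
by apply: eq_measure_integral => A mA _; exact: m1E.
Qed.

Lemma product_measure_map3 d1 d2 d3 (T1 : measurableType d1)
    (T2 : measurableType d2) (T3 : measurableType d3) (R : realType)
    (m1 : {sigma_finite_measure set T1 -> \bar R})
    (m2 : {sigma_finite_measure set T2 -> \bar R})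
    (m3 : {sigma_finite_measure set T3 -> \bar R})
    (s1 : T1 -> T1) (s2 : T2 -> T2) (s3 : T3 -> T3) :
  measurable_fun setT s1 -> measurable_fun setT s2 -> measurable_fun setT s3 ->
  (forall A, measurable A -> m1 (s1 @^-1` A) = m1 A) ->
  (forall A, measurable A -> m2 (s2 @^-1` A) = m2 A) ->
  (forall A, measurable A -> m3 (s3 @^-1` A) = m3 A) ->
  let s := fun p => (s1 p.1.1, s2 p.1.2, s3 p.2) in
  measurable_fun setT s /\
  forall X, measurable X -> ((m1 \x m2) \x m3) (s @^-1` X) = ((m1 \x m2) \x m3) X.
Proof.
move=> ms1 ms2 ms3 m1E m2E m3E s.
have [ms12 E12] := product_measure_map ms1 ms2 m1E m2E.
exact: (product_measure_map ms12 ms3 E12 m3E).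
Qed.

Lemma Rintegral_map d (T : measurableType d) (R : realType)
    (m : {measure set T -> \bar R}) (s : T -> T) (F : T -> R) :
  measurable_fun setT s -> (forall A, measurable A -> m (s @^-1` A) = m A) ->
  measurable_fun setT F -> m.-integrable setT (EFin \o (F \o s)) ->
  (\int[m]_p F (s p) = \int[m]_p F p)%R.
Proof.
move=> ms sE mF iF.
have mF' : measurable_fun setT (EFin \o F) by exact/measurable_EFinP.
have E := @integral_pushforward _ _ _ _ R s ms m setT (EFin \o F) mF' iF measurableT.
rewrite preimage_setT in E; rewrite /Rintegral; congr fine.
transitivity (\int[m]_x (EFin \o F \o s) x) => //.
rewrite -E; apply: eq_measure_integral => A mA _.
exact: sE.
Qed.

Lemma mu3_shift (R : realType) (a : mpt3 R) :
  let s := fun p : mpt3 R => (p + a)%R : mpt3 R in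
  measurable_fun setT s /\
  forall X : set (mpt3 R), measurable X -> mu3 (s @^-1` X) = mu3 X.
Proof.
move=> s; rewrite (_ : s = fun p : mpt3 R =>
  ((p.1.1 + a.1.1, p.1.2 + a.1.2), p.2 + a.2)%R); last first.
  by apply/funext => -[[? ?] ?].
have m1 (b : R) : measurable_fun setT
    (fun x : measurableTypeR R => (x + b)%R : measurableTypeR R).
  exact: measurable_funD.
exact: (product_measure_map3 (m1 a.1.1) (m1 a.1.2) (m1 a.2)
  (@lebesgue_measure_shift R a.1.1) (@lebesgue_measure_shift R a.1.2)
  (@lebesgue_measure_shift R a.2)).
Qed.

Lemma Rintegral_shift (R : realType) (a : mpt3 R) (F : mpt3 R -> R) :
  measurable_fun setT F -> mu3.-integrable setT (fun p : mpt3 R => (F (p + a)%R)%:E) ->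
  (\int[mu3]_p F (p + a)%R = \int[mu3]_p F p)%R.
Proof.
by have [ms sE] := mu3_shift a; exact: Rintegral_map.
Qed.

End Translation.

(** * Test functions and integration by parts *)

Section DirectionalDerivative.
Context {R : realType}.
Implicit Types (f : pt3 R -> R) (p v : pt3 R).

Lemma is_derive_line f p v (s : R) : derivable f (p + s *: v) v ->
  is_derive s 1 (fun r : R => f (p + r *: v)) ('D_v f (p + s *: v)).
Proof.
move=> df.
have E : (fun h : R => h^-1 *: (((fun r : R => f (p + r *: v)) \o shift s) (h *: 1) - f (p + s *: v))) =
    (fun h : R => h^-1 *: ((f \o shift (p + s *: v)) (h *: v) - f (p + s *: v))).
  apply/funext => h /=; congr (_ *: (f _ - _)).
  by rewrite addrCA -scalerDl [h%:A]mulr1.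
by split; rewrite /derivable /derive E.
Qed.

Lemma increment_le f p v (C t : R) :
  (forall q, derivable f q v) -> (forall q, `|'D_v f q| <= C) -> 0 <= t ->
  `|f (p + t *: v) - f p| <= C * t.
Proof.
move=> df DC t0.
have [|c _] := @MVT_segment _ (fun r : R => f (p + r *: v))
    (fun s => 'D_v f (p + s *: v)) 0 t t0 (fun s _ => is_derive_line (df _)).
  apply: derivable_within_continuous => x _.
  by have [] := is_derive_line (df (p + x *: v)).
rewrite scale0r addr0 subr0 => ->.
by rewrite normrM (ger0_norm t0) ler_wpM2r.
Qed.

Lemma derive_cvg_seq f p v (t : nat -> R) : derivable f p v ->
  (forall n, t n != 0) -> t @ \oo --> (0 : R) ->
  (fun n => (t n)^-1 * (f (p + t n *: v) - f p)) @ \oo --> 'D_v f p.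
Proof.
move=> df t0 ct.
have -> : (fun n => (t n)^-1 * (f (p + t n *: v) - f p)) =
    (fun h : R => h^-1 *: ((f \o shift p) (h *: v) - f p)) \o t.
  by apply/funext => n /=; congr (_ * (f _ - _)); exact: addrC.
apply: cvg_comp df => /=.
move=> A [e /= e0 eA]; have := ct; move/cvgrPdist_lt => /(_ e e0).
by apply: filterS => n; rewrite sub0r => tn; apply: eA => //=; rewrite sub0r.
Qed.

End DirectionalDerivative.

Section TestFunctions.
Context {R : realType}.
Implicit Types (O : set (pt3 R)) (f g phi : pt3 R -> R).

Lemma CkD m f g : Ck m f -> Ck m g -> Ck m (fun p => f p + g p).
Proof.
elim: m f g => [|m IH] f g [cf df] [cg dg].
  by split => // p; apply: continuousD; [exact: cf|exact: cg].
split; first by move=> p; apply: continuousD; [exact: cf|exact: cg].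
move=> k; have [dfk Cf] := df k; have [dgk Cg] := dg k.
split; first by move=> p; apply: derivableD.
rewrite (_ : partial _ _ = fun p => partial k f p + partial k g p); first exact: IH.
by apply/funext => p; rewrite /partial deriveD.
Qed.

Lemma CkZ m (c : R) f : Ck m f -> Ck m (fun p => c * f p).
Proof.
elim: m f => [|m IH] f [cf df].
  by split => // p; apply: continuousM; [exact: cvg_cst|exact: cf].
split; first by move=> p; apply: continuousM; [exact: cvg_cst|exact: cf].
move=> k; have [dfk Cf] := df k.
split; first by move=> p; apply: derivableZ.
rewrite (_ : partial _ _ = fun p => c * partial k f p); first exact: IH.
by apply/funext => p; rewrite /partial; exact: deriveZ.
Qed.

Lemma test_functionD O f g : test_function O f -> test_function O g ->
  test_function O (fun p => f p + g p).
Proof.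
move=> [sf [K [cK KO Kf]]] [sg [K' [cK' K'O K'g]]]; split.
  by move=> m; exact: CkD.
exists (K `|` K'); split; first exact: compactU.
  by move=> p [/KO|/K'O].
by move=> p /not_orP[/Kf -> /K'g ->]; rewrite addr0.
Qed.

Lemma test_functionZ O (c : R) f : test_function O f ->
  test_function O (fun p => c * f p).
Proof.
move=> [sf [K [cK KO Kf]]]; split; first by move=> m; exact: CkZ.
by exists K; split => // p /Kf ->; rewrite mulr0.
Qed.

Lemma test_function0 O : test_function O (fun=> 0).
Proof.
have C0 m : @Ck R m (fun=> 0).
  elim: m => [|m IH]; split => //; try by move=> p; exact: cvg_cst.
  move=> k; split; first by move=> p; exact: derivable_cst.
  rewrite (_ : partial _ _ = fun=> 0)//.
  by apply/funext => p; exact: derive_cst.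
split => //; exists set0; split => //; exact: compact0.
Qed.

Lemma test_function_partial O k f : test_function O f ->
  test_function O (partial k f).
Proof.
move=> [sf [K [cK KO Kf]]]; split => [m|].
  by have [_ /(_ k)[]] := sf m.+1.
exists K; split => // p Kp.
have oK : open (~` K) by apply: closed_openC; apply: compact_closed.
have nK : \forall q \near p, f q = 0.
  by apply: filterS (open_nbhs_nbhs (conj oK Kp)) => q /Kf.
rewrite /partial -(derive_cst (0 : R) p (basis k)).
exact: near_eq_derive.
Qed.

Lemma test_function_bounded O f : test_function O f ->
  exists2 C : R, 0 <= C & forall p, `|f p| <= C.
Proof.
move=> [sf [K [cK KO Kf]]].
have [cf _] := sf 0%N.
have /compact_bounded[M [_ MK]] : compact (f @` K).
  by apply: continuous_compact => //; apply: continuous_subspaceT.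
exists (`|M| + 1) => [|p]; first by rewrite addr_ge0.
have [Kp|Kp] := pselect (K p); last by rewrite Kf// normr0 addr_ge0.
by apply: MK; [rewrite ltr_pwDr// ler_norm|exists p].
Qed.

Lemma test_function_derivable O k f : test_function O f ->
  forall p, derivable f p (basis k).
Proof. by move=> [sf _] p; have [_ /(_ k)[]] := sf 1%N. Qed.

Lemma test_function_measurable O f : test_function O f ->
  measurable_fun setT (f : mpt3 R -> R).
Proof. by move=> [sf _]; apply: continuous_measurable3; have [] := sf 0%N. Qed.

Lemma test_function_out O f : test_function O f -> forall p, ~ O p -> f p = 0.
Proof. by move=> [_ [K [_ KO Kf]]] p Op; apply: Kf => /KO. Qed.

(** Compactness makes the admissible step uniform over the support of a test function, although the
    distance to the boundary of O depends on the point. *)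
Lemma compact_segment_sub O (K : set (pt3 R)) (v : pt3 R) :
  open O -> compact K -> K `<=` O ->
  exists N, forall n, (N <= n)%N -> forall p, K p ->
    forall t : R, 0 <= t <= n.+1%:R^-1 -> O (p + t *: v).
Proof.
move=> oO /compact_near_coveringP cK KO.
have [N _ HN] : \forall n \near \oo, K `<=` fun p =>
    forall t : R, 0 <= t <= n.+1%:R^-1 -> O (p + t *: v).
  apply: cK => p /KO Op.
  have c : {for ((0 : R), p), continuous (fun z : R * pt3 R => z.2 + z.1 *: v)}.
    apply: cvgD; first exact: cvg_snd.
    by apply: cvgZr_tmp; exact: cvg_fst.
  have : nbhs ((0 : R), p) ((fun z : R * pt3 R => z.2 + z.1 *: v) @^-1` O).
    apply: c; rewrite /= scale0r addr0; exact: open_nbhs_nbhs.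
  case=> -[A B] /= [/nbhs_ballP[e /= e0 eA] nB] AB.
  have [n0 _ Hn] := near_infty_natSinv_lt (PosNum e0).
  exists (B, [set n | (n0 <= n)%N]) => /=; first by split => //; exists n0.
  move=> [q n] /= [Bq n0n] t /andP[t0 tn].
  apply: (AB (t, q)); split => //=; apply: eA.
  rewrite /ball/= sub0r normrN ger0_norm// (le_lt_trans tn)//.
  exact: Hn.
by exists N => n Nn p Kp; exact: HN.
Qed.

End TestFunctions.

Section BoundedConvergence.
Context d (T : measurableType d) (R : realType).
Variables (mu : {measure set T -> \bar R}) (O : set T).
Hypothesis mO : measurable O.
Hypothesis finO : (mu O < +oo)%E.

Lemma bounded_integrable (F : T -> R) (C : R) : measurable_fun O F ->
  (forall p, O p -> `|F p| <= C) -> mu.-integrable O (EFin \o F).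
Proof.
move=> mF FC; apply: (@integrable_le_EFin _ _ _ _ _ mO _ (fun=> C)) => //.
exact: integrable_cst_EFin.
Qed.

Lemma bounded_convergence (f_ : nat -> T -> R) (f : T -> R) (C : R) N :
  (forall n, measurable_fun O (f_ n)) ->
  (forall p, O p -> (fun n => f_ n p) @ \oo --> f p) ->
  (forall n p, (N <= n)%N -> O p -> `|f_ n p| <= C) ->
  (fun n => \int[mu]_(p in O) f_ n p) @ \oo --> \int[mu]_(p in O) f p.
Proof.
move=> mf cf fC.
have mlim : measurable_fun O f by exact: measurable_fun_cvg cf.
have [||||//|if_ _ c] := @dominated_convergence _ _ _ mu O mO
    (fun n => EFin \o f_ (n + N)%N) (EFin \o f) (EFin \o fun=> C).
- by move=> n; exact/measurable_EFinP.
- exact/measurable_EFinP.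
- apply: aeW => p Op; apply: cvg_EFin; first exact: nearW.
  by have := cf p Op; rewrite -(@cvg_shiftn N _ (fun n => f_ n p)); exact.
- exact: integrable_cst_EFin.
- by apply: aeW => p n Op; rewrite lee_fin fC// leq_addl.
rewrite -(@cvg_shiftn N).
have fin : (\int[mu]_(p in O) (f p)%:E)%E \is a fin_num by exact: integrable_fin_num.
by have := c; rewrite -(fineK fin) => /fine_cvg.
Qed.

(** Translation invariance is available on the whole space; this passes to it from O for functions
    that vanish outside O. *)
Lemma extend_integrable (F : T -> R) (C : R) : measurable_fun setT F ->
  (forall p, ~ O p -> F p = 0) -> (forall p, O p -> `|F p| <= C) ->
  mu.-integrable setT (EFin \o F) /\
  \int[mu]_p F p = \int[mu]_(p in O) F p.
Proof.
move=> mF F0 FC.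
have E : F \_ O = F.
  apply/funext => p; rewrite patchE; case: ifPn => //.
  by rewrite notin_setE => /F0.
split; last by rewrite [RHS]Rintegral_mkcond E.
have := @bounded_integrable F C (measurable_funTS mF) FC.
by move/(integrable_mkcond _ mO); rewrite restrict_EFin E.
Qed.

End BoundedConvergence.

Section IntegrationByParts.
Context {R : realType}.
Variable O : set (pt3 R).
Hypothesis oO : open O.
Hypothesis finO : (mu3 (O : set (mpt3 R)) < +oo)%E.

Let mO : measurable (O : set (mpt3 R)).
Proof. exact: open_measurable3. Qed.

(** The hypotheses are tailored to a piecewise affine g on a nonconvex set: the Lipschitz bound [gL]
    concerns segments inside O, since g may change abruptly across a gap, and [gD] is a one-sided
    derivative, since g has kinks. *)
Variables (k : 'I_3) (g Dg : pt3 R -> R) (M L : R).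
Hypothesis mg : measurable_fun (O : set (mpt3 R)) g.
Hypothesis gM : forall p, O p -> `|g p| <= M.
Hypothesis gL : forall p (t : R), 0 < t ->
  (forall r : R, 0 <= r <= t -> O (p + r *: basis k)) ->
  `|g (p + t *: basis k) - g p| <= L * t.
Hypothesis gD : forall p, O p ->
  (fun n : nat => n.+1%:R * (g (p + n.+1%:R^-1 *: basis k) - g p)) @ \oo --> Dg p.

Let e : pt3 R := basis k.
Let t (n : nat) : R := n.+1%:R^-1.
Let gz : pt3 R -> R := g \_ O.
Let A n (p : pt3 R) := n.+1%:R * (gz (p + t n *: e) - gz p).

Let t0 n : 0 < t n. Proof. by rewrite invr_gt0. Qed.

Let mgz : measurable_fun setT (gz : mpt3 R -> R).
Proof. by apply/(measurable_restrictT _ mO). Qed.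

Let mgzs (a : pt3 R) : measurable_fun setT ((fun p => gz (p + a)) : mpt3 R -> R).
Proof. by have [ms _] := @mu3_shift R a; exact: measurableT_comp mgz ms. Qed.

Let gzE p : O p -> gz p = g p.
Proof. by move=> Op; rewrite /gz patchE mem_set. Qed.

Let gz0 p : ~ O p -> gz p = 0.
Proof. by move=> Op; rewrite /gz patchE memNset. Qed.

Let gzM p : `|gz p| <= `|M|.
Proof.
have [Op|Op] := pselect (O p); last by rewrite gz0// normr0.
by rewrite gzE// (le_trans (gM Op))// ler_norm.
Qed.

Let mA n : measurable_fun setT (A n : mpt3 R -> R).
Proof.
by apply: measurable_funM => //; apply: measurable_funB => //; exact: mgzs.
Qed.

(** The zero extension [gz] can jump at the boundary of O, where [A n] may grow with n. On a compact
    subset of O the quotient is eventually that of g, and this is all that a test function sees. *)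
Let AL (K : set (pt3 R)) : compact K -> K `<=` O ->
  exists N, forall n p, (N <= n)%N -> K p -> `|A n p| <= L /\
    A n p = n.+1%:R * (g (p + t n *: e) - g p).
Proof.
move=> cK KO; have [N NP] := compact_segment_sub e oO cK KO.
exists N => n p Nn Kp.
have seg r : 0 <= r <= t n -> O (p + r *: e) by exact: NP.
have Op : O p by exact: KO.
have Opt : O (p + t n *: e) by apply: seg; rewrite lexx ltW.
have AE : A n p = n.+1%:R * (g (p + t n *: e) - g p) by rewrite /A !gzE.
split => //; rewrite AE normrM ger0_norm// mulrC -ler_pdivlMr//.
exact: gL.
Qed.

Let point_compact p : compact [set p : pt3 R].
Proof. exact: compact_set1. Qed.

Let cA p : O p -> (fun n => A n p) @ \oo --> Dg p.
Proof.
move=> Op; have [|N NP] := AL (@point_compact p); first by move=> _ ->.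
apply: cvg_trans (gD Op); apply: near_eq_cvg.
by exists N => // n Nn; have [] := NP n p Nn erefl.
Qed.

Lemma weak_diff_measurable : measurable_fun (O : set (mpt3 R)) Dg.
Proof.
apply: (@measurable_fun_cvg _ _ _ (O : set (mpt3 R)) A) => //.
  by move=> n; exact: measurable_funTS.
Qed.

Lemma weak_diff_bounded p : O p -> `|Dg p| <= L.
Proof.
move=> Op; have [|N NP] := AL (@point_compact p); first by move=> _ ->.
have c : (fun n => `|A n p|) @ \oo --> `|Dg p| by apply: cvg_norm; exact: cA.
rewrite -(cvg_lim (@Rhausdorff R) c); apply: limr_le; first exact: cvgP c.
by exists N => // n Nn; have [] := NP n p Nn erefl.
Qed.

(* Moving a difference quotient from g to phi only needs the translation
   invariance of mu3; a right derivative of g is enough. *)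
Lemma integration_by_parts phi : test_function O phi ->
  \int[mu3]_(p in (O : set (mpt3 R))) (g p * partial k phi p) =
  - \int[mu3]_(p in (O : set (mpt3 R))) (Dg p * phi p).
Proof.
move=> tphi; have [C C0 phiC] := test_function_bounded tphi.
have [C' C'0 dphiC] := test_function_bounded (test_function_partial k tphi).
have mphi := test_function_measurable tphi.
have [_ [K [cK KO phiK]]] := tphi.
have [N NP] := AL cK KO.
pose B n (p : pt3 R) := n.+1%:R * (phi (p - t n *: e) - phi p).
have mB n : measurable_fun setT (B n : mpt3 R -> R).
  apply: measurable_funM => //; apply: measurable_funB => //.
  have [ms _] := @mu3_shift R (- (t n *: e)).
  exact: measurableT_comp mphi ms.
have c1 : (fun n => \int[mu3]_(p in (O : set (mpt3 R))) (A n p * phi p)) @ \oo -->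
    \int[mu3]_(p in (O : set (mpt3 R))) (Dg p * phi p).
  apply: (@bounded_convergence _ _ _ mu3 _ mO finO _ _ (`|L| * C) N).
  - by move=> n; apply: measurable_funTS; exact: measurable_funM.
  - by move=> p Op; apply: cvgM; [exact: cA|exact: cvg_cst].
  - move=> n p Nn Op; have [Kp|Kp] := pselect (K p).
      have [ALp _] := NP n p Nn Kp.
      by rewrite normrM ler_pM// (le_trans ALp)// ler_norm.
    by rewrite phiK// mulr0 normr0 mulr_ge0.
have c2 : (fun n => \int[mu3]_(p in (O : set (mpt3 R))) (gz p * B n p)) @ \oo -->
    \int[mu3]_(p in (O : set (mpt3 R))) (g p * - partial k phi p).
  apply: (@bounded_convergence _ _ _ mu3 _ mO finO _ _ (`|M| * C') 0).
  - by move=> n; apply: measurable_funTS; exact: measurable_funM.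
  - move=> p Op; rewrite gzE//; apply: cvgM; first exact: cvg_cst.
    (* [B n] is minus a difference quotient with the negative step -t, so its limit is minus the
       partial derivative. *)
    have nt0 n : - t n != 0 by rewrite oppr_eq0 gt_eqF.
    have ct : (fun n => - t n) @ \oo --> (0 : R).
      by rewrite -oppr0; apply: cvgN; exact: cvg_harmonic.
    have := cvgN (derive_cvg_seq (@test_function_derivable R O k phi tphi p) nt0 ct).
    rewrite (_ : - _ = fun n => B n p); first by apply.
    apply/funext => n; rewrite /B /t /=.
    by rewrite !fctE invrN invrK mulNr opprK scaleNr.
  - move=> n p _ Op; rewrite normrM ler_pM//.
    have := @increment_le R phi (p - t n *: e) e C' (t n)
      (@test_function_derivable R O k phi tphi) dphiC (ltW (t0 n)).
    rewrite subrK distrC => H; rewrite /B normrM ger0_norm// mulrC -ler_pdivlMr//.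
(* Summation by parts: both sides contain the product [F3], and [F1] is a translate of [F2]. All
   three vanish outside O, so their integrals over O are integrals over the space. *)
have e12 n : \int[mu3]_(p in (O : set (mpt3 R))) (A n p * phi p) =
    \int[mu3]_(p in (O : set (mpt3 R))) (gz p * B n p).
  pose F1 p := gz (p + t n *: e) * phi p.
  pose F2 p := gz p * phi (p - t n *: e).
  pose F3 p := gz p * phi p.
  have bd (x y : R) : `|x| <= `|M| -> `|y| <= C -> `|x * y| <= `|M| * C.
    by move=> xM yC; rewrite normrM ler_pM.
  have [m_ _] := @mu3_shift R (- (t n *: e)).
  have [|||i1 E1] := @extend_integrable _ _ _ mu3 _ mO finO F1 (`|M| * C).
  - by apply: measurable_funM => //; exact: mgzs.
  - by move=> p Op; rewrite /F1 (test_function_out tphi Op) mulr0.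
  - by move=> p _; exact: bd.
  have [|||i2 E2] := @extend_integrable _ _ _ mu3 _ mO finO F2 (`|M| * C).
  - by apply: measurable_funM => //; exact: measurableT_comp mphi m_.
  - by move=> p Op; rewrite /F2 gz0// mul0r.
  - by move=> p _; exact: bd.
  have [|||i3 E3] := @extend_integrable _ _ _ mu3 _ mO finO F3 (`|M| * C).
  - exact: measurable_funM.
  - by move=> p Op; rewrite /F3 gz0// mul0r.
  - by move=> p _; exact: bd.
  have r (F : pt3 R -> R) : mu3.-integrable setT (EFin \o F) ->
      mu3.-integrable (O : set (mpt3 R)) (EFin \o F).
    by move=> iF; exact: integrableS iF.
  have E12 : \int[mu3]_p F1 p = \int[mu3]_p F2 p.
    have F12 : F1 = fun p => F2 (p + t n *: e).
      by apply/funext => p; rewrite /F1 /F2 addrK.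
    rewrite F12; apply: Rintegral_shift; last by move: i1; rewrite F12.
    by apply: measurable_funM => //; exact: measurableT_comp mphi m_.
  transitivity (n.+1%:R * (\int[mu3]_(p in (O : set (mpt3 R))) F1 p -
      \int[mu3]_(p in (O : set (mpt3 R))) F3 p)).
    rewrite -RintegralB ?r// -RintegralZl//; last first.
      by have := integrableB mO (r _ i1) (r _ i3).
    by apply: eq_Rintegral => p _; rewrite /A /F1 /F3; ring.
  rewrite -E1 E12 E2 -RintegralB ?r// -RintegralZl//; last first.
    by have := integrableB mO (r _ i2) (r _ i3).
  by apply: eq_Rintegral => p _; rewrite /B /F2 /F3; ring.
have c2' := c2; rewrite -(eq_cvg _ _ e12) in c2'.
have := cvg_unique _ c1 c2' => /(_ (@Rhausdorff R)) ->.
rewrite (_ : \int[mu3]_(p in _) (g p * - _) = \int[mu3]_(p in (O : set (mpt3 R))) (-1 * (g p * partial k phi p))).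
  rewrite RintegralZl// ?mulN1r ?opprK//.
  apply: (@bounded_integrable _ _ _ mu3 _ mO finO _ (`|M| * C')).
    apply: measurable_funM => //; apply: measurable_funTS.
    exact: test_function_measurable (test_function_partial k tphi).
  move=> p Op; rewrite normrM ler_pM//.
  by rewrite (le_trans (gM Op))// ler_norm.
by apply: eq_Rintegral => p _; ring.
Qed.

End IntegrationByParts.

(** * Weak derivatives and the Dirichlet principle *)

Section SquareLimits.
Context d (T : measurableType d) (R : realType).
Variables (mu : {measure set T -> \bar R}) (O : set T).
Hypothesis mO : measurable O.
Local Notation sqint := (sqint mu O).
Local Notation ip := (l2dot mu O).

Definition sqcvg (F : nat -> T -> R) (f : T -> R) :=
  (fun n => ip (fun x => F n x - f x) (fun x => F n x - f x)) @ \oo --> (0 : R).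

Lemma ip_cvg F f h : (forall n, sqint (F n)) -> sqint f -> sqint h ->
  sqcvg F f -> (fun n => ip (F n) h) @ \oo --> ip f h.
Proof.
move=> sF sf sh cF.
have sFf n : sqint (fun x => F n x - f x) by exact: sqintB.
have c := ip_cvg0 mO sFf sh cF.
rewrite -[X in _ --> X]add0r.
rewrite (_ : (fun n => ip (F n) h) = (fun n => ip (fun x => F n x - f x) h) \+ cst (ip f h)).
  by apply: cvgD => //; exact: cvg_cst.
by apply/funext => n /=; rewrite ipBl// subrK.
Qed.

Lemma ip_cvg_norm F f : (forall n, sqint (F n)) -> sqint f ->
  sqcvg F f -> (fun n => ip (F n) (F n)) @ \oo --> ip f f.
Proof.
move=> sF sf cF; have c := ip_cvg sF sf sf cF.
have -> : (fun n => ip (F n) (F n)) = (fun n =>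
    ip (fun x => F n x - f x) (fun x => F n x - f x) + 2 * ip (F n) f - ip f f).
  by apply/funext => n; rewrite normB2//; ring.
rewrite -[X in _ --> X](_ : 0 + 2 * ip f f - ip f f = _); last by ring.
apply: cvgB; last exact: cvg_cst.
by apply: cvgD => //; apply: cvgM => //; exact: cvg_cst.
Qed.

Lemma sqcvgDl F f h : sqcvg F f -> sqcvg (fun n x => h x + F n x) (fun x => h x + f x).
Proof.
rewrite /sqcvg; set u := (X in X @ _ --> _ -> _); set v := (X in _ -> X @ _ --> _).
have -> // : u = v.
by apply/funext => n; apply: eq_Rintegral => x _; congr (_ * _); ring.
Qed.

End SquareLimits.

Section WeakDerivatives.
Context {R : realType}.
Variable O : set (pt3 R).
Hypothesis oO : open O.
Hypothesis finO : (mu3 (O : set (mpt3 R)) < +oo)%E.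
Local Notation OO := (O : set (mpt3 R)).
Local Notation mu := (mu3 : {measure set (mpt3 R) -> \bar R}).
Local Notation ip := (l2dot mu OO).
Implicit Types (w g phi eta : pt3 R -> R) (alpha : nat * nat * nat).

Let mO : measurable OO. Proof. exact: open_measurable3. Qed.

Lemma multi1 : multi 1 = [:: (0, 0, 1); (0, 1, 0); (1, 0, 0)]%N.
Proof. by []. Qed.

Lemma multi1_partial alpha : alpha \in multi 1 ->
  exists k, (forall phi, Dpartial alpha phi = partial k phi) /\
    multi_order alpha = 1%N.
Proof.
rewrite multi1 !inE => /or3P[] /eqP ->.
- by exists (inord 2).
- by exists (inord 1).
- by exists (inord 0).
Qed.

Lemma test_function_L2 phi : test_function O phi -> L2 O phi.
Proof.
move=> tphi; have [C _ phiC] := test_function_bounded tphi.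
apply: (@sqint_bounded _ _ _ mu _ mO _ C finO) => //.
exact: measurable_funTS (test_function_measurable tphi).
Qed.

Lemma test_function_Dpartial alpha phi : alpha \in multi 1 ->
  test_function O phi -> test_function O (Dpartial alpha phi).
Proof. by move=> /multi1_partial[k [-> _]]; exact: test_function_partial. Qed.

Lemma DpartialD alpha phi eta : alpha \in multi 1 ->
  test_function O phi -> test_function O eta ->
  Dpartial alpha (fun p => phi p + eta p) = fun p => Dpartial alpha phi p + Dpartial alpha eta p.
Proof.
move=> /multi1_partial[k [Dk _]] tp te; rewrite !Dk; apply/funext => p.
have dp := @test_function_derivable R O k phi tp p.
have de := @test_function_derivable R O k eta te p.
by rewrite /partial deriveD.
Qed.

Lemma DpartialZ alpha (c : R) phi : alpha \in multi 1 ->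
  test_function O phi ->
  Dpartial alpha (fun p => c * phi p) = fun p => c * Dpartial alpha phi p.
Proof.
move=> /multi1_partial[k [Dk _]] tp; rewrite !Dk; apply/funext => p.
have dp := @test_function_derivable R O k phi tp p.
exact: deriveZ.
Qed.

Lemma weak_derivativeD alpha w g D E : weak_derivative O alpha w D ->
  weak_derivative O alpha g E -> alpha \in multi 1 ->
  weak_derivative O alpha (fun p => w p + g p) (fun p => D p + E p).
Proof.
move=> [Lw LD wD] [Lg LE gE] a1; split; try exact: (sqintD mO).
move=> phi tphi; have Lphi := test_function_L2 tphi.
have LDphi := test_function_L2 (test_function_Dpartial a1 tphi).
have := ipDl mO Lw Lg LDphi; rewrite /l2dot => ->.
have := ipDl mO LD LE Lphi; rewrite /l2dot => ->.
by rewrite wD// gE// mulrDr.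
Qed.

Lemma weak_derivativeZ alpha (c : R) w D : weak_derivative O alpha w D ->
  alpha \in multi 1 ->
  weak_derivative O alpha (fun p => c * w p) (fun p => c * D p).
Proof.
move=> [Lw LD wD] a1; split; try exact: (sqintZ mO).
move=> phi tphi; have Lphi := test_function_L2 tphi.
have LDphi := test_function_L2 (test_function_Dpartial a1 tphi).
have := ipZl mO c Lw LDphi; rewrite /l2dot => ->.
have := ipZl mO c LD Lphi; rewrite /l2dot => ->.
by rewrite wD// mulrCA.
Qed.

Lemma weak_derivativeB alpha w g D E : weak_derivative O alpha w D ->
  weak_derivative O alpha g E -> alpha \in multi 1 ->
  weak_derivative O alpha (fun p => w p - g p) (fun p => D p - E p).
Proof.
move=> wD gE a1; have := weak_derivativeD wD (weak_derivativeZ (-1) gE a1) a1.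
by congr weak_derivative; apply/funext => p; rewrite mulN1r.
Qed.

Lemma weak_derivative_lipschitz (k : 'I_3) alpha g (Dg : pt3 R -> R) (M L : R) :
  (forall phi, Dpartial alpha phi = partial k phi) -> multi_order alpha = 1%N ->
  measurable_fun OO g -> (forall p, O p -> `|g p| <= M) ->
  (forall p (t : R), 0 < t ->
    (forall r : R, 0 <= r <= t -> O (p + r *: basis k)) ->
    `|g (p + t *: basis k) - g p| <= L * t) ->
  (forall p, O p -> (fun n : nat =>
    n.+1%:R * (g (p + n.+1%:R^-1 *: basis k) - g p)) @ \oo --> Dg p) ->
  weak_derivative O alpha g Dg.
Proof.
move=> Dk a1 mg gM gL gD; split.
- exact: (@sqint_bounded _ _ _ mu _ mO _ M finO).
- apply: (@sqint_bounded _ _ _ mu _ mO _ L finO).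
    exact: (@weak_diff_measurable R O oO k g Dg L mg gL gD).
  exact: (@weak_diff_bounded R O oO k g Dg L gL gD).
- move=> phi tphi; rewrite Dk a1 expr1 mulN1r.
  exact: (@integration_by_parts R O oO finO k g Dg M L mg gM gL gD).
Qed.

Lemma test_function_quotient k phi : test_function O phi -> forall p,
  (fun n : nat => n.+1%:R * (phi (p + n.+1%:R^-1 *: basis k) - phi p)) @ \oo -->
  partial k phi p.
Proof.
move=> tphi p.
have nt0 (n : nat) : n.+1%:R^-1 != 0 :> R by rewrite invr_eq0 pnatr_eq0.
have := derive_cvg_seq (@test_function_derivable R O k phi tphi p) nt0 cvg_harmonic.
by under eq_fun do rewrite invrK.
Qed.

Lemma test_weak_derivative alpha phi : alpha \in multi 1 ->
  test_function O phi -> weak_derivative O alpha phi (Dpartial alpha phi).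
Proof.
move=> /multi1_partial[k [Dk a1]] tphi.
have [C C0 phiC] := test_function_bounded tphi.
have [C' C'0 dphiC] := test_function_bounded (test_function_partial k tphi).
rewrite Dk; apply: (weak_derivative_lipschitz (M := C) (L := C') Dk a1) => //.
- exact: measurable_funTS (test_function_measurable tphi).
- move=> p t t0 _; apply: increment_le => //; last exact: ltW.
  exact: (test_function_derivable tphi).
- by move=> p _; exact: test_function_quotient.
Qed.

(* Integrating x (phi^2)' by parts gives |phi|^2 = - 2 <x phi', phi>. *)
Lemma poincare (B : R) phi : (forall p, O p -> `|p.1.1| <= B) ->
  test_function O phi ->
  ip phi phi <= 4 * B ^+ 2 *
    ip (Dpartial (1, 0, 0)%N phi) (Dpartial (1, 0, 0)%N phi).
Proof.
move=> OB tphi; pose k : 'I_3 := inord 0; pose dphi := partial k phi.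
have tdphi : test_function O dphi by exact: test_function_partial.
have [C C0 phiC] := test_function_bounded tphi.
have [C' C'0 dphiC] := test_function_bounded tdphi.
have sp := test_function_L2 tphi; have sd := test_function_L2 tdphi.
pose x (p : pt3 R) := p.1.1.
have mx : measurable_fun setT (x : mpt3 R -> R).
  by apply: continuous_measurable3 => p; apply: cvg_comp; exact: cvg_fst.
have mphi := test_function_measurable tphi.
have xe (p : pt3 R) (t : R) : x (p + t *: basis k) = x p + t.
  have -> : x (p + t *: basis k) = x p + t * (k == 0 :> nat)%:R by [].
  by rewrite /k inordK// mulr1.
have xB p : O p -> `|x p| <= B by exact: OB.
have Bge p : O p -> 0 <= B by move=> /xB; exact: le_trans.
(* The function to be integrated by parts is x phi; testing its weak derivative against phi gives
   the identity [E]. *)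
have [_ Lg ibp] : weak_derivative O (1, 0, 0)%N (fun p => x p * phi p)
    (fun p => phi p + x p * dphi p).
  apply: (@weak_derivative_lipschitz k _ _ _ (B * C) (B * C' + C)) => //.
  - by apply: measurable_funTS; exact: measurable_funM.
  - by move=> p Op; rewrite normrM ler_pM// xB.
  - move=> p t t0 seg; have Op : O p.
      by have := seg 0; rewrite scale0r addr0; apply; rewrite lexx ltW.
    rewrite xe (_ : _ - _ = x p * (phi (p + t *: basis k) - phi p) +
       t * phi (p + t *: basis k)); last by ring.
    rewrite (le_trans (ler_normD _ _))// mulrDl lerD//.
      rewrite normrM -mulrA ler_pM//; first exact: xB.
      apply: increment_le => //; last exact: ltW.
      exact: (test_function_derivable tphi).
    by rewrite normrM gtr0_norm// mulrC ler_wpM2r// ltW.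
  - move=> p Op.
    have -> : (fun n : nat => n.+1%:R * (x (p + n.+1%:R^-1 *: basis k) * phi (p + n.+1%:R^-1 *: basis k) - x p * phi p)) =
      (fun n : nat => x p * (n.+1%:R * (phi (p + n.+1%:R^-1 *: basis k) - phi p)) + phi (p + n.+1%:R^-1 *: basis k)).
      by apply/funext => n; rewrite xe; field; rewrite addrC natr1.
    rewrite addrC; apply: cvgD.
      by apply: cvgM; [exact: cvg_cst|exact: test_function_quotient].
    have [[cphi _] _] := (tphi.1 0%N, tt).
    have c : (fun n : nat => p + n.+1%:R^-1 *: basis k) @ \oo --> p.
      suff : (fun n : nat => p + n.+1%:R^-1 *: basis k) @ \oo --> p + 0 *: basis k.
        by rewrite scale0r addr0.
      by apply: cvgD; [exact: cvg_cst|apply: cvgZr_tmp; exact: cvg_harmonic].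
    exact: (cvg_comp _ _ c (cphi p)).
have sx : L2 O (fun p => x p * dphi p).
  apply: (@sqint_bounded _ _ _ mu _ mO _ (B * C') finO).
    apply: measurable_funTS; apply: measurable_funM => //.
    exact: test_function_measurable tdphi.
  by move=> p Op; rewrite normrM ler_pM// xB.
have E : ip (fun p => x p * phi p) dphi = - ip (fun p => phi p + x p * dphi p) phi.
  by have := ibp phi tphi; rewrite expr1 mulN1r.
have -> : Dpartial (1, 0, 0)%N phi = dphi by [].
have E1 : ip (fun p => x p * phi p) dphi = ip (fun p => x p * dphi p) phi.
  by apply: eq_Rintegral => p _; ring.
have E2 : ip phi phi = - 2 * ip (fun p => x p * dphi p) phi.
  by move: E; rewrite E1 (ipDl mO sp sx sp); lra.
(* By [E2] the mixed term of |x phi' + phi / 2|^2 equals - |phi|^2 / 2, so nonnegativity gives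
   |phi|^2 / 4 <= |x phi'|^2. *)
have h := ip_ge0 mu OO (fun p => x p * dphi p + 2^-1 * phi p).
rewrite normD2 ?ipZl ?ipZr// in h; do ?exact: (sqintZ mO).
have xd : ip (fun p => x p * dphi p) (fun p => x p * dphi p) <= B ^+ 2 * ip dphi dphi.
  rewrite -(ipZl mO (B ^+ 2) sd sd).
  apply: le_Rintegral => //.
  - exact: (sqint_mul mO sx sx).
  - by have := sqint_mul mO (sqintZ mO (B ^+ 2) sd) sd.
  - move=> p Op; rewrite -expr2 exprMn -mulrA -expr2 ler_wpM2r ?sqr_ge0//.
    rewrite -(real_normK (num_real (x p))) lerXn2r ?nnegrE ?xB//.
    exact: Bge Op.
move: E2 h xd; move: (ip phi phi) (ip _ phi) (ip _ (fun p => x p * dphi p)) (ip dphi dphi).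
by clear => a b c e; lra.
Qed.

End WeakDerivatives.

Lemma Rintegral_sum_seq d (T : measurableType d) (R : realType)
    (mu : {measure set T -> \bar R}) (O : set T) (I : eqType) (s : seq I)
    (F : I -> T -> R) : measurable O ->
  (forall i, i \in s -> mu.-integrable O (EFin \o F i)) ->
  mu.-integrable O (EFin \o fun p => \sum_(i <- s) F i p) /\
  \int[mu]_(p in O) (\sum_(i <- s) F i p) = \sum_(i <- s) \int[mu]_(p in O) F i p.
Proof.
move=> mO; elim: s => [|i s IH] iF.
  rewrite big_nil; under eq_Rintegral do rewrite big_nil.
  rewrite /Rintegral integral0; split=> //.
  rewrite (_ : EFin \o _ = cst 0%E); first exact: integrable0.
  by apply/funext => p /=; rewrite big_nil.
have [js es] := IH (fun j js => iF j (mem_behead (s := i :: s) js)).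
have ji := iF i (mem_head i s).
have E : (fun p => \sum_(j <- i :: s) F j p) = (F i \+ fun p => \sum_(j <- s) F j p).
  by apply/funext => p; rewrite big_cons.
rewrite E; split; first exact: (integrableD_EFin mO ji js).
by rewrite big_cons -es -RintegralD.
Qed.

Lemma cvg_sum_seq (R : realType) (I : eqType) (s : seq I) (u : I -> nat -> R)
    (l : I -> R) : (forall i, i \in s -> u i @ \oo --> l i) ->
  (fun n => \sum_(i <- s) u i n) @ \oo --> \sum_(i <- s) l i.
Proof.
elim: s => [|i s IH] ul.
  by rewrite big_nil; under eq_fun do rewrite big_nil; exact: cvg_cst.
rewrite big_cons; under eq_fun do rewrite big_cons.
apply: cvgD; first exact: ul (mem_head _ _).
by apply: IH => j js; apply: ul; rewrite inE js orbT.
Qed.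

Section Arithmetic.
Variable R : realFieldType.
Implicit Types a b c e m t u : R.

(** On the line from phi to eta the energy is [a + 2 t c + t^2 b]. With its midpoint value bounded
    below by m, the parallelogram identity bounds the squared distance [b] between phi and eta. *)
Lemma midpoint_le a b c m :
  m <= a + 2 * 2^-1 * c + 2^-1 ^+ 2 * b ->
  b <= 2 * a + 2 * (a + 2 * 1 * c + 1 ^+ 2 * b) - 4 * m.
Proof. by move=> H; lra. Qed.

Lemma near_minimum_le a b e m : 0 <= e -> b < m + 4^-1 * e -> a < m + e ->
  2 * a + 2 * b - 4 * m <= 4 * e.
Proof. by move=> *; lra. Qed.

Lemma near_minimum_ge a c e m t u : a < m + u ->
  m <= a + 2 * t * c + t ^+ 2 * e -> 0 <= u + 2 * t * c + t ^+ 2 * e.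
Proof. by move=> *; lra. Qed.

Lemma quadratic_ge0_eq0 b e : 0 <= e ->
  (forall t, 0 <= 2 * t * b + t ^+ 2 * e) -> b = 0.
Proof.
(* Dividing by e + 1 rather than by e covers the case e = 0. *)
move=> e0 /(_ (- b / (e + 1))).
have e1 : 0 < e + 1 by lra.
rewrite (_ : _ + _ = - (b ^+ 2 * (e + 2) / (e + 1) ^+ 2)); last first.
  by field; rewrite gt_eqF.
rewrite oppr_ge0 => H; apply/eqP; rewrite -sqrf_eq0 eq_le sqr_ge0 andbT.
have e2 : 0 < (e + 2) / (e + 1) ^+ 2 by rewrite divr_gt0 ?exprn_gt0//; lra.
by move: H; rewrite -mulrA pmulr_lle0.
Qed.

End Arithmetic.

Section DirichletPrinciple.
Context {R : realType}.
Variable O : set (pt3 R).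
Hypothesis oO : open O.
Hypothesis finO : (mu3 (O : set (mpt3 R)) < +oo)%E.
Variable B : R.
Hypothesis OB : forall p, O p -> `|p.1.1| <= B.
Local Notation OO := (O : set (mpt3 R)).
Local Notation mu := (mu3 : {measure set (mpt3 R) -> \bar R}).
Local Notation ip := (l2dot mu OO).
Implicit Types (w phi eta : pt3 R -> R) (alpha : nat * nat * nat).
Implicit Types (D E : nat * nat * nat -> pt3 R -> R).

Let mO : measurable OO. Proof. exact: open_measurable3. Qed.

Definition dirichlet D E := \sum_(alpha <- multi 1) ip (D alpha) (E alpha).

Definition sqint1 D := forall alpha, alpha \in multi 1 -> L2 O (D alpha).

Lemma dirichletE D E : sqint1 D -> sqint1 E ->
  \int[mu]_(p in OO) (\sum_(alpha <- multi 1) D alpha p * E alpha p) =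
  dirichlet D E.
Proof.
move=> sD sE; have [//|_ ->//] := @Rintegral_sum_seq _ _ _ mu OO _ (multi 1)
  (fun alpha p => D alpha p * E alpha p) mO.
by move=> alpha a1; apply: (sqint_mul mO); [exact: sD|exact: sE].
Qed.

Lemma dirichlet_norm D : sqint1 D ->
  \int[mu]_(p in OO) (\sum_(alpha <- multi 1) D alpha p ^+ 2) = dirichlet D D.
Proof.
by move=> sD; rewrite -dirichletE//; apply: eq_Rintegral => p _;
  apply: eq_bigr => alpha _; rewrite expr2.
Qed.

Lemma dirichlet_ge0 D : 0 <= dirichlet D D.
Proof. by apply: sumr_ge0 => alpha _; exact: ip_ge0. Qed.

Lemma le_dirichlet D alpha : alpha \in multi 1 ->
  ip (D alpha) (D alpha) <= dirichlet D D.
Proof.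
move=> a1; rewrite /dirichlet (big_rem _ a1)/= lerDl.
by apply: sumr_ge0 => beta _; exact: ip_ge0.
Qed.

Definition grad phi alpha := Dpartial alpha phi.

Lemma sqint1_grad phi : test_function O phi -> sqint1 (grad phi).
Proof.
by move=> tphi alpha a1; apply: (test_function_L2 oO finO);
  exact: test_function_Dpartial.
Qed.

Lemma dirichlet_line D E (t : R) : sqint1 D -> sqint1 E ->
  dirichlet (fun alpha p => D alpha p + t * E alpha p)
    (fun alpha p => D alpha p + t * E alpha p) =
  dirichlet D D + 2 * t * dirichlet D E + t ^+ 2 * dirichlet E E.
Proof.
move=> sD sE; rewrite /dirichlet !mulr_sumr -!big_split/=.
apply: eq_big_seq => alpha a1; have sDa := sD _ a1; have sEa := sE _ a1.
have stE := sqintZ mO t sEa.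
by rewrite (normD2 mO sDa stE) !(ipZl mO, ipZr mO)//; ring.
Qed.

Variables (g : pt3 R -> R) (Dg : nat * nat * nat -> pt3 R -> R).
Hypothesis gD : weak_derivatives O 1 g Dg.

Let sDg : sqint1 Dg. Proof. by move=> alpha /gD[]. Qed.

(** The weak gradient of [g + phi]; [J] is the Dirichlet energy of that sum. *)
Let shift phi alpha p := Dg alpha p + grad phi alpha p.

Let J phi := dirichlet (shift phi) (shift phi).

Let sqint1_shift phi : test_function O phi -> sqint1 (shift phi).
Proof.
move=> tphi alpha a1; apply: (sqintD mO); first exact: sDg.
exact: sqint1_grad.
Qed.

Let J_line phi eta (t : R) : test_function O phi -> test_function O eta ->
  J (fun p => phi p + t * eta p) =
  J phi + 2 * t * dirichlet (shift phi) (grad eta) + t ^+ 2 * dirichlet (grad eta) (grad eta).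
Proof.
move=> tp te; rewrite -dirichlet_line ?/J; [|exact: sqint1_shift|exact: sqint1_grad].
apply: eq_big_seq => alpha a1; have tte := test_functionZ t te.
rewrite /shift /grad (DpartialD a1 tp tte) (DpartialZ _ a1 te).
by apply: eq_Rintegral => p _; rewrite !addrA.
Qed.

Let m := inf [set J phi | phi in test_function O].

Let m_lb phi : test_function O phi -> m <= J phi.
Proof.
move=> tphi; apply: ge_inf; last by exists phi.
by exists 0 => _ [psi _ <-]; exact: dirichlet_ge0.
Qed.

(** Through [parallelogram], the rate 4^-n becomes the rate of the squared increments that
    [sqint_complete] asks for. *)
Let minimizing_sequence : exists phi : nat -> pt3 R -> R,
  forall n, test_function O (phi n) /\ J (phi n) < m + 4^-1 ^+ n.
Proof.
suff /choice[phi phiP] : forall n : nat, exists phi : pt3 R -> R,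
    test_function O phi /\ J phi < m + 4^-1 ^+ n by exists phi.
move=> n; have [||_ [phi tphi <-] Jphi] := @inf_adherent R [set J phi | phi in test_function O] (4^-1 ^+ n).
- by rewrite exprn_gt0// invr_gt0.
- split; last by exists 0 => _ [psi _ <-]; exact: dirichlet_ge0.
  by exists (J (fun=> 0)), (fun=> 0) => //; exact: test_function0.
- by exists phi.
Qed.

Let parallelogram phi eta : test_function O phi -> test_function O eta ->
  dirichlet (grad (fun p => eta p - phi p)) (grad (fun p => eta p - phi p)) <=
  2 * J phi + 2 * J eta - 4 * m.
Proof.
move=> tp te.
have td : test_function O (fun p => eta p - phi p).
  have := test_functionD te (test_functionZ (-1) tp).
  by congr test_function; apply/funext => p; rewrite mulN1r.
have J1 := J_line 1 tp td; have J2 := J_line 2^-1 tp td.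
have E1 : (fun p => phi p + 1 * (eta p - phi p)) = eta by apply/funext => p; ring.
have := m_lb (test_functionD tp (test_functionZ 2^-1 td)).
by rewrite J2; rewrite E1 in J1; rewrite J1; exact: midpoint_le.
Qed.

(** The minimising sequence is Cauchy in energy by the parallelogram law and in L2 by the Poincare
    inequality, and weak derivatives pass to L2 limits. Minimality of the limit gives the weak
    Laplace equation; comparison with [phi = 0] gives the energy bound. *)
Theorem dirichlet_principle : exists w Dw,
  [/\ weak_derivatives O 1 w Dw,
      forall eta, test_function O eta ->
        \int[mu]_(p in OO) (\sum_(alpha <- multi 1) Dw alpha p * Dpartial alpha eta p) = 0,
      H10 O (fun p => w p - g p)
    & dirichlet Dw Dw <= dirichlet Dg Dg].
Proof.
have [phi phiP] := minimizing_sequence.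
have tphi n : test_function O (phi n) by have [] := phiP n.
have Jphi n : J (phi n) < m + 4^-1 ^+ n by have [] := phiP n.
have td n : test_function O (fun p => phi n.+1 p - phi n p).
  have := test_functionD (tphi n.+1) (test_functionZ (-1) (tphi n)).
  by congr test_function; apply/funext => p; rewrite mulN1r.
have fast n : dirichlet (grad (fun p => phi n.+1 p - phi n p))
    (grad (fun p => phi n.+1 p - phi n p)) <= 4 * 4^-1 ^+ n.
  apply: le_trans (parallelogram (tphi n) (tphi n.+1)) _.
  apply: near_minimum_le => //.
  by rewrite -exprS.
have gradB n alpha : alpha \in multi 1 -> grad (fun p => phi n.+1 p - phi n p) alpha =
    fun p => grad (phi n.+1) alpha p - grad (phi n) alpha p.
  move=> a1; have tn := test_functionZ (-1) (tphi n).
  have -> : (fun p => phi n.+1 p - phi n p) = fun p => phi n.+1 p + -1 * phi n p.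
    by apply/funext => p; rewrite mulN1r.
  rewrite /grad (DpartialD a1 (tphi n.+1) tn) (DpartialZ _ a1 (tphi n)).
  by apply/funext => p; rewrite mulN1r.
have [psi spsi cpsi] : exists2 psi, L2 O psi & sqcvg mu OO phi psi.
  apply: (@sqint_complete _ _ _ mu OO mO finO phi (4 * B ^+ 2 * 4)).
    by move=> n; exact: (test_function_L2 oO finO (tphi n)).
  move=> n; apply: le_trans (poincare oO finO OB (td n)) _.
  rewrite -[leRHS]mulrA; apply: ler_wpM2l; first by rewrite mulr_ge0 ?sqr_ge0.
  apply: le_trans (fast n).
  exact: (@le_dirichlet (grad _) (1, 0, 0)%N).
have /choice[G GP] alpha : exists G, alpha \in multi 1 ->
    L2 O G /\ sqcvg mu OO (fun n => grad (phi n) alpha) G.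
  have [a1|] := boolP (alpha \in multi 1); last by exists (fun=> 0).
  have [||G sG cG] := @sqint_complete _ _ _ mu OO mO finO (fun n => grad (phi n) alpha) 4.
  - by move=> n; exact: sqint1_grad.
  - move=> n; have := le_trans (le_dirichlet (grad (fun p => phi n.+1 p - phi n p)) a1) (fast n).
    by rewrite gradB.
  by exists G.
have wpsi : weak_derivatives O 1 psi G.
  move=> alpha a1; have [sG cG] := GP alpha a1; split => // eta te.
  have seta := test_function_L2 oO finO te.
  have sDeta := sqint1_grad te a1.
  have [k [Dk o1]] := @multi1_partial R alpha a1.
  have c1 := ip_cvg mO (fun n => test_function_L2 oO finO (tphi n)) spsi sDeta cpsi.
  have c2 := cvgN (ip_cvg mO (fun n => sqint1_grad (tphi n) a1) sG seta cG).
  rewrite o1 expr1 mulN1r; apply: (cvg_unique (@Rhausdorff R)) c1 _.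
  have E n : ip (phi n) (grad eta alpha) = - ip (grad (phi n) alpha) eta.
    have [_ _ /(_ eta te)] := test_weak_derivative oO finO a1 (tphi n).
    by rewrite o1 expr1 mulN1r.
  have -> : (fun n => ip (phi n) (grad eta alpha)) = fun n => - ip (grad (phi n) alpha) eta.
    exact/funext/E.
  exact: c2.
pose w p := g p + psi p.
pose Dw alpha p := Dg alpha p + G alpha p.
have sG : sqint1 G by move=> alpha /GP[].
have wD : weak_derivatives O 1 w Dw.
  by move=> alpha a1; apply: (weak_derivativeD oO finO) => //; [exact: gD|exact: wpsi].
have sDw : sqint1 Dw by move=> alpha /wD[].
have cDw alpha : alpha \in multi 1 -> sqcvg mu OO (fun n => shift (phi n) alpha) (Dw alpha).
  by move=> a1; apply: sqcvgDl; have [] := GP _ a1.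
have cJ : (fun n => J (phi n)) @ \oo --> dirichlet Dw Dw.
  apply: cvg_sum_seq => alpha a1.
  exact: (ip_cvg_norm mO (fun n => sqint1_shift (tphi n) a1) (sDw _ a1) (cDw _ a1)).
have c4 : (fun n => 4^-1 ^+ n) @ \oo --> (0 : R).
  by apply: cvg_expr; rewrite ger0_norm ?invr_ge0// invf_lt1 ?ltr1n.
have Jm : dirichlet Dw Dw = m.
  apply/eqP; rewrite eq_le; apply/andP; split.
    rewrite -[leRHS]addr0.
    apply: (ler_cvg_to cJ (cvgD (cvg_cst m) c4)).
    by apply: nearW => n /=; exact: ltW.
  apply: (ler_cvg_to (cvg_cst m) cJ).
  by apply: nearW => n /=; exact: m_lb.
exists w, Dw; split => //.
- move=> eta te; rewrite dirichletE//; last exact: sqint1_grad.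
  pose b := dirichlet Dw (grad eta); pose e := dirichlet (grad eta) (grad eta).
  have cb : (fun n => dirichlet (shift (phi n)) (grad eta)) @ \oo --> b.
    apply: cvg_sum_seq => alpha a1.
    exact: (ip_cvg mO (fun n => sqint1_shift (tphi n) a1) (sDw _ a1)
      (sqint1_grad te a1) (cDw _ a1)).
  (* First variation: the inequality J (phi n + t eta) >= m passes to the limit and leaves a
     quadratic in t without constant term. *)
  have key t : 0 <= 2 * t * b + t ^+ 2 * e.
    have c : (fun n => 4^-1 ^+ n + 2 * t * dirichlet (shift (phi n)) (grad eta) + t ^+ 2 * e) @ \oo
        --> 0 + 2 * t * b + t ^+ 2 * e.
      apply: cvgD; last exact: cvg_cst.
      by apply: cvgD => //; apply: cvgM => //; exact: cvg_cst.
    rewrite add0r in c.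
    apply: (ler_cvg_to (cvg_cst 0) c); apply: nearW => n /=.
    have := m_lb (test_functionD (tphi n) (test_functionZ t te)).
    by rewrite J_line//; exact: near_minimum_ge.
  have e0 : 0 <= e by exact: dirichlet_ge0.
  exact: quadratic_ge0_eq0 key.
- have wg : (fun p => w p - g p) = psi by apply/funext => p; rewrite /w addrAC subrr add0r.
  rewrite wg; split; first by exists G.
  exists phi, (fun n => Num.sqrt (dirichlet (fun alpha p => G alpha p - grad (phi n) alpha p)
    (fun alpha p => G alpha p - grad (phi n) alpha p))).
  split => //.
  + move=> n; exists (fun alpha p => G alpha p - grad (phi n) alpha p).
      move=> alpha a1; apply: (weak_derivativeB oO finO) => //; first exact: wpsi.
      exact: test_weak_derivative.
    rewrite dirichlet_norm// => alpha a1; apply: (sqintB mO); first exact: sG.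
    exact: sqint1_grad.
  + move: cpsi; rewrite /sqcvg; set u := (X in X @ _ --> _ -> _).
    rewrite (_ : u = fun n => \int[mu]_(p in OO) (psi p - phi n p) ^+ 2); first by [].
    by apply/funext => n; apply: eq_Rintegral => p _; ring.
  + rewrite -[X in _ --> X]sqrtr0; apply: continuous_cvg; first exact: sqrt_continuous.
    have E0 : \sum_(alpha <- multi 1) (0 : R) = 0 by rewrite big1_eq.
    rewrite -[X in _ --> X]E0.
    apply: cvg_sum_seq => alpha a1; have [_] := GP _ a1.
    rewrite /sqcvg; set u := (X in X @ _ --> _ -> _); set v := (X in _ -> X @ _ --> _).
    rewrite (_ : u = v); first by [].
    by apply/funext => n; apply: eq_Rintegral => p _; ring.
- rewrite Jm; have := m_lb (test_function0 O); congr (_ <= _).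
  apply: eq_big_seq => alpha a1; have [k [Dk _]] := @multi1_partial R alpha a1.
  rewrite /shift /grad Dk; apply: eq_Rintegral => p _.
  by rewrite /partial derive_cst addr0.
Qed.

End DirichletPrinciple.

(** * Triangles in space *)

Section Coordinates.
Context {R : realType}.
Implicit Types (p q : pt3 R) (a : R).

Lemma coordD p q : [/\ (p + q).1.1 = p.1.1 + q.1.1,
  (p + q).1.2 = p.1.2 + q.1.2 & (p + q).2 = p.2 + q.2].
Proof. by []. Qed.

Lemma coordN p : [/\ (- p).1.1 = - p.1.1, (- p).1.2 = - p.1.2 & (- p).2 = - p.2].
Proof. by []. Qed.

Lemma coordZ a p : [/\ (a *: p).1.1 = a * p.1.1,
  (a *: p).1.2 = a * p.1.2 & (a *: p).2 = a * p.2].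
Proof. by []. Qed.

(** A multirule for rewriting; each entry projects one coordinate identity out of a conjunction. *)
Definition coordE :=
  ((fun p q => let: And3 a _ _ := coordD p q in a),
   (fun p q => let: And3 _ a _ := coordD p q in a),
   (fun p q => let: And3 _ _ a := coordD p q in a),
   (fun p => let: And3 a _ _ := coordN p in a),
   (fun p => let: And3 _ a _ := coordN p in a),
   (fun p => let: And3 _ _ a := coordN p in a),
   (fun a p => let: And3 b _ _ := coordZ a p in b),
   (fun a p => let: And3 _ b _ := coordZ a p in b),
   (fun a p => let: And3 _ _ b := coordZ a p in b)).

Lemma pt3_eq p q : p.1.1 = q.1.1 -> p.1.2 = q.1.2 -> p.2 = q.2 -> p = q.
Proof. by case: p q => [[? ?] ?] [[? ?] ?] /= -> -> ->. Qed.

End Coordinates.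

Section Triangle.
Context {R : realType}.
Implicit Types (p q x y z n : pt3 R) (a b c : R).

Definition cross p q : pt3 R :=
  (p.1.2 * q.2 - p.2 * q.1.2, p.2 * q.1.1 - p.1.1 * q.2,
   p.1.1 * q.1.2 - p.1.2 * q.1.1).

Lemma inner_ge0 p : 0 <= inner p p.
Proof. by rewrite /inner -!expr2 !addr_ge0 ?sqr_ge0. Qed.

Lemma inner_eq0 p : inner p p = 0 -> p = 0.
Proof.
move: p => [[p1 p2] p3]; rewrite /inner/= => H.
have h1 : p1 = 0 by nra.
have h2 : p2 = 0 by nra.
have h3 : p3 = 0 by nra.
by rewrite h1 h2 h3.
Qed.

Lemma inner_gt0 p : p != 0 -> 0 < inner p p.
Proof.
by move=> p0; rewrite lt_neqAle inner_ge0 andbT; apply: contraNneq p0 => /esym/inner_eq0 ->.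
Qed.

Lemma inner_continuous n : continuous (inner n : pt3 R -> R).
Proof.
move=> p; rewrite /inner; apply: cvgD; first apply: cvgD.
- by apply: cvgM; [exact: cvg_cst|apply: cvg_comp; exact: cvg_fst].
- apply: cvgM; first exact: cvg_cst.
  by apply: (@cvg_comp _ _ _ fst snd _ (nbhs p.1)); [exact: cvg_fst|exact: cvg_snd].
- by apply: cvgM; [exact: cvg_cst|exact: cvg_snd].
Qed.

Lemma innerD n p q : inner n (p + q) = inner n p + inner n q.
Proof. by rewrite /inner !coordE; ring. Qed.

Lemma innerZ n a p : inner n (a *: p) = a * inner n p.
Proof. by rewrite /inner !coordE; ring. Qed.

(** Cramer's rule for q in the basis u, v, n = u x v, multiplied by the determinant |n|^2. *)
Lemma cross_decomposition u v q : let n := cross u v in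
  inner n n *: q = inner n (cross q v) *: u + inner n (cross u q) *: v + inner n q *: n.
Proof. by apply: pt3_eq; rewrite /inner /cross !coordE /= ; ring. Qed.

Definition triangle x y z : set (pt3 R) :=
  [set p | exists a b c, [/\ 0 <= a, 0 <= b, 0 <= c, a + b + c = 1
                           & p = a *: x + b *: y + c *: z]].

Lemma triangle_compact x y z : compact (triangle x y z).
Proof.
pose S := [set w : R * R | [/\ 0 <= w.1, 0 <= w.2 & w.1 + w.2 <= 1]].
have cS : compact S.
  apply: (@subclosed_compact _ _ ((`[0, 1]%classic : set R) `*` (`[0, 1]%classic : set R))).
  - have cl (f : R * R -> R) : continuous f -> closed [set w | 0 <= f w].
      move=> cf; apply: (@closed_comp _ _ f [set r | 0 <= r]); last exact: closed_ge.
      by move=> w _; exact: cf.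
    rewrite (_ : S = [set w | 0 <= w.1] `&` [set w | 0 <= w.2] `&` [set w | 0 <= 1 - w.1 - w.2]).
      apply: closedI; first apply: closedI.
      + by apply: cl => w; exact: cvg_fst.
      + by apply: cl => w; exact: cvg_snd.
      + apply: cl => w; apply: cvgB; last exact: cvg_snd.
        by apply: cvgB; [exact: cvg_cst|exact: cvg_fst].
    by apply/seteqP; split => w /=; [case=> ? ? ?|case=> -[] ? ? ?]; split => //; lra.
  - by apply: compact_setX; exact: segment_compact.
  - by move=> w [w1 w2 w12]; split; rewrite /= in_itv/=; apply/andP; split => //; lra.
pose f (w : R * R) := w.1 *: x + w.2 *: y + (1 - w.1 - w.2) *: z.
have cf : continuous f.
  move=> w; apply: cvgD; first apply: cvgD.
  - by apply: cvgZr_tmp; exact: cvg_fst.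
  - by apply: cvgZr_tmp; exact: cvg_snd.
  - apply: cvgZr_tmp; apply: cvgB; last exact: cvg_snd.
    by apply: cvgB; [exact: cvg_cst|exact: cvg_fst].
rewrite (_ : triangle x y z = f @` S).
  by apply: continuous_compact => //; exact: continuous_subspaceT.
apply/seteqP; split => [p [a [b [c [a0 b0 c0 abc ->]]]]|_ [w [w1 w2 w12] <-]].
  exists (a, b); first by split => //=; lra.
  by rewrite /f/= (_ : 1 - a - b = c)//; lra.
by exists w.1, w.2, (1 - w.1 - w.2); split => //; lra.
Qed.

Section Nondegenerate.
Variables (x y z : pt3 R).
Let n := cross (y - x) (z - x).
Hypothesis n0 : n != 0.

Let N := inner n n.
Let N0 : 0 < N. Proof. exact: inner_gt0. Qed.

(** Quotients of signed areas, measured along the normal n. They are affine on the whole space, so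
    continuity also holds off the plane. *)
Definition bary2 p := inner n (cross (p - x) (z - x)) / N.
Definition bary3 p := inner n (cross (y - x) (p - x)) / N.
Definition bary1 p := 1 - bary2 p - bary3 p.

Lemma bary_decomposition p : inner n p = inner n x ->
  p = bary1 p *: x + bary2 p *: y + bary3 p *: z.
Proof.
move=> np; have := cross_decomposition (y - x) (z - x) (p - x).
rewrite -/n -/N /= (_ : inner n (p - x) = 0) ?scale0r ?addr0; last first.
  by rewrite innerD np -scaleN1r innerZ; ring.
move=> /(congr1 (fun q => N^-1 *: q)); rewrite scalerA mulVf ?gt_eqF// scale1r.
rewrite scalerDr !scalerA ![N^-1 * _]mulrC -/(bary2 p) -/(bary3 p) => E.
rewrite -[LHS](subrK x) E /bary1; apply: pt3_eq; rewrite !coordE; ring.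
Qed.

(** Later proofs recognise sides, vertices and outside points through this uniqueness of
    coordinates. It follows from bilinearity of the cross product, in the basis y - x, z - x of the
    plane. *)
Lemma bary_comb a b c p : a + b + c = 1 -> p = a *: x + b *: y + c *: z ->
  [/\ bary1 p = a, bary2 p = b, bary3 p = c & inner n p = inner n x].
Proof.
move=> abc pE.
have pxE : p - x = b *: (y - x) + c *: (z - x).
  by rewrite pE (_ : a = 1 - b - c); [apply: pt3_eq; rewrite !coordE; ring|lra].
have N1 : N != 0 by rewrite gt_eqF.
have b2 : bary2 p = b.
  rewrite /bary2 pxE (_ : cross _ _ = b *: n) ?innerZ ?mulfK//.
  by apply: pt3_eq; rewrite /n /cross !coordE /=; ring.
have b3 : bary3 p = c.
  rewrite /bary3 pxE (_ : cross _ _ = c *: n) ?innerZ ?mulfK//.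
  by apply: pt3_eq; rewrite /n /cross !coordE /=; ring.
split => //; first by rewrite /bary1 b2 b3; lra.
rewrite -[p](subrK x) pxE innerD -[RHS]add0r; congr (_ + _).
by rewrite innerD !innerZ /n /inner /cross !coordE /=; ring.
Qed.

Lemma triangleE p : triangle x y z p <->
  [/\ inner n p = inner n x, 0 <= bary1 p, 0 <= bary2 p & 0 <= bary3 p].
Proof.
split=> [[a [b [c [a0 b0 c0 abc pE]]]]|[np b1 b2 b3]].
  by have [-> -> -> ->] := bary_comb abc pE.
exists (bary1 p), (bary2 p), (bary3 p); split => //.
  by rewrite /bary1; ring.
exact: bary_decomposition.
Qed.

Lemma bary_continuous : [/\ continuous bary1, continuous bary2 & continuous bary3].
Proof.
have cc (u v : pt3 R) : continuous (fun p => inner n (cross (p - u) v)).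
  have -> : (fun p => inner n (cross (p - u) v)) =
     fun p => inner (cross v n) p - inner n (cross u v).
    by apply/funext => p; rewrite /inner /cross !coordE /=; ring.
  by move=> p; apply: cvgB; [exact: inner_continuous|exact: cvg_cst].
have cc' (u v : pt3 R) : continuous (fun p => inner n (cross v (p - u))).
  have -> : (fun p => inner n (cross v (p - u))) =
     fun p => inner (cross n v) p - inner n (cross v u).
    by apply/funext => p; rewrite /inner /cross !coordE /=; ring.
  by move=> p; apply: cvgB; [exact: inner_continuous|exact: cvg_cst].
have c2 : continuous bary2 by move=> p; apply: cvgM; [exact: cc|exact: cvg_cst].
have c3 : continuous bary3 by move=> p; apply: cvgM; [exact: cc'|exact: cvg_cst].
split => // p; apply: cvgB; last exact: c3.
by apply: cvgB; [exact: cvg_cst|exact: c2].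
Qed.

Lemma triangle_plane : triangle x y z `<=` plane n (inner n x).
Proof. by move=> p /triangleE[]. Qed.

Lemma relint_triangle p : relint (plane n (inner n x)) (triangle x y z) p <->
  [/\ inner n p = inner n x, 0 < bary1 p, 0 < bary2 p & 0 < bary3 p].
Proof.
split.
- case=> tp; rewrite near_withinE => nearp.
  have /triangleE[np b1 b2 b3] := tp.
  have pE := bary_decomposition np.
  (* If the coordinate of p at the vertex w is zero, the point p + t (p - w) has coordinate -t
     there: it stays in the plane but leaves the triangle, for arbitrarily small t. *)
  have escape a b c w : a + b + c = 1 -> w = a *: x + b *: y + c *: z -> 
      inner n w = inner n x -> (forall t : R, 0 < t ->
        ~ triangle x y z (p + t *: (p - w))) -> False.
    move=> abc wE nw out.
    have cl : (fun k : nat => p + k.+1%:R^-1 *: (p - w)) @ \oo --> p.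
      suff : (fun k : nat => p + k.+1%:R^-1 *: (p - w)) @ \oo --> p + 0 *: (p - w).
        by rewrite scale0r addr0.
      by apply: cvgD; [exact: cvg_cst|apply: cvgZr_tmp; exact: cvg_harmonic].
    have [k _ /(_ k (leqnn k))] := cl _ nearp.
    move=> H; apply: (out k.+1%:R^-1); first by rewrite invr_gt0.
    apply: H; rewrite /plane/= innerD innerZ innerD -scaleN1r innerZ np nw; ring.
  have comb t w : inner n w = inner n x -> forall a b c, w = a *: x + b *: y + c *: z ->
     a + b + c = 1 -> p + t *: (p - w) =
       ((1 + t) * bary1 p - t * a) *: x + ((1 + t) * bary2 p - t * b) *: y +
       ((1 + t) * bary3 p - t * c) *: z.
    move=> nw a b c wE abc; rewrite wE {1 2}pE.
    by apply: pt3_eq; rewrite !coordE; ring.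
  have sb : bary1 p + bary2 p + bary3 p = 1 by rewrite /bary1; ring.
  have vx : x = 1 *: x + 0 *: y + 0 *: z by rewrite scale1r !scale0r !addr0.
  have vy : y = 0 *: x + 1 *: y + 0 *: z by rewrite scale1r !scale0r addr0 add0r.
  have vz : z = 0 *: x + 0 *: y + 1 *: z by rewrite scale1r !scale0r !add0r.
  have sx : (1 : R) + 0 + 0 = 1 by ring.
  have sy : (0 : R) + 1 + 0 = 1 by ring.
  have sz : (0 : R) + 0 + 1 = 1 by ring.
  have [_ _ _ ny] := bary_comb sy vy.
  have [_ _ _ nz] := bary_comb sz vz.
  have sumE t a b c : a + b + c = 1 ->
      (1 + t) * bary1 p - t * a + ((1 + t) * bary2 p - t * b) +
      ((1 + t) * bary3 p - t * c) = 1.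
    move=> abc; transitivity ((1 + t) * (bary1 p + bary2 p + bary3 p) - t * (a + b + c)).
      by ring.
    by rewrite sb abc; ring.
  split=> //; rewrite lt_neqAle ?b1 ?b2 ?b3 andbT; apply/negP => /eqP/esym b0.
  + apply: (escape 1 0 0 x sx vx erefl) => t t0 /triangleE[_].
    have E := comb t x erefl _ _ _ vx sx.
    have [|e _ _ _] := bary_comb _ E; first exact: sumE.
    by rewrite e b0; lra.
  + apply: (escape 0 1 0 y sy vy ny) => t t0 /triangleE[_].
    have E := comb t y ny _ _ _ vy sy.
    have [|_ e _ _] := bary_comb _ E; first exact: sumE.
    by rewrite e b0; lra.
  + apply: (escape 0 0 1 z sz vz nz) => t t0 /triangleE[_].
    have E := comb t z nz _ _ _ vz sz.
    have [|_ _ e _] := bary_comb _ E; first exact: sumE.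
    by rewrite e b0; lra.
- case=> np b1 b2 b3; split; first by apply/triangleE; split => //; exact: ltW.
  rewrite near_withinE; have [c1 c2 c3] := bary_continuous.
  have o (f : pt3 R -> R) : continuous f -> 0 < f p -> \forall q \near p, 0 < f q.
    by move=> cf fp; exact: (@cvgr_gt R _ (nbhs p) _ f (f p) (cf p) 0 fp).
  near=> q => nq; apply/triangleE; split => //; apply: ltW; near: q; exact: o.
Unshelve. all: by end_near. Qed.

Lemma triangle_relint_neq0 : relint (plane n (inner n x)) (triangle x y z) !=set0.
Proof.
have E : 3^-1 + 3^-1 + 3^-1 = 1 :> R by field.
have [b1 b2 b3 np] := bary_comb E erefl.
exists (3^-1 *: x + 3^-1 *: y + 3^-1 *: z); apply/relint_triangle.
by split => //; rewrite ?b1 ?b2 ?b3 invr_gt0.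
Qed.

Lemma triangle_frontier :
  triangle x y z `\` relint (plane n (inner n x)) (triangle x y z) =
  segment x y `|` segment y z `|` segment z x.
Proof.
apply/seteqP; split => [p [tp rp]|p].
  have /triangleE[np b1 b2 b3] := tp.
  have pE := bary_decomposition np.
  have sb : bary1 p + bary2 p + bary3 p = 1 by rewrite /bary1; ring.
  have : [\/ bary1 p = 0, bary2 p = 0 | bary3 p = 0].
    have [e1|b1'] := eqVneq (bary1 p) 0; first by constructor 1.
    have [e2|b2'] := eqVneq (bary2 p) 0; first by constructor 2.
    have [e3|b3'] := eqVneq (bary3 p) 0; first by constructor 3.
    exfalso; apply: rp; apply/relint_triangle; split => //.
    - by rewrite lt_neqAle eq_sym b1'.
    - by rewrite lt_neqAle eq_sym b2'.
    - by rewrite lt_neqAle eq_sym b3'.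
  case=> e.
  - left; right; exists (bary3 p); first by rewrite b3/=; lra.
    by rewrite {1}pE e scale0r add0r (_ : bary2 p = 1 - bary3 p)//; lra.
  - right; exists (bary1 p); first by rewrite b1/=; lra.
    by rewrite {1}pE e scale0r addr0 addrC (_ : bary3 p = 1 - bary1 p)//; lra.
  - left; left; exists (bary2 p); first by rewrite b2/=; lra.
    by rewrite {1}pE e scale0r addr0 (_ : bary1 p = 1 - bary2 p)//; lra.
have key a b c : 0 <= a -> 0 <= b -> 0 <= c -> a + b + c = 1 ->
    [\/ a = 0, b = 0 | c = 0] -> p = a *: x + b *: y + c *: z ->
    (triangle x y z `\` relint (plane n (inner n x)) (triangle x y z)) p.
  move=> a0 b0 c0 abc z0 pE; split; first by exists a, b, c.
  have [e1 e2 e3 _] := bary_comb abc pE.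
  by move=> /relint_triangle[_]; rewrite e1 e2 e3; case: z0 => ->; rewrite ltxx.
case=> [[]|] [t /andP[t0 t1] pE].
- apply: (key (1 - t) t 0); rewrite ?subr_ge0 ?addr0 ?subrK//; first by constructor 3.
  by rewrite scale0r addr0.
- apply: (key 0 (1 - t) t); rewrite ?subr_ge0 ?add0r ?subrK//; first by constructor 1.
  by rewrite scale0r add0r.
- apply: (key t 0 (1 - t)); rewrite ?subr_ge0 ?addr0//; [by ring|by constructor 2|].
  by rewrite scale0r addr0 addrC.
Qed.

End Nondegenerate.
End Triangle.

Section TriangularFacet.
Context {R : realType} {V : eqType}.
Variables (v : V -> pt3 R) (a b c : V).
Hypothesis abc : uniq [:: a; b; c].
Local Notation s := [:: a; b; c].

Let neq : [/\ (a == b) = false, (a == c) = false & (b == c) = false].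
Proof.
by move: abc => /=; rewrite !inE negb_or andbT => /andP[/andP[/negbTE -> /negbTE ->] /negbTE ->].
Qed.

Lemma next3 : [/\ next s a = b, next s b = c & next s c = a].
Proof.
have [ab ac bc] := neq; rewrite /next /= !eqxx.
by rewrite ?[b == a]eq_sym ?[c == a]eq_sym ?[c == b]eq_sym ?ab ?ac ?bc.
Qed.

Lemma prev3 : [/\ prev s a = c, prev s b = a & prev s c = b].
Proof.
have [ab ac bc] := neq; rewrite /prev /= !eqxx.
by rewrite ?[b == a]eq_sym ?[c == a]eq_sym ?[c == b]eq_sym ?ab ?ac ?bc.
Qed.

Lemma edge_of3 i j : i \in s -> j \in s -> i != j -> edge_of s i j.
Proof.
move=> si sj ij; rewrite /edge_of si sj !andTb; have [na nb nc] := next3.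
move: si sj ij; rewrite !inE => /or3P[] /eqP -> /or3P[] /eqP ->;
  by rewrite ?na ?nb ?nc ?eqxx ?orbT.
Qed.

Lemma closed_polygon3 : closed_polygon v s =
  segment (v a) (v b) `|` segment (v b) (v c) `|` segment (v c) (v a).
Proof.
have [na nb nc] := next3; apply/seteqP; split => p.
  case=> i; rewrite !inE => /or3P[] /eqP ->; rewrite ?na ?nb ?nc.
  - by left; left.
  - by left; right.
  - by right.
case=> [[]|] h.
- by exists a; rewrite ?inE ?eqxx ?na.
- by exists b; rewrite ?inE ?eqxx ?orbT ?nb.
- by exists c; rewrite ?inE ?eqxx ?orbT ?nc.
Qed.

Hypothesis nd : cross (v b - v a) (v c - v a) != 0.

Lemma triangle_polygon : exists n d, [/\ n != 0,
    triangle (v a) (v b) (v c) `<=` plane n d, compact (triangle (v a) (v b) (v c)),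
    relint (plane n d) (triangle (v a) (v b) (v c)) !=set0
  & triangle (v a) (v b) (v c) `\` relint (plane n d) (triangle (v a) (v b) (v c)) =
    closed_polygon v s].
Proof.
exists (cross (v b - v a) (v c - v a)), (inner (cross (v b - v a) (v c - v a)) (v a)).
split => //.
- exact: triangle_plane.
- exact: triangle_compact.
- exact: triangle_relint_neq0.
- by rewrite triangle_frontier// closed_polygon3.
Qed.

(* Barycentric coordinates are unique, so a point of two sides has only one nonzero coordinate. *)
Lemma triangle_simple i j p : i \in s -> j \in s -> i != j ->
  segment (v i) (v (next s i)) p -> segment (v j) (v (next s j)) p ->
  exists k, [/\ p = v k, k \in [:: i; next s i] & k \in [:: j; next s j]].
Proof.
have [na nb nc] := next3.
have ab p' : segment (v a) (v b) p' -> exists2 t, p' = (1 - t) *: v a + t *: v b + 0 *: v c & (1 - t) + t + 0 = 1.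
  by case=> t _ ->; exists t; [rewrite scale0r addr0|ring].
have bc p' : segment (v b) (v c) p' -> exists2 t, p' = 0 *: v a + (1 - t) *: v b + t *: v c & 0 + (1 - t) + t = 1.
  by case=> t _ ->; exists t; [rewrite scale0r add0r|ring].
have ca p' : segment (v c) (v a) p' -> exists2 t, p' = t *: v a + 0 *: v b + (1 - t) *: v c & t + 0 + (1 - t) = 1.
  by case=> t _ ->; exists t; [rewrite scale0r addr0 addrC|ring].
have ha : p = 1 *: v a + 0 *: v b + 0 *: v c -> p = v a.
  by rewrite scale1r !scale0r !addr0.
have hb : p = 0 *: v a + 1 *: v b + 0 *: v c -> p = v b.
  by rewrite scale1r !scale0r addr0 add0r.
have hc : p = 0 *: v a + 0 *: v b + 1 *: v c -> p = v c.
  by rewrite scale1r !scale0r !add0r.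
have meet_ab_bc : segment (v a) (v b) p -> segment (v b) (v c) p -> p = v b.
  move=> /ab[t pt t1] /bc[t' pt' t1'].
  have [_ _ e3 _] := bary_comb nd t1 pt; have [e1 e2 e3' _] := bary_comb nd t1' pt'.
  by apply: hb; rewrite pt' -e3' e3 subr0.
have meet_bc_ca : segment (v b) (v c) p -> segment (v c) (v a) p -> p = v c.
  move=> /bc[t pt t1] /ca[t' pt' t1'].
  have [e1 _ _ _] := bary_comb nd t1 pt; have [e1' _ _ _] := bary_comb nd t1' pt'.
  by apply: hc; rewrite pt' -e1' e1 subr0.
have meet_ca_ab : segment (v c) (v a) p -> segment (v a) (v b) p -> p = v a.
  move=> /ca[t pt t1] /ab[t' pt' t1'].
  have [_ e2 _ _] := bary_comb nd t1 pt; have [_ e2' _ _] := bary_comb nd t1' pt'.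
  by apply: ha; rewrite pt' -e2' e2 subr0.
rewrite !inE => /or3P[] /eqP -> /or3P[] /eqP ->; rewrite ?eqxx// => _; rewrite ?na ?nb ?nc => h h'.
- by exists b; rewrite !inE !eqxx ?orbT; split => //; exact: meet_ab_bc.
- by exists a; rewrite !inE !eqxx ?orbT; split => //; exact: meet_ca_ab.
- by exists b; rewrite !inE !eqxx ?orbT; split => //; exact: meet_ab_bc.
- by exists c; rewrite !inE !eqxx ?orbT; split => //; exact: meet_bc_ca.
- by exists a; rewrite !inE !eqxx ?orbT; split => //; exact: meet_ca_ab.
- by exists c; rewrite !inE !eqxx ?orbT; split => //; exact: meet_bc_ca.
Qed.

Lemma triangle_corner i : i \in s ->
  ~ segment (v (prev s i)) (v (next s i)) (v i).
Proof.
have [na nb nc] := next3; have [pa pb pc] := prev3.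
have ha : v a = 1 *: v a + 0 *: v b + 0 *: v c by rewrite scale1r !scale0r !addr0.
have hb : v b = 0 *: v a + 1 *: v b + 0 *: v c by rewrite scale1r !scale0r addr0 add0r.
have hc : v c = 0 *: v a + 0 *: v b + 1 *: v c by rewrite scale1r !scale0r !add0r.
have one : [/\ 1 + 0 + 0 = 1 :> R, 0 + 1 + 0 = 1 :> R & 0 + 0 + 1 = 1 :> R] by split; ring.
case: one => oa ob oc.
have [ea _ _ _] := bary_comb nd oa ha.
have [_ eb _ _] := bary_comb nd ob hb.
have [_ _ ec _] := bary_comb nd oc hc.
have absurd : (1 : R) = 0 -> False by move/eqP; rewrite oner_eq0.
rewrite !inE => /or3P[] /eqP ->; rewrite ?na ?nb ?nc ?pa ?pb ?pc => -[t _ E].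
- have E' : v a = 0 *: v a + t *: v b + (1 - t) *: v c by rewrite {1}E scale0r add0r addrC.
  have [|e _ _ _] := bary_comb nd _ E'; first by ring.
  by apply: absurd; rewrite -ea e.
- have E' : v b = (1 - t) *: v a + 0 *: v b + t *: v c by rewrite {1}E scale0r addr0.
  have [|_ e _ _] := bary_comb nd _ E'; first by ring.
  by apply: absurd; rewrite -eb e.
- have E' : v c = t *: v a + (1 - t) *: v b + 0 *: v c by rewrite {1}E scale0r addr0 addrC.
  have [|_ _ e _] := bary_comb nd _ E'; first by ring.
  by apply: absurd; rewrite -ec e.
Qed.

End TriangularFacet.

Section Separation.
Context {R : realType} {V : eqType}.
Variables (v : V -> pt3 R) (a b c a' b' c' : V).
Hypothesis abc : uniq [:: a; b; c].
Hypothesis abc' : uniq [:: a'; b'; c'].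
Local Notation s := [:: a; b; c].
Local Notation s' := [:: a'; b'; c'].

(** At a common point [l] is both nonnegative and nonpositive, hence zero, so only vertices shared
    with the other triangle carry weight. One such vertex gives the first alternative, two give a
    common edge, and three are excluded. *)
Lemma triangle_meet (l : pt3 R -> R) p : affine l ->
  ~~ all (mem s') s ->
  (forall i, i \in s -> 0 <= l (v i)) ->
  (forall i, i \in s -> i \notin s' -> 0 < l (v i)) ->
  (forall i, i \in s' -> l (v i) <= 0) ->
  triangle (v a) (v b) (v c) p -> triangle (v a') (v b') (v c') p ->
  (exists i, [/\ i \in s, i \in s' & p = v i]) \/
  (exists i j, [/\ edge_of s i j, edge_of s' i j & segment (v i) (v j) p]).
Proof.
move=> [n [d lE]] sub l0 lpos lneg [x [y [z [x0 y0 z0 xyz pE]]]] [x' [y' [z' [x'0 y'0 z'0 xyz' pE']]]].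
have comb u1 u2 u3 w1 w2 w3 : u1 + u2 + u3 = 1 ->
    l (u1 *: w1 + u2 *: w2 + u3 *: w3) = u1 * l w1 + u2 * l w2 + u3 * l w3.
  by move=> u; rewrite !lE !innerD !innerZ -[d in LHS]mul1r -u; ring.
have [ma mb mc] : [/\ a \in s, b \in s & c \in s] by rewrite !inE !eqxx ?orbT.
have [ma' mb' mc'] : [/\ a' \in s', b' \in s' & c' \in s'] by rewrite !inE !eqxx ?orbT.
have lp : x * l (v a) + y * l (v b) + z * l (v c) <= 0.
  rewrite -comb// -pE pE' comb//.
  have := lneg _ ma'; have := lneg _ mb'; have := lneg _ mc'.
  by clear comb l0 lpos lneg sub; nra.
have la := l0 _ ma; have lb := l0 _ mb; have lc := l0 _ mc.
have [xa yb zc] : [/\ x * l (v a) = 0, y * l (v b) = 0 & z * l (v c) = 0].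
  have h1 := mulr_ge0 x0 la; have h2 := mulr_ge0 y0 lb; have h3 := mulr_ge0 z0 lc.
  by clear comb l0 lpos lneg sub; split; lra.
have ra : a \notin s' -> x = 0.
  by move=> h; move/eqP: xa; rewrite mulf_eq0 (gt_eqF (lpos _ ma h)) orbF => /eqP.
have rb : b \notin s' -> y = 0.
  by move=> h; move/eqP: yb; rewrite mulf_eq0 (gt_eqF (lpos _ mb h)) orbF => /eqP.
have rc : c \notin s' -> z = 0.
  by move=> h; move/eqP: zc; rewrite mulf_eq0 (gt_eqF (lpos _ mc h)) orbF => /eqP.
have [ab ac bc] : [/\ a != b, a != c & b != c].
  by move: abc => /=; rewrite !inE negb_or andbT => /andP[/andP[-> ->] ->].
have edge i j : i \in s -> j \in s -> i != j -> i \in s' -> j \in s' ->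
    edge_of s i j /\ edge_of s' i j.
  by move=> *; split; exact: edge_of3.
clear l0 lpos lneg comb lE lp la lb lc xa yb zc.
have [a's|/ra xE] := boolP (a \in s'); have [b's|/rb yE] := boolP (b \in s');
  have [c's|/rc zE] := boolP (c \in s').
- by move: sub; rewrite /= a's b's c's.
- right; exists a, b; have [//|e e'] := edge a b ma mb _ a's b's; split => //.
  exists y; first by clear ra rb rc edge; lra.
  by rewrite pE zE scale0r addr0 (_ : x = 1 - y)//; clear ra rb rc edge; lra.
- right; exists a, c; have [//|e e'] := edge a c ma mc _ a's c's; split => //.
  exists z; first by clear ra rb rc edge; lra.
  by rewrite pE yE scale0r addr0 (_ : x = 1 - z)//; clear ra rb rc edge; lra.
- left; exists a; split => //.
  by rewrite pE yE zE !scale0r !addr0 (_ : x = 1) ?scale1r//; clear ra rb rc edge; lra.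
- right; exists b, c; have [//|e e'] := edge b c mb mc _ b's c's; split => //.
  exists z; first by clear ra rb rc edge; lra.
  by rewrite pE xE scale0r add0r (_ : y = 1 - z)//; clear ra rb rc edge; lra.
- left; exists b; split => //.
  by rewrite pE xE zE !scale0r addr0 add0r (_ : y = 1) ?scale1r//; clear ra rb rc edge; lra.
- left; exists c; split => //.
  by rewrite pE xE yE !scale0r !add0r (_ : z = 1) ?scale1r//; clear ra rb rc edge; lra.
- by move: xyz; rewrite xE yE zE !addr0 => /esym/eqP; rewrite oner_eq0.
Qed.

End Separation.

(** * The fan of three tetrahedra *)

Section Combinatorics.

Let o0 : 'I_6 := @Ordinal 6 0 isT.
Let o1 : 'I_6 := @Ordinal 6 1 isT.
Let o2 : 'I_6 := @Ordinal 6 2 isT.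
Let o3 : 'I_6 := @Ordinal 6 3 isT.
Let o4 : 'I_6 := @Ordinal 6 4 isT.
Let o5 : 'I_6 := @Ordinal 6 5 isT.

(* Three tetrahedra ABCD, BCDE, BCEV around the common edge BC; the vertices
   A, B, C, D, E, V are numbered 0 to 5. *)
Definition facets : seq ('I_6 * 'I_6 * 'I_6) :=
  [:: (o0, o1, o2); (o0, o1, o3); (o0, o2, o3); (o1, o3, o4);
      (o2, o3, o4); (o1, o4, o5); (o2, o4, o5); (o1, o2, o5)].

Definition facet (F : 'I_8) := nth (o0, o1, o2) facets F.

Definition facet_cycle (F : 'I_8) : seq 'I_6 :=
  [:: (facet F).1.1; (facet F).1.2; (facet F).2].

Lemma facet_cycle_uniq F : uniq (facet_cycle F).
Proof. by case: F => -[|[|[|[|[|[|[|[|//]]]]]]]] i. Qed.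

Lemma facet_not_sub F G : F != G -> ~~ all (mem (facet_cycle G)) (facet_cycle F).
Proof.
case: F => -[|[|[|[|[|[|[|[|//]]]]]]]] iF;
  by case: G => -[|[|[|[|[|[|[|[|//]]]]]]]] iG.
Qed.

Lemma facet_edge_two F i j : edge_of (facet_cycle F) i j ->
  #|[pred G | edge_of (facet_cycle G) i j]| = 2%N.
Proof.
rewrite -sum1_card big_mkcond /= !big_ord_recl big_ord0.
case: i => -[|[|[|[|[|[|//]]]]]] ii; case: j => -[|[|[|[|[|[|//]]]]]] ij;
  try (by vm_compute);
  by case: F => -[|[|[|[|[|[|[|[|//]]]]]]]] iF; vm_compute.
Qed.

Definition facet_adjacent (i : 'I_6) : rel 'I_8 :=
  [rel A B | [exists j, edge_of (facet_cycle A) i j && edge_of (facet_cycle B) i j]].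

Let f k (k8 : (k < 8)%N) : 'I_8 := Ordinal k8.

(* the facets around each vertex, in cyclic order *)
Definition fan (i : 'I_6) : seq 'I_8 :=
  nth [::] [:: [:: @f 0 isT; @f 1 isT; @f 2 isT];
               [:: @f 0 isT; @f 1 isT; @f 3 isT; @f 5 isT; @f 7 isT];
               [:: @f 0 isT; @f 2 isT; @f 4 isT; @f 6 isT; @f 7 isT];
               [:: @f 1 isT; @f 2 isT; @f 4 isT; @f 3 isT];
               [:: @f 3 isT; @f 4 isT; @f 6 isT; @f 5 isT];
               [:: @f 5 isT; @f 6 isT; @f 7 isT]] i.

Lemma facet_adjacent_sym i : symmetric (facet_adjacent i).
Proof.
by move=> A B; apply/existsP/existsP => -[j]; rewrite andbC; exists j.
Qed.

(** The quantifier ranges over an explicit list, in a form that [vm_compute] can evaluate. *)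
Let adjb (i : 'I_6) : rel 'I_8 := fun A B =>
  has (fun j => edge_of (facet_cycle A) i j && edge_of (facet_cycle B) i j)
    [:: o0; o1; o2; o3; o4; o5].

Lemma fan_connect i F : i \in facet_cycle F ->
  connect (facet_adjacent i) (head (@f 0 isT) (fan i)) F.
Proof.
move=> iF; apply: (@path_connect _ _ _ (behead (fan i))).
  apply: (@sub_path _ (adjb i)).
    by move=> A B /hasP[j _ ?]; apply/existsP; exists j.
  by case: i iF => -[|[|[|[|[|[|//]]]]]] ii _; vm_compute.
move: iF; case: i => -[|[|[|[|[|[|//]]]]]] ii;
  by case: F => -[|[|[|[|[|[|[|[|//]]]]]]]] iF; vm_compute.
Qed.

Lemma facet_fan i F G : i \in facet_cycle F -> i \in facet_cycle G ->
  connect (facet_adjacent i) F G.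
Proof.
move=> /fan_connect iF /fan_connect iG; apply: connect_trans iG.
by rewrite (sym_connect_sym (@facet_adjacent_sym i)).
Qed.

Lemma facet_of_vertex i : exists F, i \in facet_cycle F.
Proof.
case: i => -[|[|[|[|[|[|//]]]]]] ii.
- by exists (@f 0 isT).
- by exists (@f 0 isT).
- by exists (@f 0 isT).
- by exists (@f 1 isT).
- by exists (@f 3 isT).
- by exists (@f 5 isT).
Qed.

End Combinatorics.

Section Geometry.
Context {R : realType}.
Variables (h s : R).
Hypothesis hs : s = 4^-1 - 2 * h.
Hypothesis h0 : 0 < h.
Hypothesis h1 : 16 * h <= 1.
Implicit Types (p : pt3 R).

(* With s = 1/4 - 2 h the apex (0, 0, h) stays in the fixed planes
   4 (x + s) + 8 z +- 2 y = 1 through B, E and C, E, so that only the plane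
   of BCV depends on h in the coordinates (x + s, y, z). *)
Definition corner (i : 'I_6) : pt3 R :=
  nth (0, 0, 0) [:: (2^-1 - s, 0, 0); (- s, 2^-1, 0); (- s, - 2^-1, 0);
    (- 4^-1 - s, 0, - 4^-1); (- 4^-1 - s, 0, 4^-1); (0, 0, h)] i.

Lemma corner_inj : injective corner.
Proof.
have hs' := hs; have h0' := h0; have h1' := h1.
case=> -[|[|[|[|[|[|//]]]]]] ii; case=> -[|[|[|[|[|[|//]]]]]] ij E;
  try (by apply: ord_inj); exfalso; move: (congr1 (fun p : pt3 R => p.1.1) E)
    (congr1 (fun p : pt3 R => p.1.2) E) (congr1 snd E); rewrite /corner /=; lra.
Qed.

Definition facet_region (F : 'I_8) : set (pt3 R) :=
  triangle (corner (facet F).1.1) (corner (facet F).1.2) (corner (facet F).2).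

Lemma facet_nondegenerate (F : 'I_8) :
  cross (corner (facet F).1.2 - corner (facet F).1.1)
        (corner (facet F).2 - corner (facet F).1.1) != 0.
Proof.
have hs' := hs; have h0' := h0; have h1' := h1.
case: F => -[|[|[|[|[|[|[|[|//]]]]]]]] iF; rewrite /facet /corner /cross /=;
  apply/eqP => E; move: (congr1 (fun p : pt3 R => p.1.1) E)
    (congr1 (fun p : pt3 R => p.1.2) E) (congr1 snd E); clear E; rewrite /=; nra.
Qed.

(* The affine functionals are written in the coordinate X = x + s, for which
   the edge BC lies on the axis X = z = 0. *)
Definition fl (q : R * R * R * R) p : R :=
  q.1.1.1 * (p.1.1 + s) + q.1.1.2 * p.1.2 + q.1.2 * p.2 + q.2.

Lemma fl_affine q : affine (fl q).
Proof.
exists (q.1.1.1, q.1.1.2, q.1.2), (q.1.1.1 * s + q.2) => p.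
by rewrite /fl /inner/=; ring.
Qed.

(* fl (separator F G) is nonnegative on the facet F, positive at its vertices
   that do not lie on G, and nonpositive on G. *)
Definition separator (F G : nat) : option (R * R * R * R) :=
  match F, G with
  | 1, 0 | 2, 0 => Some (0, 0, -1, 0)
  | 3, 0 | 4, 0 => Some (-1, 0, 0, 0)
  | 5, 0 | 6, 0 | 7, 0 | 5, 1 | 6, 2 => Some (0, 0, 1, 0)
  | 1, 2 | 3, 4 | 5, 6 => Some (0, 1, 0, 0)
  | 3, 1 | 4, 2 => Some (-1, 0, 1, 0)
  | 1, 4 => Some (1, 1, -1, 0)
  | 2, 3 => Some (1, -1, -1, 0)
  | 6, 1 => Some (0, -1, 1, 0)
  | 5, 2 => Some (0, 1, 1, 0)
  | 7, 1 => Some (-2, -2, 6, 1)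
  | 7, 2 => Some (-2, 2, 6, 1)
  | 5, 3 | 6, 4 => Some (1, 0, 1, 0)
  | 6, 3 => Some (1, -1, 1, 0)
  | 5, 4 => Some (1, 1, 1, 0)
  | 7, 3 => Some (4, -2, 0, 1)
  | 7, 4 => Some (4, 2, 0, 1)
  | 7, 5 => Some (-4, -2, -8, 1)
  | 7, 6 => Some (-4, 2, -8, 1)
  | _, _ => None
  end.

Lemma separator_total (F G : 'I_8) : F != G -> separator F G \/ separator G F.
Proof.
by case: F => -[|[|[|[|[|[|[|[|//]]]]]]]] iF;
  case: G => -[|[|[|[|[|[|[|[|//]]]]]]]] iG // _; auto.
Qed.

Lemma separatorP (F G : 'I_8) q : separator F G = Some q ->
  [/\ forall i, i \in facet_cycle F -> 0 <= fl q (corner i),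
      forall i, i \in facet_cycle F -> i \notin facet_cycle G -> 0 < fl q (corner i)
    & forall i, i \in facet_cycle G -> fl q (corner i) <= 0].
Proof.
move=> FG; suff [pos neg] : all (fun i => (0 <= fl q (corner i)) &&
      ((i \in facet_cycle G) || (0 < fl q (corner i)))) (facet_cycle F) /\
    all (fun i => fl q (corner i) <= 0) (facet_cycle G).
  split; [move=> i /(allP pos)/andP[]//| |exact/allP].
  by move=> i /(allP pos)/andP[_ /orP[->|]].
have hs' := hs; have h0' := h0; have h1' := h1.
move: FG; case: F => -[|[|[|[|[|[|[|[|//]]]]]]]] iF;
  case: G => -[|[|[|[|[|[|[|[|//]]]]]]]] iG // [<-];
  rewrite /= /fl /corner /= ?andbT; split; do ?[apply/andP; split];
  try (apply/orP; first [by left; vm_compute|right]).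
all: lra.
Qed.

End Geometry.

(* Two facets with a common edge span one of these tetrahedra. *)
Definition tetrahedra : seq (seq nat) :=
  [:: [:: 0; 1; 2; 3]; [:: 0; 1; 3; 4]; [:: 0; 2; 3; 4]; [:: 1; 2; 3; 4];
      [:: 0; 1; 2; 5]; [:: 1; 3; 4; 5]; [:: 2; 3; 4; 5]; [:: 1; 2; 4; 5]]%N.

Lemma adjacent_facets_tetrahedron F G i j : F != G ->
  edge_of (facet_cycle F) i j -> edge_of (facet_cycle G) i j ->
  has (all (mem [seq val k | k <- facet_cycle F ++ facet_cycle G])) tetrahedra.
Proof.
case: F => -[|[|[|[|[|[|[|[|//]]]]]]]] iF; case: G => -[|[|[|[|[|[|[|[|//]]]]]]]] iG //;
  try (by vm_compute);
  by case: i => -[|[|[|[|[|[|//]]]]]] ii; case: j => -[|[|[|[|[|[|//]]]]]] ij; vm_compute.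
Qed.

Section Crease.
Context {R : realType}.

(** The relevant determinant is proportional to h for ABCV, to 1/4 + s for BDEV and CDEV, and to s +
    h for BCEV; the others do not involve V. Only the first degenerates as h tends to 0, and ABCV is
    the wedge outside the solid. *)
Lemma tetrahedra_noncoplanar (h s : R) (S : seq nat) (n : pt3 R) (d : R) :
  s = 4^-1 - 2 * h -> 0 < h -> 16 * h <= 1 ->
  S \in tetrahedra ->
  (forall k : 'I_6, val k \in S -> plane n d (corner h s k)) -> n = 0.
Proof.
move=> hs h0 h1; case: n => -[n1 n2] n3.
pose o (k : nat) (k6 : (k < 6)%N) : 'I_6 := Ordinal k6.
have h0' : h != 0 by rewrite gt_eqF.
suff E : S \in tetrahedra -> (forall k : 'I_6, val k \in S -> plane (n1, n2, n3) d (corner h s k)) ->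
    [/\ n1 = 0, n2 = 0 & n3 = 0].
  by move=> S4 H; have [-> -> ->] := E S4 H.
rewrite !inE => /or4P[/eqP->|/eqP->|/eqP->|/or4P[/eqP->|/eqP->|/eqP->|/orP[] /eqP->]] H.
- have := H (@o 0 isT) isT; have := H (@o 1 isT) isT; have := H (@o 2 isT) isT;
  have := H (@o 3 isT) isT; rewrite /plane/inner/corner/= => *; split; lra.
- have := H (@o 0 isT) isT; have := H (@o 1 isT) isT; have := H (@o 3 isT) isT;
  have := H (@o 4 isT) isT; rewrite /plane/inner/corner/= => *; split; lra.
- have := H (@o 0 isT) isT; have := H (@o 2 isT) isT; have := H (@o 3 isT) isT;
  have := H (@o 4 isT) isT; rewrite /plane/inner/corner/= => *; split; lra.
- have := H (@o 1 isT) isT; have := H (@o 2 isT) isT; have := H (@o 3 isT) isT;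
  have := H (@o 4 isT) isT; rewrite /plane/inner/corner/= => *; split; lra.
- have := H (@o 0 isT) isT; have := H (@o 1 isT) isT; have := H (@o 2 isT) isT;
  have := H (@o 5 isT) isT; rewrite /plane/inner/corner/= => e1 e2 e3 e4.
  have E2 : n2 = 0 by lra.
  have E1 : n1 = 0 by lra.
  rewrite E1 E2 in e1 e2 *; split => //.
  have /eqP : n3 * h = 0 by lra.
  by rewrite mulf_eq0 (negbTE h0') orbF => /eqP.
- have := H (@o 1 isT) isT; have := H (@o 3 isT) isT; have := H (@o 4 isT) isT;
  have := H (@o 5 isT) isT; rewrite /plane/inner/corner/= => e1 e2 e3 e4.
  have E3 : n3 = 0 by lra.
  rewrite E3 in e1 e2 e3 e4 *.
  have /eqP : n1 * (4^-1 + s) = 0 by lra.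
  have s0 : 4^-1 + s != 0 by rewrite gt_eqF//; lra.
  rewrite mulf_eq0 (negbTE s0) orbF => /eqP E1; rewrite E1 in e1 e2 e3 e4 *.
  by split => //; lra.
- have := H (@o 2 isT) isT; have := H (@o 3 isT) isT; have := H (@o 4 isT) isT;
  have := H (@o 5 isT) isT; rewrite /plane/inner/corner/= => e1 e2 e3 e4.
  have E3 : n3 = 0 by lra.
  rewrite E3 in e1 e2 e3 e4 *.
  have /eqP : n1 * (4^-1 + s) = 0 by lra.
  have s0 : 4^-1 + s != 0 by rewrite gt_eqF//; lra.
  rewrite mulf_eq0 (negbTE s0) orbF => /eqP E1; rewrite E1 in e1 e2 e3 e4 *.
  by split => //; lra.
- have := H (@o 1 isT) isT; have := H (@o 2 isT) isT; have := H (@o 4 isT) isT;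
  have := H (@o 5 isT) isT; rewrite /plane/inner/corner/= => e1 e2 e3 e4.
  have E2 : n2 = 0 by lra.
  have E3 : n3 = n1 by lra.
  rewrite E2 E3 in e1 e2 e3 e4 *.
  have /eqP : n1 * (h + s) = 0 by lra.
  have s0 : h + s != 0 by rewrite gt_eqF//; lra.
  by rewrite mulf_eq0 (negbTE s0) orbF => /eqP ->.
Qed.

End Crease.

(** * The solid *)

Section SolidInequalities.
Variables (R : realType) (h s : R).
Implicit Types (x y z : R).

(* x is the first coordinate relative to the edge BC *)
Definition in_lower x y z := [/\ z <= 0, 2 * y + 2 * x - 6 * z <= 1,
  - 2 * y + 2 * x - 6 * z <= 1, 2 * y - 4 * x <= 1 & - 2 * y - 4 * x <= 1].

Definition in_upper x y z := [/\ 0 <= z, h * x <= s * z,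
  [/\ 2 * y - 4 * x <= 1 & - 2 * y - 4 * x <= 1]
  & [/\ 2 * y + 4 * x + 8 * z <= 1 & - 2 * y + 4 * x + 8 * z <= 1]].

Definition in_open_lower x y z := [/\ z < 0, 2 * y + 2 * x - 6 * z < 1,
  - 2 * y + 2 * x - 6 * z < 1, 2 * y - 4 * x < 1 & - 2 * y - 4 * x < 1].

Definition in_open_upper x y z := [/\ 0 < z, h * x < s * z,
  [/\ 2 * y - 4 * x < 1 & - 2 * y - 4 * x < 1]
  & [/\ 2 * y + 4 * x + 8 * z < 1 & - 2 * y + 4 * x + 8 * z < 1]].

Definition in_open_middle x y z := [/\ x < 0,
  [/\ 2 * y + 2 * x - 6 * z < 1 & - 2 * y + 2 * x - 6 * z < 1],
  [/\ 2 * y - 4 * x < 1 & - 2 * y - 4 * x < 1]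
  & [/\ 2 * y + 4 * x + 8 * z < 1 & - 2 * y + 4 * x + 8 * z < 1]].

Definition in_solid x y z := in_lower x y z \/ in_upper x y z.

Definition in_interior x y z :=
  [\/ in_open_lower x y z, in_open_middle x y z | in_open_upper x y z].

(** The numbering is that of [facets]; each facet is cut out of its plane by three half-spaces.
    Every index above 6 means BCV. *)
Definition facet_cond (F : nat) x y z : Prop :=
  match F with
  | 0 => [/\ z = 0, 0 <= x, 2 * y + 2 * x <= 1 & - 2 * y + 2 * x <= 1]
  | 1 => [/\ 2 * y + 2 * x - 6 * z = 1, 0 <= y, z <= 0 & z <= x]
  | 2 => [/\ - 2 * y + 2 * x - 6 * z = 1, y <= 0, z <= 0 & z <= x]
  | 3 => [/\ 2 * y - 4 * x = 1, 0 <= y, x <= z & x <= - z]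
  | 4 => [/\ - 2 * y - 4 * x = 1, y <= 0, x <= z & x <= - z]
  | 5 => [/\ 2 * y + 4 * x + 8 * z = 1, 0 <= y, h * x <= s * z & 0 <= x + z]
  | 6 => [/\ - 2 * y + 4 * x + 8 * z = 1, y <= 0, h * x <= s * z & 0 <= x + z]
  | _ => [/\ s * z = h * x, 0 <= x, 2 * y + 4 * x + 8 * z <= 1
          & - 2 * y + 4 * x + 8 * z <= 1]
  end.

Hypothesis h0 : 0 < h.
Hypothesis s0 : 0 < s.

Lemma in_interior_solid x y z : in_interior x y z -> in_solid x y z.
Proof.
case=> [[*]|[x0 [a1 a2] [a3 a4] [a5 a6]]|[*]].
- by left; split; exact: ltW.
- have [z0|z0] := leP z 0; first by left; split => //; exact: ltW.
  right; split; [exact: ltW| |by split; exact: ltW|by split; exact: ltW].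
  by apply: (@le_trans _ _ 0); [rewrite pmulr_rle0// ltW|rewrite pmulr_rge0// ltW].
- by right; split; [exact: ltW|exact: ltW| |]; split; apply: ltW; tauto.
Qed.

(** A tight outer inequality puts the point on an outer facet. Otherwise z = 0 and h x = s z count
    as boundary only for x >= 0, because the open middle part covers the passage from lower to upper
    at x < 0. *)
Lemma in_frontier_facet x y z : in_solid x y z -> ~ in_interior x y z ->
  exists2 F, (F < 8)%N & facet_cond F x y z.
Proof.
case=> [[c1 c2 c3 c4 c5]|[c1 c2 [c3 c4] [c5 c6]]] np.
- have [d2|d2] := ltP (2 * y + 2 * x - 6 * z) 1; last first.
    by exists 1%N => //; split; clear np; lra.
  have [d3|d3] := ltP (- 2 * y + 2 * x - 6 * z) 1; last first.
    by exists 2%N => //; split; clear np; lra.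
  have [d4|d4] := ltP (2 * y - 4 * x) 1; last first.
    by exists 3%N => //; split; clear np; lra.
  have [d5|d5] := ltP (- 2 * y - 4 * x) 1; last first.
    by exists 4%N => //; split; clear np; lra.
  have [z0|z0] := ltP z 0; first by exfalso; apply: np; constructor 1.
  have [x0|x0] := ltP x 0.
    exfalso; apply: np; constructor 2; split => //; split; lra.
  by exists 0%N => //; split; clear np; lra.
- have [d3|d3] := ltP (2 * y - 4 * x) 1; last first.
    by exists 3%N => //; split; clear np; lra.
  have [d4|d4] := ltP (- 2 * y - 4 * x) 1; last first.
    by exists 4%N => //; split; clear np; lra.
  have [d5|d5] := ltP (2 * y + 4 * x + 8 * z) 1; last first.
    by exists 5%N => //; split => //; clear np; lra.
  have [d6|d6] := ltP (- 2 * y + 4 * x + 8 * z) 1; last first.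
    by exists 6%N => //; split => //; clear np; lra.
  have [x0|x0] := ltP x 0.
    exfalso; apply: np; have [z0|z0] := ltP 0 z.
      constructor 3; split => //; apply: (@lt_trans _ _ 0).
        by rewrite pmulr_rlt0.
      by rewrite pmulr_rgt0.
    by constructor 2; split => //; split; lra.
  have [d2|d2] := ltP (h * x) (s * z).
    exfalso; apply: np; constructor 3; split => //.
    by rewrite -(pmulr_rgt0 _ s0); apply: le_lt_trans d2; rewrite pmulr_rge0.
  by exists 7%N => //; split => //; apply/eqP; rewrite eq_le c2 d2.
Qed.

(** In the plane of x and z the two half-planes meet in a cone that lies above the x-axis and
    touches it only at its apex, the edge BC. *)
Lemma wedge_ge0 x z : h * x <= s * z -> 0 <= x + z ->
  0 <= z /\ (z = 0 -> x = 0).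
Proof.
move=> c1 c2; have [zn|zp] := ltP z 0.
  have x0 : 0 < x by lra.
  have e1 : 0 < h * x by rewrite mulr_gt0.
  have e2 : s * z < 0 by rewrite pmulr_rlt0.
  by have := lt_le_trans e1 (le_trans c1 (ltW e2)); rewrite ltxx.
split => // z0; move: c1; rewrite z0 mulr0 (pmulr_rle0 _ h0) => ?; lra.
Qed.

Lemma facet_cond_solid F x y z : facet_cond F x y z ->
  in_solid x y z /\ ~ in_interior x y z.
Proof.
have up5 : h * x <= s * z -> 0 <= x + z -> 2 * y + 4 * x + 8 * z <= 1 ->
   - 2 * y + 4 * x + 8 * z <= 1 -> in_upper x y z.
  move=> c1 c2 c3 c4; have [z0 _] := wedge_ge0 c1 c2.
  by split => //; split; lra.
have up3 : 0 < z -> x <= - z -> 2 * y - 4 * x <= 1 -> - 2 * y - 4 * x <= 1 ->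
    2 * y + 4 * x + 8 * z <= 1 -> - 2 * y + 4 * x + 8 * z <= 1 -> in_upper x y z.
  move=> z0 xz *; split => //; first exact: ltW.
  apply: (@le_trans _ _ 0); last by rewrite pmulr_rge0// ltW.
  by rewrite pmulr_rle0//; lra.
case: F => [|[|[|[|[|[|[|F]]]]]]] [] c1 c2 c3 c4.
- split; first by left; clear up3 up5; split; lra.
  by clear up3 up5; case=> [[]|[]|[]]; lra.
- split; first by left; clear up3 up5; split; lra.
  by clear up3 up5; case=> [[]|[_ []]|[]]; lra.
- split; first by left; clear up3 up5; split; lra.
  by clear up3 up5; case=> [[]|[_ []]|[]]; lra.
- split; last by clear up3 up5; case=> [[]|[_ _ []]|[_ _ []]]; lra.
  by have [z0|z0] := leP z 0; [left; clear up3 up5; split; lra|right; apply: up3; clear up5; lra].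
- split; last by clear up3 up5; case=> [[]|[_ _ []]|[_ _ []]]; lra.
  by have [z0|z0] := leP z 0; [left; clear up3 up5; split; lra|right; apply: up3; clear up5; lra].
- have [z0 _] := wedge_ge0 c3 c4.
  split; last by clear up3 up5; case=> [[]|[_ _ _ []]|[_ _ _ []]]; lra.
  by right; apply: up5 => //; clear up3; lra.
- have [z0 _] := wedge_ge0 c3 c4.
  split; last by clear up3 up5; case=> [[]|[_ _ _ []]|[_ _ _ []]]; lra.
  by right; apply: up5 => //; clear up3; lra.
- have z0 : 0 <= z by rewrite -(pmulr_rge0 _ s0) c1 pmulr_rge0.
  split; last by clear up3 up5; case=> [[]|[]|[]]; lra.
  by right; apply: up5 => //; [rewrite c1|clear up3; lra].
Qed.

(* Points of the outer facets leave the solid radially, from the midpoint of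
   the edge BC. *)
Lemma radial_escape F x y z t : (0 < F < 7)%N -> facet_cond F x y z -> 0 < t ->
  ~ in_solid ((1 + t) * x) ((1 + t) * y) ((1 + t) * z).
Proof.
case: F => [//|[|[|[|[|[|[|//]]]]]]] _ [] c1 c2 c3 c4 t0.
- have e : t * (2 * y + 2 * x - 6 * z) = t by rewrite c1 mulr1.
  have tz : t * z <= 0 by rewrite pmulr_rle0.
  have tx : t * z <= t * x by rewrite ler_pM2l.
  by case=> [[]|[? _ _ []]]; lra.
- have e : t * (- 2 * y + 2 * x - 6 * z) = t by rewrite c1 mulr1.
  have tz : t * z <= 0 by rewrite pmulr_rle0.
  have tx : t * z <= t * x by rewrite ler_pM2l.
  by case=> [[]|[? _ _ []]]; lra.
- have e : t * (2 * y - 4 * x) = t by rewrite c1 mulr1.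
  by case=> [[]|[_ _ []]]; lra.
- have e : t * (- 2 * y - 4 * x) = t by rewrite c1 mulr1.
  by case=> [[]|[_ _ []]]; lra.
- have [z0 zx] := wedge_ge0 c3 c4.
  have e : t * (2 * y + 4 * x + 8 * z) = t by rewrite c1 mulr1.
  have tz : 0 <= t * z by rewrite pmulr_rge0.
  case=> [[z'0 c _ _ _]|[_ _ _ []]]; last by lra.
  have zE : z = 0 by lra.
  by rewrite (zx zE) zE in e c; lra.
- have [z0 zx] := wedge_ge0 c3 c4.
  have e : t * (- 2 * y + 4 * x + 8 * z) = t by rewrite c1 mulr1.
  have tz : 0 <= t * z by rewrite pmulr_rge0.
  case=> [[z'0 _ c _ _]|[_ _ _ []]]; last by lra.
  have zE : z = 0 by lra.
  by rewrite (zx zE) zE in e c; lra.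
Qed.

(* Points of the facets ABC and BCV are pushed into the wedge between them. *)
Lemma wedge_escape F x y z t : (F == 0) || (6 < F)%N -> facet_cond F x y z -> 0 < t ->
  ~ in_solid (x + 2 * s * t) y (z + h * t).
Proof.
(* The direction (2 s, 0, h) has slope h / (2 s), strictly between 0 and the slope h / s of BCV, and
   so points into the wedge from either facet. *)
move=> F0 Fc t0; have ht : 0 < h * t by rewrite mulr_gt0.
have sht : 0 < s * (h * t) by rewrite mulr_gt0.
have [z0 below x0] : [/\ 0 <= z, s * z <= h * x & 0 <= x].
  move: F0 Fc; case: F => [|[|[|[|[|[|[|F]]]]]]] // _ [] c1 c2 _ _.
    by rewrite c1 mulr0; split => //; rewrite pmulr_rge0.
  by rewrite c1; split => //; rewrite -(pmulr_rge0 _ s0) c1 pmulr_rge0.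
by case=> [[]|[]]; lra.
Qed.

End SolidInequalities.

Section Body.
Context {R : realType}.
Variables (h s : R).
Implicit Types (p : pt3 R) (q : R * R * R * R).
Local Notation X p := (p.1.1 + s).

Definition polytope (Q : seq (R * R * R * R)) : set (pt3 R) :=
  [set p | forall q, q \in Q -> 0 <= fl s q p].

Definition open_polytope (Q : seq (R * R * R * R)) : set (pt3 R) :=
  [set p | forall q, q \in Q -> 0 < fl s q p].

Lemma fl_continuous q : continuous (fl s q : pt3 R -> R).
Proof.
have [n [d E]] := @fl_affine R s q.
rewrite (_ : fl s q = fun p => inner n p + d); last exact/funext/E.
by move=> p; apply: cvgD; [exact: inner_continuous|exact: cvg_cst].
Qed.

Lemma fl_comb q (t : R) p p' :
  fl s q ((1 - t) *: p + t *: p') = (1 - t) * fl s q p + t * fl s q p'.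
Proof. by rewrite /fl !coordE; ring. Qed.

Lemma polytope_closed Q : closed (polytope Q).
Proof.
rewrite (_ : polytope Q = \bigcap_(q in [set` Q]) [set p | 0 <= fl s q p]).
  apply: closed_bigI => q _.
  apply: (@closed_comp _ _ (fl s q) [set r | 0 <= r]); last exact: closed_ge.
  by move=> p _; exact: fl_continuous.
by apply/seteqP; split => p H q /H.
Qed.

Lemma open_polytope_open Q : open (open_polytope Q).
Proof.
elim: Q => [|q Q IH].
  rewrite (_ : open_polytope _ = setT); first exact: openT.
  by apply/seteqP; split.
rewrite (_ : open_polytope _ = [set p | 0 < fl s q p] `&` open_polytope Q).
  apply: openI => //; apply: (@open_comp _ _ (fl s q) [set r | 0 < r]).
    by move=> p _; exact: fl_continuous.
  exact: open_gt.
apply/seteqP; split => [p H|p [qp H] q']; last by rewrite inE => /predU1P[->|/H].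
by split; [exact: H (mem_head _ _)|move=> q' q'Q; apply: H; rewrite inE q'Q orbT].
Qed.

Lemma polytope_closure Q c : open_polytope Q c ->
  polytope Q `<=` closure (open_polytope Q).
Proof.
move=> Qc p Qp B nB.
have cl : (fun k : nat => (1 - k.+1%:R^-1) *: p + k.+1%:R^-1 *: c) @ \oo --> p.
  suff : (fun k : nat => (1 - k.+1%:R^-1) *: p + k.+1%:R^-1 *: c) @ \oo -->
      (1 - 0) *: p + (0 : R) *: c by rewrite subr0 scale1r scale0r addr0.
  have h0 : (fun k : nat => k.+1%:R^-1) @ \oo --> (0 : R) by exact: cvg_harmonic.
  apply: cvgD; apply: cvgZr_tmp => //.
  by apply: cvgB => //; exact: cvg_cst.
have [k _ /(_ k (leqnn k)) Bk] := cl _ nB.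
exists ((1 - k.+1%:R^-1) *: p + k.+1%:R^-1 *: c); split => // q qQ.
rewrite fl_comb; apply: ltr_wpDl.
  by rewrite mulr_ge0 ?Qp// subr_ge0 invf_le1// ler1n.
by rewrite mulr_gt0 ?Qc// invr_gt0.
Qed.

Definition lower : seq (R * R * R * R) :=
  [:: (0, 0, -1, 0); (-2, -2, 6, 1); (-2, 2, 6, 1); (4, -2, 0, 1); (4, 2, 0, 1)].

Definition upper : seq (R * R * R * R) :=
  [:: (0, 0, 1, 0); (- h, 0, s, 0); (4, -2, 0, 1); (4, 2, 0, 1);
      (-4, -2, -8, 1); (-4, 2, -8, 1)].

(* the open part that joins the lower and the upper one across z = 0 *)
Definition middle : seq (R * R * R * R) :=
  [:: (-1, 0, 0, 0); (-2, -2, 6, 1); (-2, 2, 6, 1); (4, -2, 0, 1); (4, 2, 0, 1);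
      (-4, -2, -8, 1); (-4, 2, -8, 1)].

Definition solid := polytope lower `|` polytope upper.

Definition solid_interior :=
  open_polytope lower `|` open_polytope middle `|` open_polytope upper.

Lemma in_polytope Q p : polytope Q p <-> all (fun q => 0 <= fl s q p) Q.
Proof. by split => [H|/allP]; [exact/allP|apply]. Qed.

Lemma in_open_polytope Q p : open_polytope Q p <-> all (fun q => 0 < fl s q p) Q.
Proof. by split => [H|/allP]; [exact/allP|apply]. Qed.

Lemma solidE p : solid p <-> in_solid h s (X p) p.1.2 p.2.
Proof.
suff [E1 E2] : (polytope lower p <-> in_lower (X p) p.1.2 p.2) /\
    (polytope upper p <-> in_upper h s (X p) p.1.2 p.2).
  by split=> -[/E1|/E2] ?; [left|right|left|right].
rewrite !in_polytope /= /fl /= !andbT; split; split.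
- by case/and5P => *; split; lra.
- by case=> *; apply/and5P; split; lra.
- by case/and5P => ? ? ? ? /andP[? ?]; split; [lra|lra|split; lra|split; lra].
- by case=> ? ? [? ?] [? ?]; apply/and5P; split; [lra|lra|lra|lra|apply/andP; split; lra].
Qed.

Lemma solid_interiorE p : solid_interior p <-> in_interior h s (X p) p.1.2 p.2.
Proof.
have E1 : open_polytope lower p <-> in_open_lower (X p) p.1.2 p.2.
  rewrite in_open_polytope /= /fl /= andbT; split.
    by case/and5P => *; split; lra.
  by case=> *; apply/and5P; split; lra.
have E2 : open_polytope middle p <-> in_open_middle (X p) p.1.2 p.2.
  rewrite in_open_polytope /= /fl /= andbT; split.
    by case/and5P => ? ? ? ? /and3P[? ? ?]; split; [lra|split; lra|split; lra|split; lra].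
  by case=> ? [? ?] [? ?] [? ?]; apply/and5P; split; [lra|lra|lra|lra|apply/and3P; split; lra].
have E3 : open_polytope upper p <-> in_open_upper h s (X p) p.1.2 p.2.
  rewrite in_open_polytope /= /fl /= andbT; split.
    by case/and5P => ? ? ? ? /andP[? ?]; split; [lra|lra|split; lra|split; lra].
  by case=> ? ? [? ?] [? ?]; apply/and5P; split; [lra|lra|lra|lra|apply/andP; split; lra].
split=> [[[/E1|/E2]|/E3]|[/E1|/E2|/E3]] ?;
  by [constructor 1|constructor 2|constructor 3|left; left|left; right|right].
Qed.

Lemma solid_interior_open : open solid_interior.
Proof. by do 2?apply: openU; exact: open_polytope_open. Qed.

Lemma solid_closed : closed solid.
Proof. by apply: closedU; exact: polytope_closed. Qed.

Hypothesis h0 : 0 < h.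
Hypothesis s0 : 0 < s.

(** A point of the solid outside [solid_interior] lies on a facet, and from there some direction
    leaves the solid at once: into the wedge for ABC and BCV, radially for the other facets. *)
Lemma solid_interiorP : solid° = solid_interior.
Proof.
apply/seteqP; split => [p ip|]; last first.
  rewrite -open_subsetE; last exact: solid_interior_open.
  by move=> p /solid_interiorE ?; apply/solidE; exact: in_interior_solid.
have sp : solid p := interior_subset ip.
apply: contrapT => np.
have [F F8 Fp] : exists2 F, (F < 8)%N & facet_cond h s F (X p) p.1.2 p.2.
  apply: in_frontier_facet => //; first exact/solidE.
  by move/solid_interiorE.
have [d dP] : exists d : pt3 R, forall t : R, 0 < t -> ~ solid (p + t *: d).
  have [F0|F0] := boolP ((F == 0) || (6 < F)%N).
    exists (2 * s, 0, h) => t t0 /solidE; rewrite !coordE /=.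
    rewrite (_ : _ + _ + s = X p + 2 * s * t); last by ring.
    rewrite mulr0 addr0 (mulrC t).
    exact: wedge_escape F0 Fp t0.
  exists (X p, p.1.2, p.2) => t t0 /solidE; rewrite !coordE /=.
  rewrite (_ : _ + _ + s = (1 + t) * X p); last by ring.
  rewrite (_ : p.1.2 + _ = (1 + t) * p.1.2); last by ring.
  rewrite (_ : p.2 + _ = (1 + t) * p.2); last by ring.
  apply: radial_escape Fp t0 => //.
  by move: F0; rewrite negb_or -leqNgt lt0n.
have cl : (fun k : nat => p + k.+1%:R^-1 *: d) @ \oo --> p.
  suff : (fun k : nat => p + k.+1%:R^-1 *: d) @ \oo --> p + (0 : R) *: d.
    by rewrite scale0r addr0.
  by apply: cvgD; [exact: cvg_cst|apply: cvgZr_tmp; exact: cvg_harmonic].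
have [k _ /(_ k (leqnn k))] := cl _ ip.
by apply: dP; rewrite invr_gt0.
Qed.

Lemma solid_frontierP p : (solid `\` solid°) p <->
  exists2 F, (F < 8)%N & facet_cond h s F (X p) p.1.2 p.2.
Proof.
rewrite solid_interiorP; split.
  case=> /solidE sp np; apply: in_frontier_facet => //.
  by move/solid_interiorE.
case=> F _ /(facet_cond_solid h0 s0)[sp np]; split; first exact/solidE.
by move/solid_interiorE.
Qed.

End Body.

Section FacetRegions.
Variables (R : realType) (h s : R).
Hypothesis hs : s = 4^-1 - 2 * h.
Hypothesis h0 : 0 < h.
Hypothesis h1 : 16 * h <= 1.
Local Notation X p := (p.1.1 + s).

Lemma facet_region_cond (F : 'I_8) (p : pt3 R) :
  facet_region h s F p -> facet_cond h s F (X p) p.1.2 p.2.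
Proof.
case=> a [b [c [a0 b0 c0 abc pE]]].
have XE (u v w : pt3 R) : p = a *: u + b *: v + c *: w ->
    [/\ X p = a * (u.1.1 + s) + b * (v.1.1 + s) + c * (w.1.1 + s),
     p.1.2 = a * u.1.2 + b * v.1.2 + c * w.1.2 & p.2 = a * u.2 + b * v.2 + c * w.2].
  move=> ->; rewrite !coordE; split => //.
  by rewrite -[s in LHS]mul1r -abc; ring.
have [-> -> ->] := XE _ _ _ pE; clear XE pE.
have hs' := hs; have h0' := h0; have h1' := h1.
case: F => -[|[|[|[|[|[|[|[|//]]]]]]]] iF; rewrite /corner /=.
- by split; lra.
- by split; lra.
- by split; lra.
- by split; lra.
- by split; lra.
- have e : 0 <= (s + h) * b by apply: mulr_ge0 => //; lra.
  have e' : 0 <= (s + h) * c by apply: mulr_ge0 => //; lra.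
  by rewrite hs' in e e' *; split; lra.
- have e : 0 <= (s + h) * b by apply: mulr_ge0 => //; lra.
  have e' : 0 <= (s + h) * c by apply: mulr_ge0 => //; lra.
  by rewrite hs' in e e' *; split; lra.
- have e : 0 <= s * c by apply: mulr_ge0 => //; lra.
  by rewrite hs' in e *; split; lra.
Qed.

Lemma facet_cond_region (F : 'I_8) (p : pt3 R) :
  facet_cond h s F (X p) p.1.2 p.2 -> facet_region h s F p.
Proof.
have s0 : 0 < s by have hs' := hs; have h0' := h0; have h1' := h1; lra.
have sh0 : 0 < s + h by rewrite addr_gt0.
have sh4 : s + h = 4^-1 - h by rewrite hs; ring.
have hs' := hs.
have px : p.1.1 = X p - s by rewrite addrK.
move: px; move: (X p) => x px.
case: F => -[|[|[|[|[|[|[|[|//]]]]]]]] iF [] c1 c2 c3 c4.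
- exists (2 * x), ((1 - 2 * x + 2 * p.1.2) / 2), ((1 - 2 * x - 2 * p.1.2) / 2).
  split; [lra|lra|lra|lra|].
  by apply: pt3_eq; rewrite !coordE /corner /= ?px ?c1; [field|field|ring].
- exists (2 * (x - p.2)), (2 * p.1.2), (- 4 * p.2).
  split; [lra|lra|lra|lra|].
  have e : 2 * p.1.2 = 1 - 2 * x + 6 * p.2 by lra.
  by apply: pt3_eq; rewrite !coordE /corner /= ?px; [rewrite e; field|field|field].
- exists (2 * (x - p.2)), (- 2 * p.1.2), (- 4 * p.2).
  split; [lra|lra|lra|lra|].
  have e : - 2 * p.1.2 = 1 - 2 * x + 6 * p.2 by lra.
  by apply: pt3_eq; rewrite !coordE /corner /= ?px; [rewrite e; field|field|field].
- exists (2 * p.1.2), (- 2 * (x + p.2)), (2 * (p.2 - x)).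
  split; [lra|lra|lra|lra|].
  have e : 2 * p.1.2 = 1 + 4 * x by lra.
  by apply: pt3_eq; rewrite !coordE /corner /= ?px; [rewrite e; field|field|field].
- exists (- 2 * p.1.2), (- 2 * (x + p.2)), (2 * (p.2 - x)).
  split; [lra|lra|lra|lra|].
  have e : - 2 * p.1.2 = 1 + 4 * x by lra.
  by apply: pt3_eq; rewrite !coordE /corner /= ?px; [rewrite e; field|field|field].
- have d : s + h != 0 by rewrite gt_eqF.
  have e0 : 4 * (s * p.2 - h * x) / (s + h) + (x + p.2) / (s + h) = 4 * x + 8 * p.2.
    by apply: (mulIf d); rewrite mulrDl !divfK// hs; field.
  have sum : 2 * p.1.2 + 4 * (s * p.2 - h * x) / (s + h) + (x + p.2) / (s + h) = 1.
    by rewrite -addrA e0 addrA.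
  (* Each weight is the affine function that vanishes on the opposite side and is 1 at its vertex: s
     z - h x vanishes on the plane BCV, and x + z on the plane BCE. *)
  exists (2 * p.1.2), (4 * (s * p.2 - h * x) / (s + h)), ((x + p.2) / (s + h)); split=> //.
  + by lra.
  + by apply: divr_ge0; [rewrite mulr_ge0// subr_ge0|exact: ltW].
  + by apply: divr_ge0; [|exact: ltW].
  have e : 2 * p.1.2 = 1 - 4 * (s * p.2 - h * x) / (s + h) - (x + p.2) / (s + h) by lra.
  apply: pt3_eq; rewrite !coordE /corner /= ?px.
  + by rewrite e; field.
  + by field.
  + by field.
- have d : s + h != 0 by rewrite gt_eqF.
  have e0 : 4 * (s * p.2 - h * x) / (s + h) + (x + p.2) / (s + h) = 4 * x + 8 * p.2.
    by apply: (mulIf d); rewrite mulrDl !divfK// hs; field.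
  have sum : - 2 * p.1.2 + 4 * (s * p.2 - h * x) / (s + h) + (x + p.2) / (s + h) = 1.
    by rewrite -addrA e0 addrA.
  exists (- 2 * p.1.2), (4 * (s * p.2 - h * x) / (s + h)), ((x + p.2) / (s + h)); split=> //.
  + by lra.
  + by apply: divr_ge0; [rewrite mulr_ge0// subr_ge0|exact: ltW].
  + by apply: divr_ge0; [|exact: ltW].
  have e : - 2 * p.1.2 = 1 - 4 * (s * p.2 - h * x) / (s + h) - (x + p.2) / (s + h) by lra.
  apply: pt3_eq; rewrite !coordE /corner /= ?px.
  + by rewrite e; field.
  + by field.
  + by field.
- have d : s != 0 by rewrite gt_eqF.
  have pz : p.2 = h * x / s by rewrite -c1 mulrAC divff ?mul1r.
  have xs : 4 * x + 8 * p.2 = x / s.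
    apply: (mulIf d); rewrite divfK//.
    rewrite (_ : _ * s = 4 * (x * s) + 8 * (s * p.2)); last by ring.
    by rewrite c1 hs; field.
  have xs0 : 0 <= x / s by rewrite divr_ge0// ltW.
  exists ((1 - x / s + 2 * p.1.2) / 2), ((1 - x / s - 2 * p.1.2) / 2), (x / s).
  split; [lra|lra|lra|lra|].
  apply: pt3_eq; rewrite !coordE /corner /= ?px.
  + by field.
  + by field.
  + by rewrite pz; field.
Qed.

Lemma facet_regionP (F : 'I_8) (p : pt3 R) :
  facet_region h s F p <-> facet_cond h s F (X p) p.1.2 p.2.
Proof. by split; [exact: facet_region_cond|exact: facet_cond_region]. Qed.

End FacetRegions.

(** * The polyhedron *)

Section SegmentTopology.
Context {R : realType}.
Implicit Types (p q c : pt3 R).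

Lemma segment_connected3 p q : connected (segment p q).
Proof.
rewrite (_ : segment p q = (fun t : R => (1 - t) *: p + t *: q) @` `[0, 1]%classic).
  apply: connected_continuous_connected; first exact: segment_connected.
  apply: continuous_subspaceT => t.
  apply: cvgD; apply: cvgZr_tmp; last exact: cvg_id.
  by apply: cvgB; [exact: cvg_cst|exact: cvg_id].
apply/seteqP; split => x.
  by case=> t t01 ->; exists t => //=; rewrite in_itv.
by case=> t; rewrite /= in_itv => t01 <-; exists t.
Qed.

Lemma starshaped_connected (A : set (pt3 R)) c : A c ->
  (forall p, A p -> segment c p `<=` A) -> connected A.
Proof.
move=> Ac star; rewrite (_ : A = \bigcup_(p in A) segment c p).
  apply: bigcup_connected => [|p _]; last exact: segment_connected3.
  exists c => p _; exists 0; first by rewrite lexx ler01.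
  by rewrite subr0 scale1r scale0r addr0.
apply/seteqP; split => [p Ap|p [q Aq /(star _ Aq)]//].
exists p => //; exists 1; first by rewrite lexx ler01.
by rewrite subrr scale0r add0r scale1r.
Qed.

End SegmentTopology.

Section SolidTopology.
Variables (R : realType) (h s : R).
Hypothesis hs : s = 4^-1 - 2 * h.
Hypothesis h0 : 0 < h.
Hypothesis h1 : 16 * h <= 1.
Local Notation X p := (p.1.1 + s).

Let s0 : 0 < s.
Proof. by have hs' := hs; have h0' := h0; have h1' := h1; lra. Qed.

(* The octahedron has diameter 1, attained at its vertices B and C. *)
Lemma in_solid_l1 x y z : in_solid h s x y z -> `|x| + `|y| + `|z| <= 2^-1.
Proof.
move=> H; suff : [/\ x + y + z <= 2^-1, x - y + z <= 2^-1, x + y - z <= 2^-1 & x - y - z <= 2^-1] /\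
  [/\ - x + y + z <= 2^-1, - x - y + z <= 2^-1, - x + y - z <= 2^-1 & - x - y - z <= 2^-1].
  case=> -[? ? ? ?] [? ? ? ?].
  by have [x0|x0] := leP 0 x; have [y0|y0] := leP 0 y; have [z0|z0] := leP 0 z;
    rewrite ?(ger0_norm x0) ?(ltr0_norm x0) ?(ger0_norm y0) ?(ltr0_norm y0)
      ?(ger0_norm z0) ?(ltr0_norm z0); lra.
by case: H => [[? ? ? ? ?]|[? _ [? ?] [? ?]]]; split; split; lra.
Qed.

Lemma solid_l1 p : solid h s p -> `|X p| + `|p.1.2| + `|p.2| <= 2^-1.
Proof. by move/solidE/in_solid_l1. Qed.

Definition box : set (pt3 R) := `[-1, 1]%classic `*` `[-1, 1]%classic `*` `[-1, 1]%classic.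

Lemma solid_box : solid h s `<=` box.
Proof.
move=> p /solid_l1 H.
have [a1 a2 a3] : [/\ `|X p| <= 2^-1, `|p.1.2| <= 2^-1 & `|p.2| <= 2^-1].
  have := normr_ge0 (X p); have := normr_ge0 p.1.2; have := normr_ge0 p.2.
  by move=> *; split; lra.
have hs' := hs; have h0' := h0; have h1' := h1.
move: a1 a2 a3; rewrite !ler_norml => /andP[? ?] /andP[? ?] /andP[? ?].
by split; [split|]; rewrite /= in_itv/=; apply/andP; split; lra.
Qed.

Lemma solid_compact : compact (solid h s).
Proof.
apply: (subclosed_compact (@solid_closed _ h s) _ solid_box).
by do 2?apply: compact_setX; exact: segment_compact.
Qed.

Lemma solid_regular : solid h s = closure (solid h s)°.
Proof.
rewrite solid_interiorP//; apply/seteqP; split; last first.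
  apply: subset_trans (@solid_closed R h s).
  by rewrite -solid_interiorP//; apply: closureS; exact: interior_subset.
move=> p [lp|up].
  have : open_polytope s lower (- s, 0, - 20^-1).
    by apply/in_open_polytope; rewrite /= /fl /=; apply/and5P; split; [lra|lra|lra|lra|apply/andP; split => //; lra].
  by move=> /polytope_closure/(_ _ lp); apply: closureS => q; left; left.
have : open_polytope s (upper h s) (- 8^-1 - s, 0, 16^-1).
  apply/in_open_polytope; rewrite /= /fl /=.
  have s0' := s0; have h0' := h0.
  by apply/and5P; split; [lra|lra|lra|lra|apply/and3P; split => //; lra].
by move=> /polytope_closure/(_ _ up); apply: closureS => q; right.
Qed.

Lemma open_polytope_comb Q (t : R) c p : polytope s Q c -> open_polytope s Q p ->
  0 < t <= 1 -> open_polytope s Q ((1 - t) *: c + t *: p).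
Proof.
move=> Qc Qp /andP[t0 t1] q qQ; rewrite fl_comb; apply: ltr_wpDl.
  by rewrite mulr_ge0 ?Qc// subr_ge0.
by rewrite mulr_gt0 ?Qp.
Qed.

(** The interior is star-shaped about c, a point of the open middle part with z = 0. Since c also
    lies in both closed polytopes, a segment from c to a point of an open one is inside it as soon
    as it leaves c. *)
Lemma solid_connected : (solid h s)° !=set0 /\ connected (solid h s)°.
Proof.
rewrite solid_interiorP//; pose c : pt3 R := (- 8^-1 - s, 0, 0).
have h0' := h0; have s0' := s0.
have cM : open_polytope s middle c.
  apply/in_open_polytope; rewrite /= /fl /=.
  by apply/and5P; split; [lra|lra|lra|lra|apply/and4P; split => //; lra].
have cL : polytope s lower c.
  apply/in_polytope; rewrite /= /fl /=.
  by apply/and5P; split; [lra|lra|lra|lra|apply/andP; split => //; lra].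
have cU : polytope s (upper h s) c.
  apply/in_polytope; rewrite /= /fl /=.
  by apply/and5P; split; [lra|lra|lra|lra|apply/and3P; split => //; lra].
have cO : solid_interior h s c by left; right.
split; first by exists c.
apply: (starshaped_connected cO) => p Op q [t /andP[]].
rewrite le_eqVlt => /predU1P[<- _ ->|t0 t1 ->].
  by rewrite subr0 scale1r scale0r addr0.
have t01 : 0 < t <= 1 by rewrite t0.
case: Op => [[|]|] Qp.
- by left; left; exact: open_polytope_comb.
- left; right; apply: open_polytope_comb => // q' /cM; exact: ltW.
- by right; exact: open_polytope_comb.
Qed.

Lemma solid_facets : solid h s `\` (solid h s)° = [set p | exists F, facet_region h s F p].
Proof.
apply/seteqP; split => p.
  case/(solid_frontierP h0 s0) => F F8 Fp; exists (Ordinal F8).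
  exact/(facet_regionP hs h0 h1).
case=> F /(facet_regionP hs h0 h1) Fp; apply/(solid_frontierP h0 s0).
by exists F.
Qed.

End SolidTopology.

Section Polyhedron.
Variables (R : realType) (h s : R).
Hypothesis hs : s = 4^-1 - 2 * h.
Hypothesis h0 : 0 < h.
Hypothesis h1 : 16 * h <= 1.

Lemma facet_cycle_size F : uniq (facet_cycle F) /\ (3 <= size (facet_cycle F))%N.
Proof. by split; first exact: facet_cycle_uniq. Qed.

Lemma facet_simple F i j p : i \in facet_cycle F -> j \in facet_cycle F -> i != j ->
  segment (corner h s i) (corner h s (next (facet_cycle F) i)) p ->
  segment (corner h s j) (corner h s (next (facet_cycle F) j)) p ->
  exists k, [/\ p = corner h s k, k \in [:: i; next (facet_cycle F) i]
              & k \in [:: j; next (facet_cycle F) j]].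
Proof.
exact: (triangle_simple (facet_cycle_uniq F) (facet_nondegenerate hs h0 h1 F)).
Qed.

Lemma facet_polygon F : exists n d,
  [/\ n != 0, facet_region h s F `<=` plane n d, compact (facet_region h s F),
      relint (plane n d) (facet_region h s F) !=set0
    & facet_region h s F `\` relint (plane n d) (facet_region h s F) =
      closed_polygon (corner h s) (facet_cycle F)].
Proof.
exact: (triangle_polygon (facet_cycle_uniq F) (facet_nondegenerate hs h0 h1 F)).
Qed.

Lemma facet_meet F G p : F != G -> facet_region h s F p -> facet_region h s G p ->
  (exists i, [/\ i \in facet_cycle F, i \in facet_cycle G & p = corner h s i]) \/
  (exists i j, [/\ edge_of (facet_cycle F) i j, edge_of (facet_cycle G) i j
                 & segment (corner h s i) (corner h s j) p]).
Proof.
have meet (F' G' : 'I_8) : F' != G' -> separator (R:=R) F' G' -> facet_region h s F' p -> facet_region h s G' p ->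
  (exists i, [/\ i \in facet_cycle F', i \in facet_cycle G' & p = corner h s i]) \/
  (exists i j, [/\ edge_of (facet_cycle F') i j, edge_of (facet_cycle G') i j
                 & segment (corner h s i) (corner h s j) p]).
  move=> FG; case E : separator => [q|//] _; have [q1 q2 q3] := separatorP hs h0 h1 E.
  exact: (triangle_meet (facet_cycle_uniq F') (facet_cycle_uniq G') (@fl_affine R s q)
    (facet_not_sub FG) q1 q2 q3).
move=> FG Fp Gp; case: (@separator_total R _ _ FG) => sep.
  exact: meet.
case: (meet G F _ sep Gp Fp) => [|[i [? ? ->]]|[i [j [? ? ?]]]]; first by rewrite eq_sym.
  by left; exists i.
by right; exists i, j.
Qed.

Lemma facet_crease F G i j : F != G ->
  edge_of (facet_cycle F) i j -> edge_of (facet_cycle G) i j ->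
  ~ exists n d, n != 0 /\ forall k, (k \in facet_cycle F) || (k \in facet_cycle G) ->
      plane n d (corner h s k).
Proof.
move=> FG Fij Gij [n [d [/negP n0 H]]]; apply: n0; apply/eqP.
have /hasP[S S4 /allP SFG] := adjacent_facets_tetrahedron FG Fij Gij.
apply: (tetrahedra_noncoplanar hs h0 h1 S4 (d := d)) => k /SFG /mapP[k' + /val_inj ->].
by rewrite mem_cat; exact: H.
Qed.

Lemma facet_corner i : exists2 F, i \in facet_cycle F &
  ~ segment (corner h s (prev (facet_cycle F) i)) (corner h s (next (facet_cycle F) i))
      (corner h s i).
Proof.
have [F Fi] := facet_of_vertex i; exists F => //.
exact: (triangle_corner (facet_cycle_uniq F) (facet_nondegenerate hs h0 h1 F)).
Qed.

Definition fan_polyhedron : polyhedron R :=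
  Polyhedron (corner_inj hs h0 h1) facet_cycle_size facet_simple facet_polygon facet_meet
    facet_edge_two facet_crease facet_corner facet_fan (solid_compact hs h0 h1)
    (solid_regular hs h0 h1) (solid_connected hs h0 h1) (solid_facets hs h0 h1).

End Polyhedron.

Section Shape.
Variables (R : realType) (h s : R).
Hypothesis hs : s = 4^-1 - 2 * h.
Hypothesis h0 : 0 < h.
Hypothesis h1 : 16 * h <= 1.

(** The octahedron of [solid_l1] lies in the ball of radius 1/2 about the midpoint of BC, so the
    diameter is at most 1. *)
Lemma solid_inner p : solid h s p ->
  (p.1.1 + s) ^+ 2 + p.1.2 ^+ 2 + p.2 ^+ 2 <= 4^-1.
Proof.
move=> /solid_l1; rewrite -(real_normK (num_real (p.1.1 + s))) -(real_normK (num_real p.1.2)) -(real_normK (num_real p.2)).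
move: (normr_ge0 (p.1.1 + s)) (normr_ge0 p.1.2) (normr_ge0 p.2).
move: `|p.1.1 + s| `|p.1.2| `|p.2| => a b c a0 b0 c0 abc.
have e : (a + b + c) ^+ 2 <= (2^-1) ^+ 2 by apply: lerXn2r => //; rewrite nnegrE; lra.
have ab := mulr_ge0 a0 b0; have ac := mulr_ge0 a0 c0; have bc := mulr_ge0 b0 c0.
nra.
Qed.

Lemma corner_facet F i : i \in facet_cycle F -> facet_region h s F (corner h s i).
Proof.
rewrite !inE /facet_region => /or3P[] /eqP ->.
- by exists 1, 0, 0; split => //; rewrite ?addr0// !scale0r scale1r !addr0.
- by exists 0, 1, 0; split => //; rewrite ?addr0 ?add0r// !scale0r scale1r addr0 add0r.
- by exists 0, 0, 1; split => //; rewrite ?add0r// !scale0r scale1r !add0r.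
Qed.

Lemma corner_solid F i : i \in facet_cycle F -> solid h s (corner h s i).
Proof.
move=> /corner_facet Fp; have : [set p | exists F, facet_region h s F p] (corner h s i) by exists F.
by rewrite -solid_facets// => -[].
Qed.

Lemma solid_diam : diam (solid h s) = 1.
Proof.
have ub : ubound [set r : R | exists p q, [/\ solid h s p, solid h s q & r = dist p q]] 1.
  move=> _ [p [q [/solid_inner Sp /solid_inner Sq ->]]].
  rewrite /dist -[leRHS]sqrtr1 ler_wsqrtr// /inner !coordE -!expr2.
  have sq (a b : R) : (a - b) ^+ 2 <= 2 * (a ^+ 2 + b ^+ 2) by have := sqr_ge0 (a + b); nra.
  have := sq (p.1.1 + s) (q.1.1 + s); have := sq p.1.2 q.1.2; have := sq p.2 q.2.
  rewrite (_ : p.1.1 + s - (q.1.1 + s) = p.1.1 - q.1.1); last by ring.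
  lra.
apply/eqP; rewrite eq_le; apply/andP; split.
  apply: ge_sup => //; exists (dist (corner h s 0) (corner h s 0)), (corner h s 0), (corner h s 0).
  by split => //; exact: (@corner_solid 0).
apply: ub_le_sup; first by exists 1.
pose o1 : 'I_6 := @Ordinal 6 1 isT; pose o2 : 'I_6 := @Ordinal 6 2 isT.
exists (corner h s o1), (corner h s o2); split.
- exact: (@corner_solid 0).
- exact: (@corner_solid 0).
rewrite /dist -[LHS]sqrtr1; congr Num.sqrt.
by rewrite /inner /corner !coordE /=; field.
Qed.

Lemma base_plane p : facet_region h s 0 p -> p.2 = 0.
Proof. by move/(facet_regionP hs h0 h1) => -[]. Qed.

Lemma base_frontier_far :
  16^-1 < dist_set (0, 0, 0) (closed_polygon (corner h s) (facet_cycle 0)).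
Proof.
(* An infimum keeps only weak inequalities, so a larger constant is proved first. It is uniform in h
   because 1/8 <= s < 1/4. *)
apply: (@lt_le_trans _ _ 8^-1); first by lra.
apply: lb_le_inf.
  exists (dist (0, 0, 0) (corner h s (@Ordinal 6 0 isT))), (corner h s (@Ordinal 6 0 isT)) => //.
  exists (@Ordinal 6 0 isT) => //; exists 0; first by rewrite lexx ler01.
  by rewrite subr0 scale1r scale0r addr0.
have hs' := hs; have h0' := h0; have h1' := h1.
move=> _ [p + <-]; rewrite closed_polygon3; last exact: facet_cycle_uniq.
move=> pP; suff far : 64^-1 <= p.1.1 ^+ 2 + p.1.2 ^+ 2 + p.2 ^+ 2.
  rewrite -[leLHS]ger0_norm// -sqrtr_sqr /dist ler_wsqrtr// /inner !coordE -!expr2 /=.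
  by rewrite !sub0r !sqrrN; lra.
(* For the sides AB and CA, where x + |y| = 1/2 - s is at least 1/4. *)
have far2 (a b c : R) : 4^-1 <= `|a| + `|b| -> 64^-1 <= a ^+ 2 + b ^+ 2 + c ^+ 2.
  rewrite -(real_normK (num_real a)) -(real_normK (num_real b)) => ab.
  have := sqr_ge0 c; have := sqr_ge0 (`|a| - `|b|).
  have : (4^-1 : R) ^+ 2 <= (`|a| + `|b|) ^+ 2 by rewrite lerXn2r// nnegrE; lra.
  by nra.
have far1 (a b c : R) : a = - s -> 64^-1 <= a ^+ 2 + b ^+ 2 + c ^+ 2.
  move=> ->; have := sqr_ge0 b; have := sqr_ge0 c; rewrite sqrrN.
  have : (8^-1 : R) ^+ 2 <= s ^+ 2 by apply: lerXn2r; rewrite ?nnegrE; lra.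
  by nra.
case: pP => [[]|] [t /andP[t0 t1] ->]; rewrite !coordE /corner /=.
- apply: far2; apply: le_trans (lerD (ler_norm _) (ler_norm _)); lra.
- by apply: far1; ring.
- apply: far2; rewrite -[X in _ + X]normrN.
  by apply: le_trans (lerD (ler_norm _) (ler_norm _)); lra.
Qed.

Lemma apex_near : 0 <= dist_set (0, 0, h) (facet_region h s 0) <= h.
Proof.
have hs' := hs; have h0' := h0; have h1' := h1.
have O0 : facet_region h s 0 (0, 0, 0).
  by apply/(facet_regionP hs h0 h1); split; rewrite /=; lra.
apply/andP; split.
  apply: lb_le_inf; first by exists (dist (0, 0, h) (0, 0, 0)), (0, 0, 0).
  by move=> _ [q _ <-]; exact: sqrtr_ge0.
apply: (@le_trans _ _ (dist (0, 0, h) (0, 0, 0))).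
  apply: ge_inf; last by exists (0, 0, 0).
  by exists 0 => _ [q _ <-]; exact: sqrtr_ge0.
rewrite /dist /inner !coordE /= !subr0 !mul0r !add0r -expr2 sqrtr_sqr ger0_norm// ltW//.
Qed.

End Shape.

(** * The function x^2 + y^2 *)

Section MultiIndices.
Context {R : realType}.
Implicit Types (alpha beta : nat * nat * nat) (phi : pt3 R -> R).

Lemma multi1_basis alpha : alpha \in multi 1 ->
  exists k, [/\ forall phi, Dpartial alpha phi = partial k phi, multi_order alpha = 1%N &
    basis k = (alpha.1.1%:R, alpha.1.2%:R, alpha.2%:R) :> pt3 R].
Proof.
rewrite multi1 !inE => /or3P[] /eqP ->.
- by exists (inord 2); rewrite /basis inordK.
- by exists (inord 1); rewrite /basis inordK.
- by exists (inord 0); rewrite /basis inordK.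
Qed.

(** The splitting follows the order in which [Dpartial] applies the partial derivatives, so the
    first identity holds by computation. *)
Lemma multi2_split alpha : alpha \in multi 2 -> exists2 beta, beta \in multi 1 &
  exists2 gamma, gamma \in multi 1 &
  [/\ forall phi, Dpartial alpha phi = Dpartial beta (Dpartial gamma phi),
      multi_order alpha = 2%N,
      alpha.1.1 = (beta.1.1 + gamma.1.1)%N & alpha.1.2 = (beta.1.2 + gamma.1.2)%N].
Proof.
rewrite (_ : multi 2 = [:: (0, 0, 2); (0, 1, 1); (0, 2, 0); (1, 0, 1); (1, 1, 0); (2, 0, 0)]%N)//.
rewrite !inE => /or4P[|||/or3P[]] /eqP ->.
- by exists (0, 0, 1)%N => //; exists (0, 0, 1)%N.
- by exists (0, 1, 0)%N => //; exists (0, 0, 1)%N.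
- by exists (0, 1, 0)%N => //; exists (0, 1, 0)%N.
- by exists (1, 0, 0)%N => //; exists (0, 0, 1)%N.
- by exists (1, 0, 0)%N => //; exists (0, 1, 0)%N.
- by exists (1, 0, 0)%N => //; exists (1, 0, 0)%N.
Qed.

End MultiIndices.

Lemma box_finite (R : realType) : (mu3 (@box R : set (mpt3 R)) < +oo)%E.
Proof.
have mI : measurable (`[-1, 1]%classic : set (measurableTypeR R)) by exact: measurable_itv.
rewrite product_measure1E//; last exact: measurableX.
have E := @product_measure1E _ _ _ _ R lebesgue_measure lebesgue_measure _ _ mI mI.
have L : lebesgue_measure (`[-1, 1]%classic : set (measurableTypeR R)) = (1 - - 1)%:E.
  by rewrite lebesgue_measure_itv /= lte_fin ifT -?EFinB//; lra.
rewrite [X in (X * _)%E](_ : _ = ((1 - - 1) * (1 - - 1))%:E); last first.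
  by apply: (etrans E); exact: (congr2 (fun a b => (a * b)%E) L L).
by rewrite [X in (_ * X)%E](_ : _ = (1 - - 1)%:E)// -EFinM ltry.
Qed.

Section SquaredRadius.
Context {R : realType}.
Variable O : set (pt3 R).
Hypothesis oO : open O.
Hypothesis Obox : O `<=` @box R.
Local Notation OO := (O : set (mpt3 R)).
Local Notation mu := (mu3 : {measure set (mpt3 R) -> \bar R}).
Local Notation ip := (l2dot mu OO).
Implicit Types (alpha : nat * nat * nat) (p : pt3 R).

Let mO : measurable OO. Proof. exact: open_measurable3. Qed.

Lemma finite_measure3 : (mu3 OO < +oo)%E.
Proof.
apply: le_lt_trans (box_finite R); apply: (@le_measure _ _ _ mu); rewrite ?inE//.
by apply: measurableX => //; apply: measurableX.
Qed.
Let finO := finite_measure3.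

Lemma box_bounds p : O p -> [/\ `|p.1.1| <= 1, `|p.1.2| <= 1 & `|p.2| <= 1].
Proof.
by move=> /Obox[[]]; rewrite /= !in_itv/= => *; split; rewrite ler_norml.
Qed.

Definition vol : R := fine (mu OO).

Lemma vol_ge0 : 0 <= vol.
Proof. exact: fine_ge0. Qed.

Lemma ip_bounded (f : pt3 R -> R) (M : R) : L2 O f -> (forall p, O p -> `|f p| <= M) ->
  ip f f <= M ^+ 2 * vol.
Proof.
move=> Lf fM; rewrite ip_norm -[leRHS]Rintegral_cst//; apply: le_Rintegral => //.
- exact: Lf.2.
- exact: integrable_cst_EFin.
- move=> p Op; rewrite -(real_normK (num_real (f p))) lerXn2r ?nnegrE ?fM//.
  by apply: le_trans (fM p Op).
Qed.

Lemma dirichlet_bounded (D : nat * nat * nat -> pt3 R -> R) (M : R) : sqint1 O D ->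
  (forall alpha p, alpha \in multi 1 -> O p -> `|D alpha p| <= M) ->
  dirichlet O D D <= 3 * M ^+ 2 * vol.
Proof.
move=> sD DM; apply: (@le_trans _ _ (\sum_(alpha <- multi 1) M ^+ 2 * vol)).
  rewrite /dirichlet big_seq [leRHS]big_seq; apply: ler_sum => alpha a1.
  by apply: ip_bounded; [exact: sD|move=> p; exact: DM].
by rewrite !big_cons big_nil; lra.
Qed.

Definition radius2 p : R := p.1.1 ^+ 2 + p.1.2 ^+ 2.

Definition grad_radius2 alpha p : R := 2 * (alpha.1.1%:R * p.1.1 + alpha.1.2%:R * p.1.2).

Definition hess_radius2 alpha : R := 2 * ((alpha.1.1 == 2%N) + (alpha.1.2 == 2%N))%:R.

Lemma fst1_continuous : continuous (fun p : pt3 R => p.1.1).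
Proof. by move=> p; apply: cvg_comp; exact: cvg_fst. Qed.

Lemma snd1_continuous : continuous (fun p : pt3 R => p.1.2).
Proof.
by move=> p; apply: (@cvg_comp _ _ _ fst snd _ (nbhs p.1)); [exact: cvg_fst|exact: cvg_snd].
Qed.

Let index_le1 alpha : alpha \in multi 1 ->
  [/\ (alpha.1.1%:R : R) <= 1, (alpha.1.2%:R : R) <= 1 &
      (alpha.1.1%:R : R) ^+ 2 + (alpha.1.2%:R : R) ^+ 2 <= 1].
Proof. by rewrite multi1 !inE => /or3P[] /eqP -> /=; split; lra. Qed.

Lemma grad_radius2_bounded alpha p : alpha \in multi 1 -> O p ->
  `|grad_radius2 alpha p| <= 2.
Proof.
move=> a1 /box_bounds[]; rewrite !ler_norml /grad_radius2 => /andP[? ?] /andP[? ?] _.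
by move: a1; rewrite multi1 !inE => /or3P[] /eqP -> /=; lra.
Qed.

Lemma weak_grad_radius2 : weak_derivatives O 1 radius2 grad_radius2.
Proof.
move=> alpha a1; have [k [Dk oa bk]] := @multi1_basis R _ a1.
have a0 : (0 : R) <= alpha.1.1%:R /\ (0 : R) <= alpha.1.2%:R by rewrite !ler0n.
have [a11 a12 a2] := @index_le1 alpha a1.
apply: (@weak_derivative_lipschitz R O oO finO k alpha _ _ 2 4) => //.
- apply: measurable_funTS; apply: continuous_measurable3 => p.
  rewrite (_ : radius2 = fun p => p.1.1 * p.1.1 + p.1.2 * p.1.2).
    by apply: cvgD; apply: cvgM; try exact: fst1_continuous; exact: snd1_continuous.
  by apply/funext => q; rewrite /radius2 !expr2.
- move=> p /box_bounds[]; rewrite !ler_norml /radius2 => /andP[? ?] /andP[? ?] _.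
  by apply/andP; split; nra.
- move=> p t t0 seg.
  have Op : O p by have := seg 0; rewrite scale0r addr0; apply; rewrite lexx ltW.
  have /box_bounds[] : O (p + t *: basis k) by apply: seg; rewrite lexx ltW.
  have /box_bounds[] := Op.
  rewrite bk /radius2 !coordE /= !ler_norml.
  move=> /andP[x1 x2] /andP[y1 y2] _ /andP[x3 x4] /andP[y3 y4] _.
  have ta := mulr_ge0 (ltW t0) a0.1; have tb := mulr_ge0 (ltW t0) a0.2.
  have tb1 : t * alpha.1.2%:R <= t by rewrite ler_piMr// ltW.
  have ta1 : t * alpha.1.1%:R <= t by rewrite ler_piMr// ltW.
  by apply/andP; split; nra.
- move=> p Op; rewrite bk.
  set l := (X in _ --> X); set c : R := alpha.1.1%:R ^+ 2 + alpha.1.2%:R ^+ 2.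
  have -> : (fun n : nat => n.+1%:R * (radius2 (p + n.+1%:R^-1 *:
      (alpha.1.1%:R, alpha.1.2%:R, alpha.2%:R)) - radius2 p)) = fun n => l + n.+1%:R^-1 * c.
    apply/funext => n; rewrite /radius2 !coordE /l /grad_radius2 /c /=; field.
    by rewrite addrC natr1.
  suff : (fun n : nat => l + n.+1%:R^-1 * c) @ \oo --> l + 0 * c by rewrite mul0r addr0.
  by apply: cvgD; [exact: cvg_cst|apply: cvgM; [exact: cvg_harmonic|exact: cvg_cst]].
Qed.

(** Test w with [Dpartial gamma phi] and then D with phi; the signs multiply. *)
Lemma weak_derivative_comp alpha beta gamma (w D E : pt3 R -> R) :
  gamma \in multi 1 ->
  (forall phi : pt3 R -> R, Dpartial alpha phi = Dpartial beta (Dpartial gamma phi)) ->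
  multi_order alpha = (multi_order beta + multi_order gamma)%N ->
  weak_derivative O beta w D -> weak_derivative O gamma D E -> weak_derivative O alpha w E.
Proof.
move=> g1 Da oa [Lw LD wD] [_ LE DE]; split => // phi tphi.
by rewrite Da wD ?DE ?oa ?exprD ?mulrA//; exact: test_function_Dpartial.
Qed.

Lemma weak_hess_radius2 : weak_derivatives O 2 radius2 (fun alpha _ => hess_radius2 alpha).
Proof.
move=> alpha /(@multi2_split R)[beta b1 [gamma g1 [Da oa a1 a2]]].
have [k [Dk og bk]] := multi1_basis (R := R) g1; have [_ [_ ob _]] := multi1_basis (R := R) b1.
apply: (weak_derivative_comp g1 Da _ (weak_grad_radius2 b1)); first by rewrite oa ob og.
pose c : R := 2 * (beta.1.1%:R * gamma.1.1%:R + beta.1.2%:R * gamma.1.2%:R).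
have -> : hess_radius2 alpha = c.
  rewrite /hess_radius2 a1 a2 /c; move: b1 g1; rewrite multi1 !inE.
  by move=> /or3P[] /eqP -> /or3P[] /eqP -> /=; ring.
have inc p t : grad_radius2 beta (p + t *: basis k) - grad_radius2 beta p = c * t.
  by rewrite bk /grad_radius2 !coordE /c /=; ring.
apply: (@weak_derivative_lipschitz R O oO finO k gamma _ _ 2 `|c|) => //.
- apply: measurable_funTS; apply: continuous_measurable3 => p.
  apply: cvgM; first exact: cvg_cst.
  by apply: cvgD; (apply: cvgM; first exact: cvg_cst); [exact: fst1_continuous|exact: snd1_continuous].
- by move=> p; exact: grad_radius2_bounded.
- by move=> p t t0 _; rewrite inc normrM (gtr0_norm t0).
- move=> p _; rewrite (_ : (fun n => _) = cst c); first exact: cvg_cst.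
  by apply/funext => n; rewrite inc mulrCA mulfV ?mulr1// pnatr_eq0.
Qed.

Lemma hess_radius2_norm : \int[mu]_(p in OO) (\sum_(alpha <- multi 2) hess_radius2 alpha ^+ 2) = 8 * vol.
Proof.
rewrite Rintegral_cst//; congr (_ * _).
by rewrite !big_cons big_nil /hess_radius2 /=; ring.
Qed.

(** The energy of u - w is at most twice the sum of the energies of u and w. Three partial
    derivatives bounded by 2, respectively by M, give (24 + 6 M^2) vol, which is at most 8 vol (3 +
    M^2). Since 3 + M^2 >= 1, this number also bounds its own square root. *)
Lemma harmonic_ratio (g : pt3 R -> R) (Dg : nat * nat * nat -> pt3 R -> R) (M : R) :
  weak_derivatives O 1 g Dg ->
  (forall alpha p, alpha \in multi 1 -> O p -> `|Dg alpha p| <= M) ->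
  exists w num den, [/\ weakly_harmonic O w, H10 O (fun p => w p - g p),
    is_seminorm O 1 (fun p => radius2 p - w p) num, is_seminorm O 2 radius2 den
    & 0 <= num / den <= 3 + M ^+ 2].
Proof.
move=> gD DgM.
have OB p : O p -> `|p.1.1| <= 1 by case/box_bounds.
have [w [Dw [wD harm wg DwDg]]] := dirichlet_principle oO finO OB gD.
have sDw : sqint1 O Dw by move=> alpha /wD[].
have sDu : sqint1 O grad_radius2 by move=> alpha /weak_grad_radius2[].
have sDg : sqint1 O Dg by move=> alpha /gD[].
pose D alpha (p : pt3 R) := grad_radius2 alpha p - Dw alpha p.
have dw : weak_derivatives O 1 (fun p => radius2 p - w p) D.
  by move=> alpha a1; apply: weak_derivativeB => //; [exact: weak_grad_radius2|exact: wD].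
have sD : sqint1 O D by move=> alpha /dw[].
pose num := Num.sqrt (dirichlet O D D); pose den := Num.sqrt (8 * vol).
exists w, num, den; split => //.
- by exists Dw.
- by exists D => //; rewrite /num -dirichlet_norm.
- by exists (fun alpha _ => hess_radius2 alpha); [exact: weak_hess_radius2|rewrite hess_radius2_norm].
have bound : dirichlet O D D <= 8 * vol * (3 + M ^+ 2).
  have le1 : dirichlet O D D <= 2 * dirichlet O grad_radius2 grad_radius2 + 2 * dirichlet O Dw Dw.
    rewrite /dirichlet !mulr_sumr -big_split /= big_seq [leRHS]big_seq; apply: ler_sum => alpha a1.
    have := normD2_le mO (sDu _ a1) (sqintN mO (sDw _ a1)).
    by rewrite (ipNl mO (sDw _ a1) (sqintN mO (sDw _ a1))) (ipNr mO (sDw _ a1) (sDw _ a1)) opprK.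
  have le2 := dirichlet_bounded sDu grad_radius2_bounded.
  have le3 := dirichlet_bounded sDg DgM.
  have v0 := vol_ge0; have := mulr_ge0 (sqr_ge0 M) v0.
  by lra.
have K1 : 1 <= 3 + M ^+ 2 by have := sqr_ge0 M; lra.
rewrite divr_ge0 ?sqrtr_ge0//=.
(* A zero denominator makes the quotient 0 by convention, and the bound still holds. *)
have [den0|den0] := eqVneq den 0; first by rewrite den0 invr0 mulr0; lra.
have dpos : 0 < den by rewrite lt_neqAle eq_sym den0 sqrtr_ge0.
rewrite ler_pdivrMr//; apply: (@le_trans _ _ (Num.sqrt (8 * vol * (3 + M ^+ 2)))).
  exact: ler_wsqrtr.
have v0 := vol_ge0.
rewrite sqrtrM; last by lra.
rewrite mulrC ler_wpM2r ?sqrtr_ge0//.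
rewrite -[leRHS]ger0_norm; last by lra.
rewrite -sqrtr_sqr ler_wsqrtr// expr2 ler_peMr//; lra.
Qed.

End SquaredRadius.

(** * The interpolant *)

Section PositivePart.
Context {R : realType}.
Implicit Types (a b c t z : R).

(** The right derivative at t = 0 of the positive part of a + t c. *)
Definition pos_slope a c : R := if (0 < a) || ((a == 0) && (0 < c)) then c else 0.

Lemma pos_slope_le a c : `|c| <= 1 -> `|pos_slope a c| <= 1.
Proof. by rewrite /pos_slope; case: ifP => // _ _; rewrite normr0. Qed.

(** As long as a + t c cannot have changed sign, the increment is exactly linear in t; for a = 0
    this is every t > 0. *)
Lemma pos_right_derivative a c t : `|c| <= 1 -> 0 < t -> (a != 0 -> t < `|a|) ->
  Num.max (a + t * c) 0 - Num.max a 0 = t * pos_slope a c.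
Proof.
rewrite ler_norml => /andP[c1 c2] t0 ta.
have tc1 : t * c <= t by rewrite ler_piMr// ltW.
have tc2 : - t <= t * c by rewrite -mulrN1 ler_wpM2l// ltW.
rewrite /pos_slope; have [a0|a0|a0] := ltgtP a 0 => /=.
- have := ta (ltr0_neq0 a0); rewrite ltr0_norm// => ?.
  by rewrite !max_r ?mulr0 ?subrr//; lra.
- have := ta (lt0r_neq0 a0); rewrite gtr0_norm// => ?.
  by rewrite !max_l; lra.
- rewrite a0 add0r subr0.
  have [c0|c0] := ltP 0 c; first by rewrite max_l// ltW// mulr_gt0.
  by rewrite max_r ?mulr0// pmulr_rle0.
Qed.

Lemma max0_lipschitz a b : `|Num.max a 0 - Num.max b 0| <= `|a - b|.
Proof.
rewrite ler_norml; have := ler_norm (a - b); have := ler_norm (b - a); rewrite (distrC b).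
by have [a0|a0] := leP a 0; have [b0|b0] := leP b 0 => ? ?; apply/andP; split; lra.
Qed.

Lemma abs_right_derivative z c t : 0 < t -> (z < 0 -> t < - z) -> 0 <= c <= 1 ->
  `|z + t * c| = `|z| + t * (if z < 0 then - c else c).
Proof.
move=> t0 tz /andP[c0 c1].
have tc1 : t * c <= t by rewrite ler_piMr// ltW.
have tc0 : 0 <= t * c by rewrite mulr_ge0// ltW.
case: ltP => z0; first by have := tz z0 => ?; rewrite !ltr0_norm//; lra.
by rewrite !ger0_norm//; lra.
Qed.

End PositivePart.

Section Interpolant.
Variables (R : realType) (h s : R).
Hypothesis hs : s = 4^-1 - 2 * h.
Hypothesis h0 : 0 < h.
Hypothesis h1 : 16 * h <= 1.
Local Notation X p := (p.1.1 + s).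
Local Notation O := ((solid h s)°).
Implicit Types (p q : pt3 R) (t : R).

Let s0 : 0 < s.
Proof. by have hs' := hs; have h0' := h0; have h1' := h1; lra. Qed.

(** The constants solve the interpolation conditions: [value_edge] is u at B and C, [slopeX] fits D
    and E, [slope_lower] fits A, and [slope_upper] fits V, where u = 0. *)
Definition slopeX : R := 3 / 4 - 2 * s.
Definition slope_lower : R := - (3 / 4).
Definition slope_upper : R := - (3 / 4 * s - s ^+ 2 + 4^-1) / (s + h).
Definition slope p : R := if p.2 <= 0 then slope_lower else slope_upper.
Definition value_edge : R := s ^+ 2 + 4^-1.
(** Zero on the inner triangles BCD and BCE, negative between them inside BCDE, and positive inside
    ABCD and BCEV. *)
Definition wedge p : R := X p + `|p.2|.

(* The piecewise linear interpolant: it is affine on each of the tetrahedra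
   ABCD, BCDE and BCEV, which meet along the common edge X = z = 0. *)
Definition interpolant p : R :=
  value_edge + slopeX * X p + slope p * Num.max (wedge p) 0.

(** The bounds are uniform in h; for [slope_upper] because the denominator s + h = 1/4 - h is at
    least 3/16. *)
Lemma slopes_bounded : [/\ `|slopeX| <= 1, `|slope_lower| <= 3 & `|slope_upper| <= 3].
Proof.
have hs' := hs; have h0' := h0; have h1' := h1.
split; first by rewrite ler_norml /slopeX; lra.
  by rewrite ler_norml /slope_lower; lra.
rewrite /slope_upper mulNr normrN normf_div (gtr0_norm (addr_gt0 s0 h0)).
rewrite ler_pdivrMr ?addr_gt0// ler_norml.
have s2 := sqr_ge0 s; have s1 : s ^+ 2 <= 4^-1 * s by rewrite expr2 ler_wpM2r ?ltW//; lra.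
by apply/andP; split; lra.
Qed.

Lemma slope_bounded p : `|slope p| <= 3.
Proof. by have [_ ? ?] := slopes_bounded; rewrite /slope; case: ifP. Qed.

(** The interior passes from z < 0 to z > 0 only through BCDE, where [wedge] is negative and the
    switch between the two slopes has no effect. *)
Lemma interior_section p : O p -> p.2 = 0 -> X p < 0.
Proof.
rewrite solid_interiorP// => /solid_interiorE Op p0.
by case: Op => [[]|[]|[]]; rewrite p0 ?ltxx.
Qed.

Lemma interpolant_bounded p : solid h s p -> `|interpolant p| <= 5.
Proof.
move=> /solid_l1 p1.
have [? ? ?] : [/\ `|X p| <= 2^-1, `|p.1.2| <= 2^-1 & `|p.2| <= 2^-1].
  have := normr_ge0 (X p); have := normr_ge0 p.1.2; have := normr_ge0 p.2.
  by move=> *; split; lra.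
have [sX _ _] := slopes_bounded; have sp := slope_bounded p.
have w1 : `|Num.max (wedge p) 0| <= 1.
  have := max0_lipschitz (wedge p) 0; rewrite maxxx !subr0 => H; apply: le_trans H _.
  by rewrite (le_trans (ler_normD _ _))// normr_id; lra.
have a1 : `|slopeX * X p| <= 1 * 2^-1 by rewrite normrM ler_pM.
have a2 : `|slope p * Num.max (wedge p) 0| <= 3 * 1 by rewrite normrM ler_pM.
have a3 : `|value_edge| <= 1.
  have hs' := hs; have h0' := h0; have h1' := h1; have s2 := sqr_ge0 s.
  have s1 : s ^+ 2 <= 4^-1 * s by rewrite expr2 ler_wpM2r ?ltW//; lra.
  by rewrite ler_norml /value_edge; apply/andP; split; lra.
rewrite /interpolant; apply: le_trans (ler_normD _ _) _.
have := ler_normD value_edge (slopeX * X p); lra.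
Qed.

Lemma interpolant_same_side p q : (p.2 <= 0) = (q.2 <= 0) ->
  `|interpolant q - interpolant p| <= `|q.1.1 - p.1.1| + 3 * (`|q.1.1 - p.1.1| + `|q.2 - p.2|).
Proof.
move=> pq; have [sX _ _] := slopes_bounded; have sp := slope_bounded p.
rewrite (_ : _ - _ = slopeX * (q.1.1 - p.1.1) +
    slope p * (Num.max (wedge q) 0 - Num.max (wedge p) 0)); last first.
  rewrite /interpolant (_ : slope q = slope p); first by ring.
  by rewrite /slope pq.
rewrite (le_trans (ler_normD _ _))// lerD//; rewrite normrM.
  by rewrite ler_piMl.
apply: ler_pM => //; apply: le_trans (max0_lipschitz _ _) _.
rewrite (_ : _ - _ = q.1.1 - p.1.1 + (`|q.2| - `|p.2|)); last by rewrite /wedge; ring.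
by rewrite (le_trans (ler_normD _ _))// lerD// ler_dist_dist.
Qed.

(** At X < 0 the positive part of [wedge] is at most |z|, so the term that switches slope is at most
    3 |z| on each side of z = 0. *)
Lemma interpolant_crossing p q : q.1 = p.1 -> X p < 0 -> p.2 <= 0 -> 0 < q.2 ->
  `|interpolant q - interpolant p| <= 3 * (q.2 - p.2).
Proof.
move=> qp x0 p0 q0.
have pos r : X r < 0 -> `|slope r * Num.max (wedge r) 0| <= 3 * `|r.2|.
  move=> r0; rewrite normrM; apply: ler_pM => //; first exact: slope_bounded.
  rewrite ger0_norm; last by rewrite le_max lexx orbT.
  by rewrite ge_max normr_ge0 andbT /wedge; lra.
have xq : X q < 0 by rewrite qp.
have := pos _ x0; have := pos _ xq; rewrite (gtr0_norm q0) (ler0_norm p0) => a1 a2.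
rewrite (_ : _ - _ = slope q * Num.max (wedge q) 0 - slope p * Num.max (wedge p) 0); last first.
  by rewrite /interpolant qp; ring.
by rewrite (le_trans (ler_normB _ _))//; lra.
Qed.

Lemma basis_cases (k : 'I_3) :
  [\/ basis k = (1, 0, 0) :> pt3 R, basis k = (0, 1, 0) :> pt3 R | basis k = (0, 0, 1) :> pt3 R].
Proof.
by case: k => -[|[|[|//]]] ik; rewrite /basis /=; [constructor 1|constructor 2|constructor 3].
Qed.

Lemma interpolant_lipschitz (k : 'I_3) p t : 0 < t ->
  (forall r : R, 0 <= r <= t -> O (p + r *: basis k)) ->
  `|interpolant (p + t *: basis k) - interpolant p| <= 4 * t.
Proof.
move=> t0 seg; have := basis_cases k; move: (basis k) seg => e seg ek; set q := p + t *: e.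
have side : (p.2 <= 0) = (q.2 <= 0) -> q.1.1 - p.1.1 = t /\ q.2 - p.2 = 0 \/
    q.1.1 - p.1.1 = 0 /\ 0 <= q.2 - p.2 <= t -> `|interpolant q - interpolant p| <= 4 * t.
  move=> /interpolant_same_side H [[e1 e2]|[e1 /andP[e2 e3]]]; apply: le_trans H _; rewrite e1.
    by rewrite e2 normr0 gtr0_norm//; lra.
  by rewrite normr0 ger0_norm//; lra.
case: ek => ek.
- by apply: side; [|left]; rewrite /q ek !coordE /= ?mulr0 ?mulr1 ?addr0//; split; ring.
- by apply: side; [|right]; rewrite /q ek !coordE /= ?mulr0 ?mulr1 ?addr0 ?subrr// lexx ltW.
have q1 : q.1 = p.1.
  rewrite /q ek; case: (p) => -[a b] c.
  by rewrite -[LHS]/(a + t * 0, b + t * 0) mulr0 !addr0.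
have q2 : q.2 = p.2 + t by rewrite /q ek !coordE /= mulr1.
have [p0|p0] := leP p.2 0; last first.
  by apply: side; [rewrite q2; apply/idP/idP; lra|right; rewrite q1 q2 subrr; split => //; lra].
have [q0|q0] := leP q.2 0.
  by apply: side; [rewrite p0 q0|right; rewrite q1 q2 subrr; split => //; lra].
(* A vertical segment that changes sides meets z = 0 at an interior point, which forces X < 0. *)
have O0 : O (p + (- p.2) *: (0, 0, 1)) by rewrite -ek; apply: seg; lra.
have x0 : X p < 0.
  by have := interior_section O0; rewrite !coordE /= mulr0 addr0 mulr1 subrr; exact.
by have := interpolant_crossing q1 x0 p0 q0; rewrite q2; lra.
Qed.

(** The right derivative of [interpolant] along e. At z = 0 that of |z| is [e.2], as the components
    of a basis vector are nonnegative. *)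
Definition direction_slope p (e : pt3 R) : R :=
  slopeX * e.1.1 + slope p * pos_slope (wedge p) (e.1.1 + (if p.2 < 0 then - e.2 else e.2)).

Lemma direction_slope_bounded p (k : 'I_3) : `|direction_slope p (basis k)| <= 4.
Proof.
have [sX _ _] := slopes_bounded; have sp := slope_bounded p.
rewrite (le_trans (ler_normD _ _))//.
have c1 : `|(basis k).1.1 + (if p.2 < 0 then - (basis k).2 else (basis k).2)| <= (1 : R).
  case: (basis_cases k) => ->; case: ifP => _; rewrite /= ?oppr0 ?addr0 ?add0r ?normrN ?normr0 ?normr1//.
have b1 : `|slopeX * (basis k).1.1| <= 1 * (1 : R).
  rewrite normrM; apply: ler_pM => //.
  by case: (basis_cases k) => ->; rewrite /= ?normr0 ?normr1.
have b2 : `|slope p * pos_slope (wedge p)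
    ((basis k).1.1 + (if p.2 < 0 then - (basis k).2 else (basis k).2))| <= 3 * (1 : R).
  by rewrite normrM; apply: ler_pM => //; exact: pos_slope_le.
by lra.
Qed.

Lemma interpolant_increment p (k : 'I_3) t : O p -> 0 < t ->
  (wedge p != 0 -> t < `|wedge p|) -> (p.2 != 0 -> t < `|p.2|) ->
  interpolant (p + t *: basis k) - interpolant p = t * direction_slope p (basis k).
Proof.
move=> Op t0 tw tz; set e := basis k.
have [e1 e2 e12] : [/\ 0 <= e.1.1 <= 1, 0 <= e.2 <= 1 & e.1.1 + e.2 <= 1 :> R].
  by rewrite /e; case: (basis_cases k) => -> /=; split; lra.
set c := e.1.1 + (if p.2 < 0 then - e.2 else e.2).
have c1 : `|c| <= 1.
  by rewrite ler_norml /c; case: ifP => _; lra.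
have wE : wedge (p + t *: e) = wedge p + t * c.
  rewrite /wedge !coordE (abs_right_derivative t0)//; last first.
    by move=> z0; have := tz (ltr0_neq0 z0); rewrite ltr0_norm.
  by rewrite /c; ring.
have maxE := pos_right_derivative c1 t0 tw; rewrite -wE in maxE.
(* For such small t the slope can switch only when z = 0; there [wedge] is negative and remains so,
   and both sides are zero. *)
have slE : slope (p + t *: e) * Num.max (wedge (p + t *: e)) 0 =
    slope p * Num.max (wedge (p + t *: e)) 0.
  have [z0|z0] := eqVneq p.2 0.
    have x0 := interior_section Op z0.
    have w0 : wedge p < 0 by rewrite /wedge z0 normr0 addr0.
    have := tw (ltr0_neq0 w0); rewrite ltr0_norm// => tw'.
    have tc : t * c <= t by rewrite ler_piMr ?(ltW t0)//; move: c1; rewrite ler_norml => /andP[].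
    by rewrite wE max_r ?mulr0//; lra.
  congr (_ * _); rewrite /slope !coordE.
  have te1 : t * e.2 <= t by rewrite ler_piMr ?(ltW t0)//; case/andP: e2.
  have te0 : 0 <= t * e.2 by rewrite mulr_ge0 ?(ltW t0)//; case/andP: e2.
  have := tz z0; have [z1|z1] := ltP p.2 0; first by rewrite ltr0_norm// => ?; rewrite !ifT//; lra.
  have z2 : 0 < p.2 by rewrite lt_neqAle eq_sym z0.
  by rewrite ger0_norm// => ?; rewrite !ifF//; apply/negbTE; rewrite -ltNge; lra.
rewrite /direction_slope -/e -/c /interpolant slE [RHS]mulrDr.
rewrite (mulrCA t (slope p)) -maxE !coordE.
by ring.
Qed.

Lemma interpolant_derivative p (k : 'I_3) : O p ->
  (fun n : nat => n.+1%:R * (interpolant (p + n.+1%:R^-1 *: basis k) - interpolant p)) @ \oo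
    --> direction_slope p (basis k).
Proof.
move=> Op; apply: cvg_near_cst.
have small (a : R) : \forall n \near \oo, a != 0 -> n.+1%:R^-1 < `|a|.
  have [->|a0] := eqVneq a 0; first by near=> n.
  have a1 : 0 < `|a| by rewrite normr_gt0.
  by apply: filterS (near_infty_natSinv_lt (PosNum a1)) => n.
near=> n.
rewrite interpolant_increment//; first by rewrite mulrA mulfV ?mul1r// pnatr_eq0.
- by near: n; exact: small.
- by near: n; exact: small.
Unshelve. all: by end_near. Qed.

Definition branch (a : R) p : R := value_edge + slopeX * X p + a * Num.max (wedge p) 0.

Lemma branch_continuous a : continuous (branch a).
Proof.
have cX : continuous (fun p : pt3 R => X p).
  by move=> p; apply: cvgD; [exact: fst1_continuous|exact: cvg_cst].
have c2 : continuous (fun p : pt3 R => `|p.2|).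
  by move=> p; apply: cvg_norm; exact: cvg_snd.
move=> p; apply: cvgD.
  by apply: cvgD; [exact: cvg_cst|apply: cvgM; [exact: cvg_cst|exact: cX]].
apply: cvgM; first exact: cvg_cst.
apply: (@continuous_max _ _ wedge (fun=> 0)); last exact: cvg_cst.
by apply: cvgD; [exact: cX|exact: c2].
Qed.

Lemma interpolant_measurable : measurable_fun setT (interpolant : mpt3 R -> R).
Proof.
rewrite (_ : interpolant = fun p =>
    if p.2 <= 0 then branch slope_lower p else branch slope_upper p); last first.
  by apply/funext => p; rewrite /interpolant /slope; case: ifP.
apply: measurable_fun_ifT; try exact: continuous_measurable3 (@branch_continuous _).
apply: measurable_fun_ler; last exact: measurable_cst.
by apply: continuous_measurable3 => p; exact: cvg_snd.
Qed.

(** The lower and upper parts are closed, with one formula on each. On the upper part z = 0 forces X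
    <= 0, hence [wedge p <= 0], and the two formulas agree. *)
Lemma interpolant_continuous : {within solid h s, continuous interpolant}.
Proof.
apply: withinU_continuous; [exact: polytope_closed|exact: polytope_closed| |].
- apply: (@subspace_eq_continuous _ _ _ (branch slope_lower)); last first.
    by apply: continuous_subspaceT; exact: branch_continuous.
  move=> p; rewrite inE => lp.
  suff p0 : p.2 <= 0 by rewrite /from_subspace /branch /interpolant /slope p0.
  by have := lp (0, 0, -1, 0) (mem_head _ _); rewrite /fl /=; lra.
- apply: (@subspace_eq_continuous _ _ _ (branch slope_upper)); last first.
    by apply: continuous_subspaceT; exact: branch_continuous.
  move=> p; rewrite inE => up.
  have p0 : 0 <= p.2 by have := up (0, 0, 1, 0) (mem_head _ _); rewrite /fl /=; lra.
  rewrite /from_subspace /branch /interpolant /slope; case: ifP => // p0'.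
  have z0 : p.2 = 0 by lra.
  have : 0 <= fl s (- h, 0, s, 0) p by apply: up; rewrite !inE eqxx orbT.
  rewrite /fl /= z0 => hx.
  have x0 : X p <= 0.
    by rewrite leNgt; apply/negP => x0; have := mulr_gt0 h0 x0; lra.
  by rewrite max_r ?mulr0// /wedge z0 normr0 addr0.
Qed.

Lemma weak_derivatives_interpolant :
  weak_derivatives O 1 interpolant (fun alpha p =>
    direction_slope p (alpha.1.1%:R, alpha.1.2%:R, alpha.2%:R)).
Proof.
have oO : open O by exact: open_interior.
have Obox : O `<=` @box R by apply: subset_trans (@interior_subset _ _) (solid_box hs h0 h1).
move=> alpha a1; have [k [Dk oa bk]] := @multi1_basis R _ a1; rewrite -bk.
apply: (@weak_derivative_lipschitz R O oO (finite_measure3 oO Obox) k alpha _ _ 5 4) => //.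
- exact: measurable_funTS interpolant_measurable.
- by move=> p /interior_subset; exact: interpolant_bounded.
- by move=> p t; exact: interpolant_lipschitz.
- by move=> p; exact: interpolant_derivative.
Qed.

End Interpolant.

Section BoundaryValues.
Variables (R : realType) (h s : R).
Hypothesis hs : s = 4^-1 - 2 * h.
Hypothesis h0 : 0 < h.
Hypothesis h1 : 16 * h <= 1.
Local Notation X p := (p.1.1 + s).
Implicit Types p : pt3 R.

Let s0 : 0 < s.
Proof. by have hs' := hs; have h0' := h0; have h1' := h1; lra. Qed.

Lemma interpolant_corner i : interpolant h s (corner h s i) = radius2 (corner h s i).
Proof.
have sh : s + h != 0 by rewrite gt_eqF// addr_gt0.
have h0' := h0; have s0' := s0.
rewrite /interpolant /wedge /slope /slopeX /slope_lower /slope_upper /value_edge /radius2.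
case: i => -[|[|[|[|[|[|//]]]]]] ii; rewrite /corner /=.
- by rewrite lexx normr0 max_l; [field|lra].
- by rewrite lexx normr0 max_r; [field|lra].
- by rewrite lexx normr0 max_r; [field|lra].
- rewrite ifT; last by lra.
  by rewrite normrN ger0_norm// max_r; [field|lra].
- rewrite ifF; last by apply/negbTE; rewrite -ltNge; lra.
  by rewrite ger0_norm// max_r; [rewrite mulr0; field|lra].
- rewrite ifF; last by apply/negbTE; rewrite -ltNge; lra.
  rewrite gtr0_norm// max_l; last by lra.
  by rewrite add0r; field.
Qed.

(** Three formulas occur: [below] on ABC, ABD and ACD, which bound ABCD; [outer] on BDE and CDE,
    where [wedge p <= 0]; [above] on the facets through V, where z = 0 forces X = 0. *)
Lemma interpolant_affine (F : 'I_8) : exists2 L, affine L &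
  forall p, facet_region h s F p -> interpolant h s p = L p.
Proof.
have below : (forall p, facet_region h s F p -> p.2 <= 0 /\ 0 <= X p - p.2) ->
    exists2 L, affine L & forall p, facet_region h s F p -> interpolant h s p = L p.
  move=> H; exists (fl s (slopeX s + slope_lower R, 0, - slope_lower R, value_edge s)) => [|p]; first exact: fl_affine.
  move=> /H[z0 w0]; rewrite /interpolant /slope z0 /wedge ler0_norm// max_l// /fl /=.
  by ring.
have outer : (forall p, facet_region h s F p -> X p <= p.2 /\ p.2 <= - X p) ->
    exists2 L, affine L & forall p, facet_region h s F p -> interpolant h s p = L p.
  move=> H; exists (fl s (slopeX s, 0, 0, value_edge s)) => [|p]; first exact: fl_affine.
  move=> /H[z1 z2]; have w0 : `|p.2| <= - X p by rewrite ler_norml opprK z1.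
  rewrite /interpolant /wedge max_r /fl /=; last by lra.
  by ring.
have above : (forall p, facet_region h s F p -> [/\ 0 <= p.2, 0 <= X p + p.2 & p.2 = 0 -> X p <= 0]) ->
    exists2 L, affine L & forall p, facet_region h s F p -> interpolant h s p = L p.
  move=> H; exists (fl s (slopeX s + slope_upper h s, 0, slope_upper h s, value_edge s)) => [|p]; first exact: fl_affine.
  move=> /H[z0 w0 x0]; rewrite /interpolant /slope /wedge ger0_norm// max_l// /fl /=.
  case: ifP => z1; last by ring.
  have z2 : p.2 = 0 by lra.
  have -> : X p = 0 by have := x0 z2; lra.
  by rewrite z2; ring.
have fc p := @facet_region_cond R h s hs h0 h1 F p.
move: below outer above fc; case: F => -[|[|[|[|[|[|[|[|//]]]]]]]] iF below outer above fc.
- by apply: below => p /fc[]; lra.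
- by apply: below => p /fc[]; lra.
- by apply: below => p /fc[]; lra.
- by apply: outer => p /fc[]; lra.
- by apply: outer => p /fc[]; lra.
- apply: above => p /fc[] _ _ c3 c4; have [z0 zx] := wedge_ge0 h0 s0 c3 c4.
  by split => // /zx ->.
- apply: above => p /fc[] _ _ c3 c4; have [z0 zx] := wedge_ge0 h0 s0 c3 c4.
  by split => // /zx ->.
- apply: above => p /fc[] c1 c2 _ _.
  have z0 : 0 <= p.2 by rewrite -(pmulr_rge0 _ s0) c1 pmulr_rge0.
  split => //; first by lra.
  move=> z1; move: c1; rewrite z1 mulr0 => /esym/eqP.
  by rewrite mulf_eq0 (gt_eqF h0)/= => /eqP ->.
Qed.

Lemma interpolant_boundary lam :
  @boundary_interpolant R (fan_polyhedron hs h0 h1) lam (@radius2 R) (interpolant h s).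
Proof.
move=> F; have [L aL LE] := interpolant_affine F; rewrite /triangular /=.
exists L; split => // i Fi.
by rewrite -[RHS]interpolant_corner; apply/esym/LE; exact: corner_facet.
Qed.

(** Here 19 = 3 + 4^2, with 4 the bound of [direction_slope_bounded]. *)
Lemma fan_ratio lam : exists w num den,
  [/\ harmonic_interpolant (P := fan_polyhedron hs h0 h1) lam (@radius2 R) w,
      is_seminorm (solid h s)° 1 (fun p => radius2 p - w p) num,
      is_seminorm (solid h s)° 2 (@radius2 R) den & 0 <= num / den <= 19].
Proof.
have gD := weak_derivatives_interpolant hs h0 h1.
have oO : open (solid h s)° by exact: open_interior.
have Obox : (solid h s)° `<=` @box R.
  by apply: subset_trans (@interior_subset _ _) (solid_box hs h0 h1).
have [|w [num [den [harm wg nP dP r]]]] := @harmonic_ratio R _ oO Obox _ _ 4 gD.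
  move=> alpha p /(@multi1_basis R)[k [_ _ <-]] _; exact: direction_slope_bounded.
exists w, num, den; split => //; last by move: r => /andP[-> r]; lra.
split => //; exists (interpolant h s); split => //.
- exact: interpolant_continuous.
- by eexists; exact: gD.
- exact: interpolant_boundary.
Qed.

End BoundaryValues.


(* h tends to 0 along the sequence, which keeps 16 h <= 1 *)
Definition thickness (R : realType) (n : nat) : R := n.+1%:R^-1 / 16.

Lemma thickness_gt0 (R : realType) n : 0 < thickness R n.
Proof. by rewrite divr_gt0// invr_gt0. Qed.

Lemma thickness_small (R : realType) n : 16 * thickness R n <= 1.
Proof. by rewrite /thickness mulrCA mulfV// mulr1 invf_le1// ler1n. Qed.

Lemma thickness_cvg (R : realType) : thickness R @ \oo --> (0 : R).
Proof.
rewrite -[X in _ --> X](mul0r 16^-1); apply: cvgM; last exact: cvg_cst.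
exact: cvg_harmonic.
Qed.

Definition thin_polyhedron (R : realType) (n : nat) : polyhedron R :=
  fan_polyhedron (erefl (4^-1 - 2 * thickness R n)) (thickness_gt0 R n) (thickness_small R n).

(** * The convergent subsequence *)

Lemma increasing_ge (f : nat -> nat) : {mono f : n m / (n <= m)%N} -> forall i, (i <= f i)%N.
Proof.
move=> fm; elim=> // i IH; apply: leq_ltn_trans IH _.
by rewrite ltnNge fm -ltnNge.
Qed.

Theorem lemma5p4 (R : realType)
  (lam : forall P : polyhedron R,
     'I_(nface P) -> 'I_(nvert P) -> pt3 R -> R)
  (lam_bary : forall (P : polyhedron R) (F : 'I_(nface P)),
     ~~ triangular F -> barycentric F (lam P F)) :
  let u := fun p : pt3 R => p.1.1 ^+ 2 + p.1.2 ^+ 2 in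
  exists (P : nat -> polyhedron R)
         (v : forall i, 'I_(nvert (P i)))
         (f : forall i, 'I_(nface (P i))),
    (forall i, diam (body (P i)) = 1) /\
    (forall i p, region (f i) p -> p.2 = 0) /\
    (forall i, exists2 z : R, 0 < z & vertex (v i) = (0, 0, z)) /\
    (exists2 c : R, 0 < c &
       forall i, c < dist_set (0, 0, 0) (face_boundary (f i))) /\
    (fun i => dist_set (vertex (v i)) (region (f i))) @ \oo --> (0 : R) /\
    exists (Iu : nat -> pt3 R -> R) (num den : nat -> R) (C : R),
      (forall i, harmonic_interpolant (lam (P i)) u (Iu i)) /\
      (forall i, is_seminorm (body (P i))° 1
                   (fun p => u p - Iu i p) (num i)) /\
      (forall i, is_seminorm (body (P i))° 2 u (den i)) /\
      (fun i => num i / den i) @ \oo --> C.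
Proof.
move=> u; have ratio n := fan_ratio (lam (thin_polyhedron R n)).
have [w {}ratio] := choice ratio; have [num {}ratio] := choice ratio.
have [den {}ratio] := choice ratio.
have [n_ n_inc cr] : exists2 n_ : nat -> nat, {mono n_ : n m / (n <= m)%N} &
    cvgn ((fun n => num n / den n) \o n_).
  apply: bolzano_weierstrass; exists 19; split => // M M19 n _ /=.
  by have [_ _ _ /andP[r0 r1]] := ratio n; rewrite ger0_norm// (le_trans r1)// ltW.
have n_ge := increasing_ge n_inc.
(* [ord_max] is the apex V and [ord0] the facet ABC. *)
exists (thin_polyhedron R \o n_), (fun=> ord_max), (fun=> ord0).
have E n := erefl (4^-1 - 2 * thickness R n).
have t0 := thickness_gt0 R; have t1 := thickness_small R.
split; first by move=> i; exact: solid_diam (E _) (t0 _) (t1 _).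
split; first by move=> i p; exact: base_plane (E _) (t0 _) (t1 _) p.
split; first by move=> i; exists (thickness R (n_ i)).
split; first by exists 16^-1; [rewrite invr_gt0|move=> i; exact: base_frontier_far (E _) (t0 _) (t1 _)].
split.
  apply: (@squeeze_cvgr _ _ _ _ (fun=> 0) (fun i => thickness R (n_ i))).
  - by apply: nearW => i; exact: apex_near (E _) (t0 _) (t1 _).
  - exact: cvg_cst.
  - apply: (@squeeze_cvgr _ _ _ _ (fun=> 0) (thickness R)); last exact: thickness_cvg.
      apply: nearW => i; rewrite ltW//= ler_wpM2r ?invr_ge0// lef_pV2 ?posrE//.
      by rewrite ler_nat ltnS.
    exact: cvg_cst.
exists (w \o n_), (num \o n_), (den \o n_), (lim ((fun n => num n / den n) \o n_ @ \oo)).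
by split; [|split; [|split]] => //= i; have [] := ratio (n_ i).
Qed.
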